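(* Let $X,Y$ be real nonzero Banach spaces, $T:Y\rightrightarrows Y^*$ a maximal monotone operator of Gossez type (D) with strong representative function $h_T$, and $A:X\to Y$ linear continuous with $\operatorname{pr}_Y(\operatorname{dom}h_T)\cap\operatorname{im}A\neq\emptyset$. Assume one of: (a) $0\in{}^{ic}\big(\operatorname{pr}_Y(\operatorname{dom}h_T)-\operatorname{im}A\big)$; (b) the set $\{(A^*v^*,v^{**},r): r\in\mathbb R,\ h_T^*(v^*,v^{**})\le r\}$ is closed regarding $X^*\times\operatorname{im}A^{**}\times\mathbb R$ in $(X^*,w^* )\times(Y^{**},w^* )\times\mathbb R$. Then $h:=\operatorname{cl}_{\|\cdot\|\times\|\cdot\|_*}h_T^A$ is a strong representative function of $A^*TA$, and $A^*TA:X\rightrightarrows X^*$ is maximal monotone of Gossez type (D).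
   Context: Spaces are identified with their images in their biduals. Coupling $c(y,y^* )=\langle y^*,y\rangle$. Conjugate of $h$ on $Y\times Y^*$: $h^*(y^*,y^{**})=\sup_{(y,z^* )}\{\langle y^*,y\rangle+\langle y^{**},z^*\rangle-h(y,z^* )\}$ (analogously on $X\times X^*$). Representative function of monotone $T$: convex norm-lsc $h_T$ with $h_T\ge c$ and $G(T)\subseteq\{h_T=c\}$; strong if $h_T^*(y^*,y^{**})\ge\langle y^{**},y^*\rangle$ for all. Gossez's closure $\overline T:Y^{**}\rightrightarrows Y^*$ has graph $\{(y^{**},y^* ):\langle y^{**}-z,y^*-z^*\rangle\ge0\ \forall(z,z^* )\in G(T)\}$; maximal monotone $T$ is of Gossez type (D) if each point of $G(\overline T)$ is the $w^*\times\|\cdot\|_*$-limit of a bounded net in $G(T)$. $A^*,A^{**}$ adjoint and biadjoint; $\operatorname{im}A=A(X)$; $A^*TA(x)=A^*(T(Ax))$. $h_T^A(x,x^* )=\inf\{h_T(Ax,v^* ):v^*\in Y^*,\ A^*v^*=x^*\}$. Closed regarding $W$: $\operatorname{cl}D\cap W=D\cap W$. ${}^{ic}D=\operatorname{icr}D$ if $\operatorname{aff}D$ closed, else $\emptyset$, with $\operatorname{icr}D=\{u:\forall x\in\operatorname{aff}(D-D)\ \exists\delta>0\ \forall\lambda\in[0,\delta]:u+\lambda x\in D\}$. *)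

(* Defs.v *)
From Stdlib Require Import Reals Lra List ClassicalEpsilon.
Open Scope R_scope.

Record NormedSpace := {
  carrier :> Type;
  zero : carrier;
  add : carrier -> carrier -> carrier;
  opp : carrier -> carrier;
  scal : R -> carrier -> carrier;
  norm : carrier -> R;
  add_assoc : forall x y z, add x (add y z) = add (add x y) z;
  add_comm : forall x y, add x y = add y x;
  add_zero : forall x, add x zero = x;
  add_opp : forall x, add x (opp x) = zero;
  scal_one : forall x, scal 1 x = x;
  scal_assoc : forall a b x, scal a (scal b x) = scal (a * b) x;
  scal_distr_l : forall a x y, scal a (add x y) = add (scal a x) (scal a y);
  scal_distr_r : forall a b x, scal (a + b) x = add (scal a x) (scal b x);
  norm_nonneg : forall x, 0 <= norm x;
  norm_eq0 : forall x, norm x = 0 -> x = zero;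
  norm_scal : forall a x, norm (scal a x) = Rabs a * norm x;
  norm_triangle : forall x y, norm (add x y) <= norm x + norm y;
  complete : forall u : nat -> carrier,
    (forall eps, eps > 0 -> exists N, forall m n, (N <= m)%nat -> (N <= n)%nat ->
        norm (add (u m) (opp (u n))) < eps) ->
    exists l, forall eps, eps > 0 -> exists N, forall n, (N <= n)%nat ->
        norm (add (u n) (opp l)) < eps
}.
Arguments zero {n}.
Arguments add {n} _ _.
Arguments opp {n} _.
Arguments scal {n} _ _.
Arguments norm {n} _.

Definition nonzero_space (V : NormedSpace) : Prop := exists x : V, x <> zero.

Definition is_linear_fun (V : NormedSpace) (f : V -> R) : Prop :=
  (forall x y, f (add x y) = f x + f y) /\ (forall a x, f (scal a x) = a * f x).
Definition is_bounded_fun (V : NormedSpace) (f : V -> R) : Prop :=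
  exists M, forall x, Rabs (f x) <= M * norm x.

Definition Dual (V : NormedSpace) : Type :=
  { f : V -> R | is_linear_fun V f /\ is_bounded_fun V f }.
Definition dval {V : NormedSpace} (f : Dual V) : V -> R := proj1_sig f.

Definition dnormf {V : NormedSpace} (f : V -> R) : R :=
  epsilon (inhabits 0) (fun m => is_lub (fun r => exists x : V, norm x <= 1 /\ r = Rabs (f x)) m).
Definition ddist {V : NormedSpace} (f g : Dual V) : R :=
  dnormf (fun x => dval f x - dval g x).

Definition Bidual (V : NormedSpace) : Type :=
  { phi : Dual V -> R |
    (forall f g h a b, (forall x, dval h x = a * dval f x + b * dval g x) ->
         phi h = a * phi f + b * phi g) /\
    (exists M, forall f, Rabs (phi f) <= M * dnormf (dval f)) }.
Definition bval {V : NormedSpace} (p : Bidual V) : Dual V -> R := proj1_sig p.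

Record LinCont (X Y : NormedSpace) := {
  lmap :> X -> Y;
  lmap_add : forall x y, lmap (add x y) = add (lmap x) (lmap y);
  lmap_scal : forall a x, lmap (scal a x) = scal a (lmap x);
  lmap_bnd : exists K, forall x, norm (lmap x) <= K * norm x
}.
Arguments lmap {X Y} _ _.

Lemma adj_proof (X Y : NormedSpace) (A : LinCont X Y) (v : Dual Y) :
  is_linear_fun X (fun x => dval v (lmap A x)) /\ is_bounded_fun X (fun x => dval v (lmap A x)).
Proof.
  destruct v as [f [[Hadd Hsc] [M HM]]]; unfold dval; simpl.
  destruct (lmap_bnd X Y A) as [K HK].
  split; [split|].
  - intros x y; rewrite (lmap_add X Y A); apply Hadd.
  - intros a x; rewrite (lmap_scal X Y A); apply Hsc.
  - exists (Rabs M * K); intros x.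
    apply Rle_trans with (M * norm (lmap A x)); [apply HM|].
    apply Rle_trans with (Rabs M * norm (lmap A x)).
    + apply Rmult_le_compat_r; [apply norm_nonneg | apply Rle_abs].
    + rewrite Rmult_assoc; apply Rmult_le_compat_l; [apply Rabs_pos | apply HK].
Qed.

Definition adj {X Y : NormedSpace} (A : LinCont X Y) (v : Dual Y) : Dual X :=
  exist _ (fun x => dval v (lmap A x)) (adj_proof X Y A v).

Inductive Rbar := Fin (r : R) | PInf | MInf.
Definition Rbar_le (a b : Rbar) : Prop :=
  match a, b with
  | MInf, _ => True
  | _, PInf => True
  | Fin x, Fin y => x <= y
  | _, _ => False
  end.
Definition Rbar_is_lub (S : Rbar -> Prop) (m : Rbar) : Prop :=
  (forall s, S s -> Rbar_le s m) /\ (forall b, (forall s, S s -> Rbar_le s b) -> Rbar_le m b).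
Definition Rbar_is_glb (S : Rbar -> Prop) (m : Rbar) : Prop :=
  (forall s, S s -> Rbar_le m s) /\ (forall b, (forall s, S s -> Rbar_le b s) -> Rbar_le b m).
Definition Rbar_sup (S : Rbar -> Prop) : Rbar := epsilon (inhabits PInf) (Rbar_is_lub S).
Definition Rbar_inf (S : Rbar -> Prop) : Rbar := epsilon (inhabits PInf) (Rbar_is_glb S).
Definition Rbar_rsub (r : R) (u : Rbar) : Rbar :=
  match u with Fin a => Fin (r - a) | PInf => MInf | MInf => PInf end.

Definition Fun2 (V : NormedSpace) := V -> Dual V -> Rbar.

Definition convex2 {V : NormedSpace} (h : Fun2 V) : Prop :=
  forall (y1 y2 : V) (f1 f2 f : Dual V) (r s t : R),
    Rbar_le (h y1 f1) (Fin r) -> Rbar_le (h y2 f2) (Fin s) -> 0 <= t <= 1 ->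
    (forall x, dval f x = t * dval f1 x + (1 - t) * dval f2 x) ->
    Rbar_le (h (add (scal t y1) (scal (1 - t) y2)) f) (Fin (t * r + (1 - t) * s)).

Definition lsc_hull {V : NormedSpace} (h : Fun2 V) : Fun2 V :=
  fun y f => Rbar_sup (fun s => exists eps, eps > 0 /\
     s = Rbar_inf (fun u => exists (y' : V) (f' : Dual V),
            norm (add y' (opp y)) + ddist f' f < eps /\ u = h y' f')).

Definition norm_lsc {V : NormedSpace} (h : Fun2 V) : Prop :=
  forall y f, Rbar_le (h y f) (lsc_hull h y f).

Definition conj2 {V : NormedSpace} (h : Fun2 V) (f : Dual V) (p : Bidual V) : Rbar :=
  Rbar_sup (fun s => exists (y : V) (g : Dual V),
     s = Rbar_rsub (dval f y + bval p g) (h y g)).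

Definition Oper (V : NormedSpace) := V -> Dual V -> Prop.

Definition monotone {V : NormedSpace} (T : Oper V) : Prop :=
  forall x f z g, T x f -> T z g ->
    0 <= dval f x - dval f z - dval g x + dval g z.

Definition max_monotone {V : NormedSpace} (T : Oper V) : Prop :=
  monotone T /\
  forall S : Oper V, monotone S -> (forall x f, T x f -> S x f) ->
    forall x f, S x f -> T x f.

Definition representative {V : NormedSpace} (T : Oper V) (h : Fun2 V) : Prop :=
  convex2 h /\ norm_lsc h /\
  (forall y f, Rbar_le (Fin (dval f y)) (h y f)) /\
  (forall y f, T y f -> h y f = Fin (dval f y)).

Definition strong_representative {V : NormedSpace} (T : Oper V) (h : Fun2 V) : Prop :=
  representative T h /\
  forall (f : Dual V) (p : Bidual V), Rbar_le (Fin (bval p f)) (conj2 h f p).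

(* Gossez closure: graph in V^** x V^*; <p - z, f - g> expanded bilinearly *)
Definition gossez_cl {V : NormedSpace} (T : Oper V) (p : Bidual V) (f : Dual V) : Prop :=
  forall (z : V) (g : Dual V), T z g ->
    0 <= bval p f - bval p g - dval f z + dval g z.

Definition directed_set (I : Type) (le : I -> I -> Prop) : Prop :=
  inhabited I /\ (forall i, le i i) /\ (forall i j k, le i j -> le j k -> le i k) /\
  (forall i j, exists k, le i k /\ le j k).

Definition gossez_D {V : NormedSpace} (T : Oper V) : Prop :=
  max_monotone T /\
  forall (p : Bidual V) (f : Dual V), gossez_cl T p f ->
    exists (I : Type) (le : I -> I -> Prop) (net : I -> V * Dual V),
      directed_set I le /\
      (forall i, T (fst (net i)) (snd (net i))) /\
      (exists M, forall i, norm (fst (net i)) <= M /\ dnormf (dval (snd (net i))) <= M) /\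
      (forall (g : Dual V) eps, eps > 0 -> exists i0, forall i, le i0 i ->
          Rabs (dval g (fst (net i)) - bval p g) < eps) /\
      (forall eps, eps > 0 -> exists i0, forall i, le i0 i -> ddist (snd (net i)) f < eps).

Definition compTA {X Y : NormedSpace} (A : LinCont X Y) (T : Oper Y) : Oper X :=
  fun x xs => exists v : Dual Y, T (lmap A x) v /\ adj A v = xs.

Definition hA {X Y : NormedSpace} (A : LinCont X Y) (h : Fun2 Y) : Fun2 X :=
  fun x xs => Rbar_inf (fun u => exists v : Dual Y, adj A v = xs /\ u = h (lmap A x) v).

Definition pr_dom {Y : NormedSpace} (h : Fun2 Y) (y : Y) : Prop :=
  exists f : Dual Y, h y f <> PInf.

Fixpoint lc_sum {V : NormedSpace} (l : list (R * V)) : V :=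
  match l with nil => zero | (a, v) :: l' => add (scal a v) (lc_sum l') end.
Fixpoint coef_sum {V : Type} (l : list (R * V)) : R :=
  match l with nil => 0 | (a, _) :: l' => a + coef_sum l' end.

Definition aff {V : NormedSpace} (D : V -> Prop) (x : V) : Prop :=
  exists l : list (R * V), Forall (fun p => D (snd p)) l /\ coef_sum l = 1 /\ x = lc_sum l.

Definition norm_closed {V : NormedSpace} (S : V -> Prop) : Prop :=
  forall y : V, (forall eps, eps > 0 -> exists s, S s /\ norm (add y (opp s)) < eps) -> S y.

Definition diffset {V : NormedSpace} (D1 D2 : V -> Prop) (y : V) : Prop :=
  exists a b, D1 a /\ D2 b /\ y = add a (opp b).

Definition icr {V : NormedSpace} (D : V -> Prop) (u : V) : Prop :=
  forall x, aff (diffset D D) x ->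
    exists delta, delta > 0 /\ forall l, 0 <= l <= delta -> D (add u (scal l x)).

Definition ic {V : NormedSpace} (D : V -> Prop) (u : V) : Prop :=
  norm_closed (aff D) /\ icr D u.

Definition imA {X Y : NormedSpace} (A : LinCont X Y) (y : Y) : Prop :=
  exists x, y = lmap A x.

(* image of the biadjoint: q = A'' xx, i.e. q(v) = xx(adj A v) for all v *)
Definition imA2 {X Y : NormedSpace} (A : LinCont X Y) (q : Bidual Y) : Prop :=
  exists xx : Bidual X, forall v : Dual Y, bval q v = bval xx (adj A v).

(* closure in (X', weak-star) x (Y'', weak-star) x R, via basic neighbourhoods *)
Definition wcl3 {X Y : NormedSpace} (E : Dual X -> Bidual Y -> R -> Prop)
  (a : Dual X) (b : Bidual Y) (r : R) : Prop :=
  forall (xs : list X) (fs : list (Dual Y)) eps, eps > 0 ->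
    exists a' b' r', E a' b' r' /\
      (forall x, In x xs -> Rabs (dval a' x - dval a x) < eps) /\
      (forall g, In g fs -> Rabs (bval b' g - bval b g) < eps) /\
      Rabs (r' - r) < eps.

Definition closed_regarding3 {X Y : NormedSpace} (E W : Dual X -> Bidual Y -> R -> Prop) : Prop :=
  forall a b r, (wcl3 E a b r /\ W a b r) <-> (E a b r /\ W a b r).

(* Main.v *)
(** Let [h] be convex, lower semicontinuous, with [h >= c] and [h^* >= c], where [c] is the
    coupling, and let [M = {h = c}].  Fenchel duality shows that [h - c] shifted to any base point
    plus half the squared norms has infimum at most [0]; iterating this gives the
    Brondsted-Rockafellar property (points with [h - c] small are near [M]) and the maximality
    of [M].  Penalizing only the dual variable, it gives
    [inf_M <x - p0, x' - f0> <= 0] for every [(p0, f0)] in [V'' x V'], so the convex hull [g] of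
    [c] on [M] again satisfies [g^* >= c].  If [(p0, f0)] is monotonically related to [M], the
    shift of [g] to [(p0, f0)] is nonnegative, and duality against finitely many seminorms on a
    fixed ball (using Goldstine's lemma) yields bounded points with small [g - c] near
    [(p0, f0)]; Brondsted-Rockafellar moves them into [M].  This is type (D).

    For the composition, [(h_T^A)^*] is an exact infimal composition of [h_T^*] with [A^*]:
    under (a) by Baire's theorem and a subgradient of the value function, under (b) by
    separating from the weak closure and Fenchel-Moreau.  Exactness gives [h^* >= c] and
    identifies [M] with the graph of [A^* T A]. *)

Require Import Defs.
From Stdlib Require Import Reals Lra Lia List ClassicalEpsilon FunctionalExtensionality ProofIrrelevance.
From mathcomp Require classical_sets.
Open Scope R_scope.

(** * Vector identities, duals and products *)

(** Multipliers on [V x V'] live in [V' x V''], so without reflexivity minima need not be attained,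
    and a bidual point [p0] cannot be substituted into the coupling. Infima are therefore carried as
    strict inequalities with a positive error, and a halving iteration turns a small error into a
    contact point. In the problems centred at [(p0, f0)] the primal variable stays in a fixed ball
    while a weight on the dual variable controls the terms with [p0]; the same ball later bounds the
    net.

    The passage from [h] to [g] is forced by what is known: being monotonically related to [M]
    speaks of points of [M] alone. The shifted expression is affine in point and value together, so
    its sign extends to convex combinations over [M], but not to the whole epigraph of [h].

    Functions are relations [G z r], read as: the value at [z] is at most [r]. Conjugates occur
    through their upper bounds, so infinite values need no separate arithmetic. Both qualification
    conditions meet in the property [exact_conjugate]. *)

Notation "x +v y" := (add x y) (at level 50, left associativity).
Notation "x -v y" := (add x (opp y)) (at level 50, left associativity).
Notation "a *v x" := (scal a x) (at level 40, left associativity).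

Lemma Rabs_le_inv a b : Rabs a <= b -> - b <= a <= b.
Proof. unfold Rabs; destruct (Rcase_abs a); lra. Qed.

Section VectorIdentities.
Context {V : NormedSpace}.
Implicit Types x y z : V.

Lemma add_zero_l x : zero +v x = x.
Proof. rewrite add_comm; apply add_zero. Qed.

Lemma scal_zero_l x : 0 *v x = zero.
Proof. apply norm_eq0; rewrite norm_scal, Rabs_R0; ring. Qed.

Lemma scal_zero_r a : a *v zero = zero :> V.
Proof. rewrite <- (scal_zero_l zero), scal_assoc; f_equal; ring. Qed.

Lemma opp_scal x : opp x = (-1) *v x.
Proof.
  rewrite <- (add_zero_l ((-1) *v x)), <- (add_opp V x), (add_comm V x).
  rewrite <- add_assoc.
  rewrite <- (scal_one V x) at 3.
  rewrite <- scal_distr_r.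
  replace (1 + -1) with 0 by ring.
  now rewrite scal_zero_l, add_zero.
Qed.

(** Reflected syntax: both sides of a vector identity become coefficient lists over a common list of
    atoms. *)
Inductive vexp := VVar (n : nat) | VZero | VAdd (e f : vexp) | VOpp (e : vexp) | VScal (a : R) (e : vexp).

Fixpoint veval (env : list V) (e : vexp) : V :=
  match e with
  | VVar n => nth n env zero
  | VZero => zero
  | VAdd e f => veval env e +v veval env f
  | VOpp e => opp (veval env e)
  | VScal a e => a *v veval env e
  end.

Fixpoint cunit (n : nat) : list R := match n with O => 1 :: nil | S n => 0 :: cunit n end.
Fixpoint cadd (c d : list R) : list R :=
  match c, d with
  | nil, _ => d
  | _, nil => c
  | a :: c, b :: d => (a + b) :: cadd c d
  end.
Fixpoint cscal (r : R) (c : list R) : list R :=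
  match c with nil => nil | a :: c => (r * a) :: cscal r c end.
Fixpoint coefs (e : vexp) : list R :=
  match e with
  | VVar n => cunit n
  | VZero => nil
  | VAdd e f => cadd (coefs e) (coefs f)
  | VOpp e => cscal (-1) (coefs e)
  | VScal a e => cscal a (coefs e)
  end.
Fixpoint ceq (c d : list R) : Prop :=
  match c, d with
  | nil, nil => True
  | a :: c, nil => a = 0 /\ ceq c nil
  | nil, b :: d => 0 = b /\ (fix zeros (d : list R) := match d with nil => True | b :: d => 0 = b /\ zeros d end) d
  | a :: c, b :: d => a = b /\ ceq c d
  end.
Fixpoint lcomb (env : list V) (c : list R) : V :=
  match env, c with
  | x :: env, a :: c => a *v x +v lcomb env c
  | _, _ => zero
  end.

Lemma lcomb_nil env : lcomb env nil = zero.
Proof. now destruct env. Qed.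

Lemma lcomb_unit env n : lcomb env (cunit n) = nth n env zero.
Proof.
  revert n; induction env as [|x env IH]; intros [|n]; simpl; auto.
  - now rewrite lcomb_nil, scal_one, add_zero.
  - now rewrite scal_zero_l, add_zero_l.
Qed.

Lemma lcomb_add env c d : lcomb env (cadd c d) = lcomb env c +v lcomb env d.
Proof.
  revert c d; induction env as [|x env IH]; intros c d.
  - simpl; now rewrite add_zero.
  - destruct c as [|a c], d as [|b d]; simpl; rewrite ?add_zero, ?add_zero_l; auto.
    rewrite IH, scal_distr_r, <- !add_assoc; f_equal.
    rewrite !add_assoc; f_equal; apply add_comm.
Qed.

Lemma lcomb_scal env r c : lcomb env (cscal r c) = r *v lcomb env c.
Proof.
  revert c; induction env as [|x env IH]; intros c.
  - simpl; now rewrite scal_zero_r.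
  - destruct c as [|a c]; simpl; rewrite ?scal_zero_r; auto.
    now rewrite IH, scal_distr_l, scal_assoc.
Qed.

Lemma lcomb_coefs env e : veval env e = lcomb env (coefs e).
Proof.
  induction e; simpl.
  - now rewrite lcomb_unit.
  - now rewrite lcomb_nil.
  - now rewrite lcomb_add, IHe1, IHe2.
  - now rewrite lcomb_scal, IHe, opp_scal.
  - now rewrite lcomb_scal, IHe.
Qed.

Lemma lcomb_ceq env c d : ceq c d -> lcomb env c = lcomb env d.
Proof.
  revert env d; induction c as [|a c IH]; intros env d.
  - revert env; induction d as [|b d IHd]; intros env; auto; simpl; intros [<- H].
    destruct env as [|x env]; simpl; auto.
    rewrite scal_zero_l, add_zero_l, <- IHd, lcomb_nil; auto.
    destruct d; simpl in *; auto.
  - destruct d as [|b d]; simpl; intros [-> H]; destruct env as [|x env]; simpl; auto.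
    + rewrite scal_zero_l, add_zero_l, (IH _ nil), lcomb_nil; auto.
    + now rewrite (IH _ d).
Qed.

Lemma veval_eq env e f : ceq (coefs e) (coefs f) -> veval env e = veval env f.
Proof. rewrite !lcomb_coefs; apply lcomb_ceq. Qed.
End VectorIdentities.

Ltac vmem x l :=
  match l with
  | nil => constr:(false)
  | x :: _ => constr:(true)
  | _ :: ?l => vmem x l
  end.
Ltac vindex x l :=
  match l with
  | x :: _ => constr:(O)
  | _ :: ?l => let n := vindex x l in constr:(S n)
  end.
Ltac vvars e l :=
  match e with
  | @zero _ => l
  | @add _ ?a ?b => let l := vvars a l in vvars b l
  | @opp _ ?a => vvars a l
  | @scal _ _ ?a => vvars a l
  | _ => let b := vmem e l in match b with true => l | false => constr:(e :: l) end
  end.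
Ltac vreify e l :=
  match e with
  | @zero _ => constr:(VZero)
  | @add _ ?a ?b => let a := vreify a l in let b := vreify b l in constr:(VAdd a b)
  | @opp _ ?a => let a := vreify a l in constr:(VOpp a)
  | @scal _ ?r ?a => let a := vreify a l in constr:(VScal r a)
  | _ => let n := vindex e l in constr:(VVar n)
  end.
(* Reduces an identity between vectors to identities between the coefficients. *)
Ltac vec_coefs :=
  match goal with
  | |- @eq ?T ?a ?b =>
    let V := match a with @add ?V _ _ => V | @opp ?V _ => V | @scal ?V _ _ => V
             | _ => match b with @add ?V _ _ => V | @opp ?V _ => V | @scal ?V _ _ => V end end in
    let l := vvars a (@nil (carrier V)) in
    let l := vvars b l in
    let ea := vreify a l in
    let eb := vreify b l in
    change (veval l ea = veval l eb);
    apply veval_eq; cbn [coefs cunit cadd cscal ceq]; repeat split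
  end.
Ltac vec := vec_coefs; try ring.

Section NormFacts.
Context {V : NormedSpace}.
Implicit Types x y z : V.

Lemma norm_zero : norm (zero : V) = 0.
Proof. rewrite <- (scal_zero_l zero), norm_scal, Rabs_R0; ring. Qed.

Lemma norm_opp x : norm (opp x) = norm x.
Proof. rewrite opp_scal, norm_scal, Rabs_left by lra; ring. Qed.

Lemma norm_sub_sym x y : norm (x -v y) = norm (y -v x).
Proof. rewrite <- norm_opp; f_equal; vec. Qed.

Lemma norm_sub_triangle x y z : norm (x -v z) <= norm (x -v y) + norm (y -v z).
Proof. replace (x -v z) with ((x -v y) +v (y -v z)) by vec; apply norm_triangle. Qed.

Lemma norm_le_sub x y : norm x <= norm y + norm (x -v y).
Proof. replace x with (y +v (x -v y)) at 1 by vec; apply norm_triangle. Qed.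

Lemma norm_scal_nonneg a x : 0 <= a -> norm (a *v x) = a * norm x.
Proof. intros; now rewrite norm_scal, Rabs_pos_eq. Qed.
End NormFacts.

Section DualFacts.
Context {V : NormedSpace}.
Implicit Types (f g : Dual V) (x y : V).

Lemma dval_ext f g : (forall x, dval f x = dval g x) -> f = g.
Proof.
  destruct f as [f Hf], g as [g Hg]; unfold dval; simpl; intros H.
  assert (f = g) as -> by (now apply functional_extensionality).
  now rewrite (proof_irrelevance _ Hf Hg).
Qed.

Lemma dval_add f x y : dval f (x +v y) = dval f x + dval f y.
Proof. destruct f as [f [[H1 H2] H3]]; apply H1. Qed.
Lemma dval_scal f a x : dval f (a *v x) = a * dval f x.
Proof. destruct f as [f [[H1 H2] H3]]; apply H2. Qed.
Lemma dval_opp f x : dval f (opp x) = - dval f x.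
Proof. rewrite opp_scal, dval_scal; ring. Qed.
Lemma dval_zero f : dval f zero = 0.
Proof. rewrite <- (scal_zero_l zero), dval_scal; ring. Qed.

Lemma dnormf_lub f : is_lub (fun r => exists x : V, norm x <= 1 /\ r = Rabs (dval f x)) (dnormf (dval f)).
Proof.
  unfold dnormf; apply epsilon_spec.
  destruct f as [f [[Hadd Hsc] [M HM]]]; unfold dval; simpl.
  destruct (completeness (fun r => exists x : V, norm x <= 1 /\ r = Rabs (f x))) as [m Hm].
  - exists (Rabs M); intros r [x [Hx ->]].
    apply Rle_trans with (M * norm x); [apply HM|].
    pose proof (Rle_abs M); pose proof (norm_nonneg V x); pose proof (Rabs_pos M); nra.
  - exists (Rabs (f zero)), zero; rewrite norm_zero; split; [lra | auto].
  - now exists m.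
Qed.

Lemma dnormf_nonneg f : 0 <= dnormf (dval f).
Proof.
  destruct (dnormf_lub f) as [H _].
  apply Rle_trans with (Rabs (dval f zero)); [apply Rabs_pos|].
  apply H; exists zero; rewrite norm_zero; split; [lra | auto].
Qed.

Lemma dval_bound f x : Rabs (dval f x) <= dnormf (dval f) * norm x.
Proof.
  destruct (norm_nonneg V x) as [Hx|Hx].
  - destruct (dnormf_lub f) as [H _].
    assert (Rabs (dval f ((/ norm x) *v x)) <= dnormf (dval f)) as H1.
    { apply H; exists ((/ norm x) *v x); split; auto.
      rewrite norm_scal_nonneg by (left; now apply Rinv_0_lt_compat).
      right; field; lra. }
    rewrite dval_scal, Rabs_mult, (Rabs_pos_eq (/ norm x)) in H1
      by (left; now apply Rinv_0_lt_compat).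
    apply Rmult_le_compat_r with (r := norm x) in H1; [|lra].
    replace (/ norm x * Rabs (dval f x) * norm x) with (Rabs (dval f x)) in H1 by (field; lra).
    exact H1.
  - rewrite (norm_eq0 V x), dval_zero, norm_zero, Rabs_R0 by auto; lra.
Qed.

Lemma dval_le f x : dval f x <= dnormf (dval f) * norm x.
Proof. eapply Rle_trans; [apply Rle_abs | apply dval_bound]. Qed.
Lemma dval_ge f x : - (dnormf (dval f) * norm x) <= dval f x.
Proof. pose proof (dval_bound f x) as H; apply Rabs_le_inv in H; lra. Qed.

Lemma dnormf_le f M : 0 <= M -> (forall x, dval f x <= M * norm x) -> dnormf (dval f) <= M.
Proof.
  intros HM H; apply (dnormf_lub f); intros r [x [Hx ->]].
  pose proof (norm_nonneg V x).
  apply Rabs_le; split.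
  - pose proof (H (opp x)) as H1; rewrite dval_opp, norm_opp in H1; nra.
  - pose proof (H x); nra.
Qed.

Lemma dnormf_approx f eps : 0 < eps -> exists x, norm x <= 1 /\ dnormf (dval f) - eps < dval f x.
Proof.
  intros Heps; apply NNPP; intros Hn.
  assert (dnormf (dval f) <= dnormf (dval f) - eps); [|lra].
  apply (dnormf_lub f); intros r [x [Hx ->]].
  apply Rabs_le; split; apply Rnot_lt_le; intros H; apply Hn.
  - exists (opp x); rewrite norm_opp, dval_opp; lra.
  - exists x; lra.
Qed.

Lemma dlin_proof (a b : R) f g :
  is_linear_fun V (fun x => a * dval f x + b * dval g x) /\
  is_bounded_fun V (fun x => a * dval f x + b * dval g x).
Proof.
  split; [split|].
  - intros x y; rewrite !dval_add; ring.
  - intros c x; rewrite !dval_scal; ring.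
  - exists (Rabs a * dnormf (dval f) + Rabs b * dnormf (dval g)); intros x.
    eapply Rle_trans; [apply Rabs_triang|]; rewrite !Rabs_mult, Rmult_plus_distr_r, !Rmult_assoc.
    apply Rplus_le_compat; apply Rmult_le_compat_l; auto using Rabs_pos, dval_bound.
Qed.

Lemma dadd_proof f g :
  is_linear_fun V (fun x => dval f x + dval g x) /\ is_bounded_fun V (fun x => dval f x + dval g x).
Proof.
  replace (fun x => dval f x + dval g x) with (fun x => 1 * dval f x + 1 * dval g x);
    [apply dlin_proof | apply functional_extensionality; intros; ring].
Qed.
Lemma dopp_proof f : is_linear_fun V (fun x => - dval f x) /\ is_bounded_fun V (fun x => - dval f x).
Proof.
  replace (fun x => - dval f x) with (fun x => -1 * dval f x + 0 * dval f x);
    [apply dlin_proof | apply functional_extensionality; intros; ring].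
Qed.
Lemma dscal_proof a f : is_linear_fun V (fun x => a * dval f x) /\ is_bounded_fun V (fun x => a * dval f x).
Proof.
  replace (fun x => a * dval f x) with (fun x => a * dval f x + 0 * dval f x);
    [apply dlin_proof | apply functional_extensionality; intros; ring].
Qed.
Lemma dzero_proof : is_linear_fun V (fun _ => 0) /\ is_bounded_fun V (fun _ => 0).
Proof.
  split; [split|]; intros; try ring.
  exists 0; intros; rewrite Rabs_R0; lra.
Qed.

Definition dadd f g : Dual V := exist _ _ (dadd_proof f g).
Definition dopp f : Dual V := exist _ _ (dopp_proof f).
Definition dscal a f : Dual V := exist _ _ (dscal_proof a f).
Definition dzero : Dual V := exist _ _ dzero_proof.

Definition dnorm f := dnormf (dval f).

Lemma dnorm_eq0 f : dnorm f = 0 -> f = dzero.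
Proof.
  intros H; apply dval_ext; intros x; simpl.
  pose proof (dval_bound f x) as H1; unfold dnorm in H; rewrite H in H1.
  change (dval f x = 0).
  apply Rabs_le_inv in H1; lra.
Qed.

Lemma dnorm_scal_le a f : dnorm (dscal a f) <= Rabs a * dnorm f.
Proof.
  apply dnormf_le.
  - apply Rmult_le_pos; [apply Rabs_pos | apply dnormf_nonneg].
  - intros x; change (a * dval f x <= Rabs a * dnorm f * norm x).
    eapply Rle_trans; [apply Rle_abs|].
    rewrite Rabs_mult, Rmult_assoc; apply Rmult_le_compat_l; [apply Rabs_pos | apply dval_bound].
Qed.

Lemma dnorm_scal a f : dnorm (dscal a f) = Rabs a * dnorm f.
Proof.
  apply Rle_antisym; [apply dnorm_scal_le|].
  destruct (Req_dec a 0) as [->|Ha].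
  - rewrite Rabs_R0, Rmult_0_l; apply dnormf_nonneg.
  - assert (f = dscal (/ a) (dscal a f)) as E.
    { apply dval_ext; intros x; change (dval f x = / a * (a * dval f x)); field; auto. }
    rewrite E at 1.
    eapply Rle_trans; [apply Rmult_le_compat_l; [apply Rabs_pos | apply dnorm_scal_le]|].
    rewrite <- Rmult_assoc, <- Rabs_mult, Rinv_r, Rabs_R1 by auto; lra.
Qed.

Lemma dnorm_triangle f g : dnorm (dadd f g) <= dnorm f + dnorm g.
Proof.
  apply dnormf_le.
  - pose proof (dnormf_nonneg f); pose proof (dnormf_nonneg g); unfold dnorm; lra.
  - intros x; change (dval f x + dval g x <= (dnorm f + dnorm g) * norm x).
    pose proof (dval_le f x); pose proof (dval_le g x); unfold dnorm; lra.
Qed.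

Lemma dual_complete (u : nat -> Dual V) :
  (forall eps, eps > 0 -> exists N, forall m n, (N <= m)%nat -> (N <= n)%nat ->
     dnorm (dadd (u m) (dopp (u n))) < eps) ->
  exists l, forall eps, eps > 0 -> exists N, forall n, (N <= n)%nat -> dnorm (dadd (u n) (dopp l)) < eps.
Proof.
  intros HC.
  assert (forall m n x, dval (u m) x - dval (u n) x <= dnorm (dadd (u m) (dopp (u n))) * norm x) as Hd.
  { intros m n x; exact (dval_le (dadd (u m) (dopp (u n))) x). }
  assert (forall x, exists l, Un_cv (fun n => dval (u n) x) l) as Hpt.
  { intros x; destruct (R_complete (fun n => dval (u n) x)) as [l Hl]; [|now exists l].
    intros eps Heps.
    pose proof (norm_nonneg V x).
    destruct (HC (eps / (norm x + 1))) as [N HN]; [apply Rdiv_lt_0_compat; lra|].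
    exists N; intros n m Hn Hm; unfold Rdist.
    assert (forall m n, (n >= N)%nat -> (m >= N)%nat -> dval (u m) x - dval (u n) x < eps) as Hlt.
    { clear n m Hn Hm; intros n m Hn Hm.
      eapply Rle_lt_trans; [apply Hd|].
      assert (dnorm (dadd (u n) (dopp (u m))) * (norm x + 1) < eps).
      { replace eps with (eps / (norm x + 1) * (norm x + 1)) by (field; lra).
        apply Rmult_lt_compat_r; [lra | auto]. }
      pose proof (dnormf_nonneg (dadd (u n) (dopp (u m)))); unfold dnorm in *; nra. }
    apply Rabs_def1; [apply Hlt; auto|].
    pose proof (Hlt m n Hn Hm); lra. }
  destruct (choice (fun x l => Un_cv (fun n => dval (u n) x) l) Hpt) as [l Hl].
  (* Letting [m] grow in the Cauchy bound replaces [u m] by the pointwise limit, at the cost of a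
     slack [d] that is then removed. *)
  assert (forall eps, eps > 0 -> exists N, forall n x, (N <= n)%nat ->
            dval (u n) x - l x <= eps * norm x /\ l x - dval (u n) x <= eps * norm x) as Hunif.
  { intros eps Heps; destruct (HC eps Heps) as [N HN]; exists N; intros n x Hn.
    assert (forall d, d > 0 ->
      dval (u n) x - l x <= eps * norm x + d /\ l x - dval (u n) x <= eps * norm x + d) as Hd'.
    { intros d Hdpos; destruct (Hl x d Hdpos) as [M HM].
      set (m := max N M); assert (N <= m)%nat as Hm1 by (unfold m; lia).
      assert (M <= m)%nat as Hm2 by (unfold m; lia).
      specialize (HM m Hm2); unfold Rdist in HM; apply Rabs_def2 in HM.
      pose proof (Hd n m x) as H1; pose proof (Hd m n x) as H2.
      pose proof (HN n m Hn Hm1); pose proof (HN m n Hm1 Hn); pose proof (norm_nonneg V x).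
      split; nra. }
    split; apply Rnot_lt_le; intros Hlt.
    - destruct (Hd' ((dval (u n) x - l x - eps * norm x) / 2)); lra.
    - destruct (Hd' ((l x - dval (u n) x - eps * norm x) / 2)); lra. }
  assert (is_linear_fun V l /\ is_bounded_fun V l) as Pl.
  { split; [split|].
    - intros x y; eapply UL_sequence; [apply Hl|].
      eapply Un_cv_ext; [|apply CV_plus; [apply (Hl x) | apply (Hl y)]].
      intros n; simpl; now rewrite dval_add.
    - intros a x; eapply UL_sequence; [apply Hl|].
      assert (Un_cv (fun _ : nat => a) a) as Ha.
      { intros eps Heps; exists O; intros; unfold Rdist; rewrite Rminus_diag, Rabs_R0; auto. }
      eapply Un_cv_ext; [|apply (CV_mult _ _ _ _ Ha (Hl x))].
      intros n; simpl; now rewrite dval_scal.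
    - destruct (Hunif 1) as [N HN]; [lra|].
      exists (dnorm (u N) + 1); intros x.
      destruct (HN N x (Nat.le_refl N)) as [H1 H2].
      pose proof (dval_le (u N) x); pose proof (dval_ge (u N) x); unfold dnorm.
      apply Rabs_le; lra. }
  exists (exist _ l Pl); intros eps Heps.
  destruct (Hunif (eps / 2)) as [N HN]; [lra|].
  exists N; intros n Hn.
  apply Rle_lt_trans with (eps / 2); [|lra].
  apply dnormf_le; [lra|].
  intros x; exact (proj1 (HN n x Hn)).
Qed.
End DualFacts.

Definition dual_space (V : NormedSpace) : NormedSpace.
Proof.
  refine {| carrier := Dual V; zero := dzero; add := dadd; opp := dopp; scal := dscal; norm := dnorm |}.
  1-8: abstract (intros; apply dval_ext; intros; unfold dval; simpl; unfold dval; simpl; ring).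
  - exact dnormf_nonneg.
  - apply dnorm_eq0.
  - apply dnorm_scal.
  - apply dnorm_triangle.
  - apply dual_complete.
Defined.
Canonical dual_space.
Arguments dual_space : simpl never.

Section DualOperations.
Context {V : NormedSpace}.
Lemma dval_dadd (f g : Dual V) x : dval (f +v g) x = dval f x + dval g x.
Proof. reflexivity. Qed.
Lemma dval_dopp (f : Dual V) x : dval (opp f) x = - dval f x.
Proof. reflexivity. Qed.
Lemma dval_dscal a (f : Dual V) x : dval (a *v f) x = a * dval f x.
Proof. reflexivity. Qed.
Lemma dval_norm_le (f : Dual V) x : dval f x <= norm f * norm x.
Proof. apply dval_le. Qed.
Lemma dval_norm_ge (f : Dual V) x : - (norm f * norm x) <= dval f x.
Proof. apply dval_ge. Qed.
End DualOperations.

Section Product.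
Variables V W : NormedSpace.

Lemma prod_complete (u : nat -> V * W) :
  (forall eps, eps > 0 -> exists N, forall m n, (N <= m)%nat -> (N <= n)%nat ->
     norm (fst (u m) -v fst (u n)) + norm (snd (u m) -v snd (u n)) < eps) ->
  exists l : V * W, forall eps, eps > 0 -> exists N, forall n, (N <= n)%nat ->
     norm (fst (u n) -v fst l) + norm (snd (u n) -v snd l) < eps.
Proof.
  intros HC.
  destruct (complete V (fun n => fst (u n))) as [a Ha].
  { intros eps Heps; destruct (HC eps Heps) as [N HN]; exists N; intros m n Hm Hn.
    pose proof (HN m n Hm Hn); pose proof (norm_nonneg W (snd (u m) -v snd (u n))); lra. }
  destruct (complete W (fun n => snd (u n))) as [b Hb].
  { intros eps Heps; destruct (HC eps Heps) as [N HN]; exists N; intros m n Hm Hn.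
    pose proof (HN m n Hm Hn); pose proof (norm_nonneg V (fst (u m) -v fst (u n))); lra. }
  exists (a, b); intros eps Heps.
  destruct (Ha (eps / 2)) as [N1 H1]; [lra|].
  destruct (Hb (eps / 2)) as [N2 H2]; [lra|].
  exists (max N1 N2); intros n Hn; simpl.
  specialize (H1 n ltac:(lia)); specialize (H2 n ltac:(lia)); lra.
Qed.

(** On [V x V'] the sum of the norms is the distance that [lsc_hull] uses. *)
Definition prod_space : NormedSpace.
Proof.
  refine {| carrier := (carrier V * carrier W)%type; zero := (zero, zero);
    add := fun p q => (fst p +v fst q, snd p +v snd q);
    opp := fun p => (opp (fst p), opp (snd p));
    scal := fun a p => (a *v fst p, a *v snd p);
    norm := fun p => norm (fst p) + norm (snd p) |}.
  1-8: abstract (intros; repeat match goal with p : (_ * _)%type |- _ => destruct p end; simpl; f_equal; vec).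
  - abstract (intros [x y]; pose proof (norm_nonneg V x); pose proof (norm_nonneg W y); simpl; lra).
  - abstract (intros [x y]; pose proof (norm_nonneg V x); pose proof (norm_nonneg W y); simpl; intros;
      f_equal; apply norm_eq0; lra).
  - abstract (intros a [x y]; simpl; rewrite !norm_scal; ring).
  - abstract (intros [x y] [x' y']; simpl;
      pose proof (norm_triangle V x x'); pose proof (norm_triangle W y y'); lra).
  - apply prod_complete.
Defined.
End Product.
Canonical prod_space.
Arguments prod_space : simpl never.

Section ProductOperations.
Context {V W : NormedSpace}.
Implicit Types z w : prod_space V W.
Lemma fst_add z w : fst (z +v w) = fst z +v fst w. Proof. reflexivity. Qed.
Lemma snd_add z w : snd (z +v w) = snd z +v snd w. Proof. reflexivity. Qed.
Lemma fst_opp z : fst (opp z) = opp (fst z). Proof. reflexivity. Qed.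
Lemma snd_opp z : snd (opp z) = opp (snd z). Proof. reflexivity. Qed.
Lemma fst_scal a z : fst (a *v z) = a *v fst z. Proof. reflexivity. Qed.
Lemma snd_scal a z : snd (a *v z) = a *v snd z. Proof. reflexivity. Qed.
Lemma norm_prod z : norm z = norm (fst z) + norm (snd z). Proof. reflexivity. Qed.
Lemma pair_eq z w : fst z = fst w -> snd z = snd w -> z = w.
Proof. destruct z, w; simpl; congruence. Qed.
End ProductOperations.

Definition real_space : NormedSpace.
Proof.
  refine {| carrier := R; zero := 0; add := Rplus; opp := Ropp; scal := Rmult; norm := Rabs |}.
  1-8: abstract (intros; ring).
  - apply Rabs_pos.
  - abstract (intros x H; destruct (Req_dec x 0); auto; now apply Rabs_no_R0 in H).
  - apply Rabs_mult.
  - apply Rabs_triang.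
  - abstract (intros u Hu; destruct (R_complete u) as [l Hl];
      [ intros eps Heps; destruct (Hu eps Heps) as [N HN]; exists N; intros n m Hn Hm; now apply HN
      | exists l; intros eps Heps; destruct (Hl eps Heps) as [N HN]; exists N; intros n Hn; now apply HN]).
Defined.
Canonical real_space.
Arguments real_space : simpl never.

Ltac proj_ops :=
  repeat progress (rewrite ?fst_add, ?snd_add, ?fst_opp, ?snd_opp, ?fst_scal, ?snd_scal); cbn [fst snd].
Ltac pair_vec := apply pair_eq; proj_ops; vec.

(** * Hahn-Banach and the sandwich theorem *)

Lemma inf_exists (E : R -> Prop) (m : R) :
  (exists e, E e) -> (forall e, E e -> m <= e) ->
  exists i, (forall e, E e -> i <= e) /\ (forall b, i < b -> exists e, E e /\ e < b).
Proof.
  intros [e0 He0] Hm.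
  destruct (completeness (fun r => E (- r))) as [s [Hs1 Hs2]].
  - exists (- m); intros r Hr; specialize (Hm _ Hr); lra.
  - exists (- e0); now rewrite Ropp_involutive.
  - exists (- s); split.
    + intros e He; assert (- e <= s); [|lra].
      apply Hs1; now rewrite Ropp_involutive.
    + intros b Hb; apply NNPP; intros Hn.
      assert (s <= - b); [|lra].
      apply Hs2; intros r Hr; apply Rnot_lt_le; intros Hlt; apply Hn.
      exists (- r); split; [auto | lra].
Qed.

Section HahnBanach.
Variable V : NormedSpace.

Definition sublinear (p : V -> R) : Prop :=
  (forall x y, p (x +v y) <= p x + p y) /\ (forall a x, 0 < a -> p (a *v x) <= a * p x).

Lemma sublinear_scal p a x : sublinear p -> 0 < a -> p (a *v x) = a * p x.
Proof.
  intros [_ H] Ha; apply Rle_antisym; auto.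
  pose proof (Rinv_0_lt_compat a Ha) as Hi.
  pose proof (H (/ a) (a *v x) Hi) as H1.
  replace (/ a *v (a *v x)) with x in H1 by (vec; field; lra).
  apply (Rmult_le_compat_l a) in H1; [|lra].
  rewrite <- Rmult_assoc, Rinv_r, Rmult_1_l in H1; lra.
Qed.

Lemma sublinear_zero p : sublinear p -> p zero = 0.
Proof.
  intros H; pose proof (sublinear_scal p 2 zero H ltac:(lra)) as H1.
  rewrite scal_zero_r in H1; lra.
Qed.

(* Pointwise infimum: [E x] is the set of competitors at [x]. *)
Lemma sublinear_envelope (E : V -> R -> Prop) :
  (forall x, exists c, E x c) ->
  (forall x y a b, E x a -> E y b -> exists c, E (x +v y) c /\ c <= a + b) ->
  (forall t x a, 0 < t -> E x a -> exists c, E (t *v x) c /\ c <= t * a) ->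
  (forall c, E zero c -> 0 <= c) ->
  exists p, sublinear p /\ (forall x c, E x c -> p x <= c) /\
            (forall x b, p x < b -> exists c, E x c /\ c < b).
Proof.
  intros Hne Hadd Hscal H0.
  destruct (choice (fun x i => (forall e, E x e -> i <= e) /\ (forall b, i < b -> exists e, E x e /\ e < b)))
    as [p Hp].
  (* A competitor [c] at [opp x] bounds those at [x] below by [- c], since each sum dominates a
     competitor at [zero]. *)
  { intros x; destruct (Hne (opp x)) as [c Hc].
    apply inf_exists with (- c); auto.
    intros e He; destruct (Hadd _ _ _ _ He Hc) as [d [Hd Hle]].
    rewrite add_opp in Hd; specialize (H0 _ Hd); lra. }
  exists p; split; [split|split].
  - intros x y; apply Rnot_lt_le; intros Hlt.
    set (e := (p (x +v y) - (p x + p y)) / 2).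
    destruct (proj2 (Hp x) (p x + e)) as [a [Ha Ha']]; [unfold e; lra|].
    destruct (proj2 (Hp y) (p y + e)) as [b [Hb Hb']]; [unfold e; lra|].
    destruct (Hadd _ _ _ _ Ha Hb) as [c [Hc Hc']].
    pose proof (proj1 (Hp _) _ Hc); unfold e in *; lra.
  - intros t x Ht; apply Rnot_lt_le; intros Hlt.
    destruct (proj2 (Hp x) (p (t *v x) / t)) as [a [Ha Ha']].
    { apply (Rmult_lt_reg_l t); auto; replace (t * (p (t *v x) / t)) with (p (t *v x)) by (field; lra); lra. }
    destruct (Hscal _ _ _ Ht Ha) as [c [Hc Hc']].
    pose proof (proj1 (Hp _) _ Hc).
    apply (Rmult_lt_compat_l t) in Ha'; auto.
    replace (t * (p (t *v x) / t)) with (p (t *v x)) in Ha' by (field; lra); lra.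
  - intros x; apply (proj1 (Hp x)).
  - intros x; apply (proj2 (Hp x)).
Qed.

(* A minimal sublinear functional is linear: compare [q] with the sublinear
   functional [z |-> inf_(t >= 0) (q (z + t y) - t q y)]. *)
Theorem hahn_banach (p : V -> R) :
  sublinear p -> exists l, is_linear_fun V l /\ forall x, l x <= p x.
Proof.
  intros Hp.
  pose (T := {q : V -> R | sublinear q /\ forall x, q x <= p x}).
  (* The order is reversed, so that a maximal element in Zorn's lemma is a minimal sublinear
     functional. *)
  pose (below := fun s t : T => forall x, proj1_sig t x <= proj1_sig s x).
  pose (rel := fun s t : T => if excluded_middle_informative (below s t) then true else false).
  assert (forall s t, rel s t = true <-> below s t) as Hrel.
  { intros s t; unfold rel; destruct (excluded_middle_informative (below s t)); split; auto; discriminate. }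
  destruct (@classical_sets.Zorn T rel) as [[q [Hq Hqp]] Hmin].
  - intros t; apply Hrel; intros x; lra.
  - intros r s t H1 H2; apply Hrel; apply Hrel in H1, H2.
    intros x; specialize (H1 x); specialize (H2 x); lra.
  - intros [s Hs] [t Ht] H1 H2; apply Hrel in H1, H2.
    assert (s = t) as ->.
    { apply functional_extensionality; intros x; apply Rle_antisym; [apply H2 | apply H1]. }
    now rewrite (proof_irrelevance _ Hs Ht).
  - intros A HA.
    destruct (classic (exists s, A s)) as [[s0 Hs0]|Hn].
    2: { exists (exist _ p (conj Hp (fun x => Rle_refl (p x)))); intros s Hs; exfalso; apply Hn; now exists s. }
    (* The infimum of a chain is subadditive because one of any two members lies below the other,
       and finite because all members vanish at [zero]. *)
    destruct (sublinear_envelope (fun x c => exists s, A s /\ c = proj1_sig s x)) as [q [Hq1 [Hq2 _]]].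
    + intros x; eauto.
    + intros x y a b [s [Hs ->]] [t [Ht ->]].
      destruct (HA _ _ Hs Ht) as [H|H]; apply Hrel in H;
        [exists (proj1_sig t (x +v y)) | exists (proj1_sig s (x +v y))].
      * split; [eauto|].
        pose proof (proj1 (proj1 (proj2_sig t)) x y); pose proof (H x); lra.
      * split; [eauto|].
        pose proof (proj1 (proj1 (proj2_sig s)) x y); pose proof (H y); lra.
    + intros t x a Ht [s [Hs ->]]; exists (proj1_sig s (t *v x)); split; eauto.
      now apply (proj2_sig s).
    + intros c [[s [Ps Ps']] [_ ->]]; simpl; rewrite (sublinear_zero s); auto; lra.
    + assert (forall x, q x <= p x) as Hq3.
      { intros x; eapply Rle_trans; [apply Hq2; eauto|]; apply (proj2 (proj2_sig s0)). }
      exists (exist _ q (conj Hq1 Hq3)); intros s Hs; apply Hrel; intros x; simpl; eauto.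
  - exists q; split; auto.
    assert (forall y, q (opp y) <= - q y) as Hopp.
    { intros y.
      destruct (sublinear_envelope (fun z c => exists t, 0 <= t /\ c = q (z +v t *v y) - t * q y))
        as [r [Hr1 [Hr2 _]]].
      - intros x; exists (q (x +v 0 *v y) - 0 * q y); exists 0; split; [lra | auto].
      - intros x z a b [t [Ht ->]] [s [Hs ->]]; eexists; split.
        + exists (t + s); split; [lra | reflexivity].
        + replace (x +v z +v (t + s) *v y) with ((x +v t *v y) +v (z +v s *v y)) by vec.
          pose proof (proj1 Hq (x +v t *v y) (z +v s *v y)); lra.
      - intros a x b Ha [t [Ht ->]]; eexists; split.
        + exists (a * t); split; [nra | reflexivity].
        + replace (a *v x +v (a * t) *v y) with (a *v (x +v t *v y)) by vec.
          rewrite (sublinear_scal q) by auto; lra.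
      - intros c [t [[Ht|<-] ->]].
        + rewrite add_zero_l, (sublinear_scal q) by auto; lra.
        + rewrite add_zero_l, scal_zero_l, (sublinear_zero q) by auto; lra.
      - assert (forall x, r x <= q x) as Hrq.
        { intros x; apply Hr2; exists 0; split; [lra|].
          rewrite scal_zero_l, add_zero; ring. }
        assert (forall x, r x <= p x) as Hrp by (intros x; eapply Rle_trans; eauto).
        specialize (Hmin (exist _ r (conj Hr1 Hrp))).
        (* Minimality identifies [r] with [q]; the competitor [t = 1] at [opp y] then gives
           [q (opp y) <= - q y]. *)
        assert (r = q) as ->.
        { assert (rel (exist _ q (conj Hq Hqp)) (exist _ r (conj Hr1 Hrp)) = true) as Hb by now apply Hrel.
          apply Hmin in Hb; now apply (f_equal (@proj1_sig _ _)) in Hb. }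
        apply Hr2; exists 1; split; [lra|].
        replace (opp y +v 1 *v y) with (zero : V) by vec.
        rewrite (sublinear_zero q); auto; ring. }
    assert (forall y, q (opp y) = - q y) as Hopp'.
    { intros y; apply Rle_antisym; auto.
      pose proof (proj1 Hq y (opp y)) as H; rewrite add_opp, (sublinear_zero q) in H by auto; lra. }
    split.
    + intros x y; apply Rle_antisym; [apply Hq|].
      pose proof (proj1 Hq (x +v y) (opp y)) as H; rewrite Hopp' in H.
      replace (x +v y -v y) with x in H by vec; lra.
    + intros a x; destruct (Rtotal_order a 0) as [Ha|[->|Ha]].
      * replace (a *v x) with (opp ((- a) *v x)) by vec.
        rewrite Hopp', (sublinear_scal q) by (auto; lra); ring.
      * rewrite scal_zero_l, (sublinear_zero q); auto; ring.
      * apply sublinear_scal; auto.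
Qed.

Lemma bounded_of_ball (l : V -> R) (d C : R) :
  is_linear_fun V l -> 0 < d -> (forall z, norm z <= d -> l z <= C) -> is_bounded_fun V l.
Proof.
  intros [Hadd Hsc] Hd H.
  assert (forall x, l (opp x) = - l x) as Hopp.
  { intros x; rewrite opp_scal, Hsc; ring. }
  assert (0 <= C) as HC.
  { rewrite <- (Rmult_0_l (l zero)), <- Hsc, scal_zero_l; apply H; rewrite norm_zero; lra. }
  assert (forall x, l x <= C / d * norm x) as Hle.
  { intros x; destruct (norm_nonneg V x) as [Hx|Hx].
    - pose proof (Rdiv_lt_0_compat d (norm x) Hd Hx) as Hp.
      assert (l ((d / norm x) *v x) <= C) as H1.
      { apply H; rewrite norm_scal_nonneg by lra; right; field; lra. }
      rewrite Hsc in H1.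
      apply (Rmult_le_reg_l (d / norm x)); auto.
      replace (d / norm x * (C / d * norm x)) with C by (field; lra); auto.
    - rewrite (norm_eq0 V x), norm_zero by auto.
      rewrite <- (scal_zero_l zero), Hsc; lra. }
  exists (C / d); intros x; apply Rabs_le; split; auto.
  pose proof (Hle (opp x)) as H1; rewrite Hopp, norm_opp in H1; lra.
Qed.
End HahnBanach.

Definition convex_rel {V : NormedSpace} (G : V -> R -> Prop) : Prop :=
  forall x y a b t, 0 <= t <= 1 -> G x a -> G y b ->
    G (t *v x +v (1 - t) *v y) (t * a + (1 - t) * b).

(** Hahn-Banach is applied to the sublinear functional [inf t (G w + Q (w + z / t))] over [t > 0]
    and [w]. Positivity of [G + Q] bounds it below at the origin; the ball on which [Q] is bounded
    makes it finite everywhere and the resulting functional continuous. Comparing arbitrary [w] and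
    [z] in the conclusion replaces a separating constant. *)
Lemma sandwich (V : NormedSpace) (G Q : V -> R -> Prop) (w0 : V) (r0 s0 d : R) :
  convex_rel G -> convex_rel Q ->
  (forall w r s, G w r -> Q w s -> 0 <= r + s) ->
  G w0 r0 -> 0 < d -> (forall z, norm z <= d -> Q (w0 +v z) s0) ->
  exists l : Dual V, forall w r z s, G w r -> Q z s -> dval l z - dval l w <= r + s.
Proof.
  intros HG HQ Hpos HG0 Hd HQ0.
  destruct (sublinear_envelope V (fun z c => exists t w r s, 0 < t /\ G w r /\ Q (w +v / t *v z) s /\ c = t * (r + s)))
    as [p [Hp [Hp1 _]]].
  - intros z.
    (* With this [t] the vector [z / t] has norm at most [d]. *)
    set (t := norm z / d + 1).
    assert (0 < t) as Ht.
    { pose proof (norm_nonneg V z); unfold t.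
      assert (0 <= norm z / d) by (apply Rmult_le_pos; [lra | left; now apply Rinv_0_lt_compat]); lra. }
    exists (t * (r0 + s0)), t, w0, r0, s0; repeat split; auto.
    apply HQ0; rewrite norm_scal_nonneg by (left; now apply Rinv_0_lt_compat).
    apply (Rmult_le_reg_l t); auto.
    rewrite <- Rmult_assoc, Rinv_r, Rmult_1_l by lra.
    unfold t; replace ((norm z / d + 1) * d) with (norm z + d) by (field; lra); lra.
  - intros x y a b [t [w [r [s [Ht [HGw [HQw ->]]]]]]] [t' [w' [r' [s' [Ht' [HGw' [HQw' ->]]]]]]].
    exists ((t + t') * ((t / (t + t') * r + (1 - t / (t + t')) * r') + (t / (t + t') * s + (1 - t / (t + t')) * s'))).
    assert (0 <= t / (t + t') <= 1) as Hl.
    { split.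
      - apply Rmult_le_pos; [lra | left; apply Rinv_0_lt_compat; lra].
      - apply (Rmult_le_reg_r (t + t')); [lra|]; field_simplify; lra. }
    split; [|right; field; lra].
    exists (t + t'), (t / (t + t') *v w +v (1 - t / (t + t')) *v w'); do 2 eexists.
    repeat split; [lra | apply HG; eauto |].
    pose proof (HQ _ _ _ _ _ Hl HQw HQw') as H.
    match goal with H : Q ?u _ |- Q ?v _ => replace v with u; [exact H|] end.
    vec_coefs; field; lra.
  - intros a x c Ha [t [w [r [s [Ht [HGw [HQw ->]]]]]]].
    exists (a * (t * (r + s))); split; [|lra].
    exists (a * t), w, r, s; repeat split; auto; [nra | | ring].
    replace (w +v / (a * t) *v (a *v x)) with (w +v / t *v x) by (vec_coefs; field; lra); auto.
  - intros c [t [w [r [s [Ht [HGw [HQw ->]]]]]]].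
    rewrite scal_zero_r, add_zero in HQw.
    apply Rmult_le_pos; [lra | eauto].
  - destruct (hahn_banach V p Hp) as [l [Hl Hlp]].
    assert (forall w r z s, G w r -> Q z s -> l z - l w <= r + s) as Hsep.
    { intros w r z s Hw Hz.
      replace (l z - l w) with (l (z -v w)).
      - eapply Rle_trans; [apply Hlp|]; apply Hp1.
        exists 1, w, r, s; repeat split; [lra | auto | | ring].
        replace (w +v / 1 *v (z -v w)) with z by (vec_coefs; field; lra); auto.
      - destruct Hl as [Hadd Hsc]; rewrite Hadd, opp_scal, Hsc; ring. }
    assert (is_bounded_fun V l) as Hb.
    { apply bounded_of_ball with d (r0 + s0); auto.
      intros z Hz.
      pose proof (Hsep w0 r0 (w0 +v z) s0 HG0 (HQ0 z Hz)) as H.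
      rewrite (proj1 Hl) in H; lra. }
    exists (exist _ l (conj Hl Hb)); exact Hsep.
Qed.

(** * Finite-dimensional separation and Goldstine's lemma *)

(** The product ends in a factor [real_space] even for [n = 0]; [evals] puts the constant 0 in that
    last coordinate. *)
Fixpoint coord_space (n : nat) : NormedSpace :=
  match n with O => real_space | S n => prod_space real_space (coord_space n) end.

Section FiniteSeparation.
Variables (U : Type) (F : (U -> R) -> Prop).

Fixpoint evals (fs : list (U -> R)) (u : U) : coord_space (length fs) :=
  match fs with nil => 0 | f :: fs => (f u, evals fs u) end.

Hypothesis F_zero : F (fun _ => 0).
Hypothesis F_lin : forall a f g, F f -> F g -> F (fun u => a * f u + g u).

(** Pulling back a functional on coordinates gives a linear combination of the tests, which stays in
    the class [F]. *)
Lemma evals_linear (fs : list (U -> R)) (l : coord_space (length fs) -> R) :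
  Forall F fs -> is_linear_fun _ l -> exists f, F f /\ forall u, l (evals fs u) = f u.
Proof.
  induction fs as [|f fs IH]; intros HF [Hadd Hsc].
  - exists (fun _ => 0); split; auto; intros u; simpl.
    change (l (zero : real_space) = 0).
    rewrite <- (scal_zero_l (zero : real_space)), Hsc; ring.
  - inversion HF as [|? ? Hf Hfs]; subst.
    destruct (IH (fun z => l ((0, z) : coord_space (length (f :: fs))))) as [g [Hg Hlg]]; auto.
    { split.
      - intros x y; rewrite <- Hadd; f_equal; simpl; f_equal; ring.
      - intros a x; rewrite <- Hsc; f_equal; simpl; f_equal; ring. }
    exists (fun u => l ((1, zero) : coord_space (length (f :: fs))) * f u + g u); split; auto.
    intros u; rewrite <- Hlg, Rmult_comm, <- Hsc, <- Hadd; f_equal; simpl; f_equal.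
    + ring.
    + now rewrite scal_zero_r, add_zero_l.
Qed.

Lemma evals_norm (fs : list (U -> R)) (u v : U) f :
  In f fs -> Rabs (f u - f v) <= norm (evals fs u -v evals fs v).
Proof.
  induction fs as [|g fs IH]; simpl; [tauto|]; intros [->|H].
  - pose proof (norm_nonneg _ (evals fs u -v evals fs v)); unfold Rminus; lra.
  - specialize (IH H); pose proof (Rabs_pos (g u + - g v)); lra.
Qed.

(** [U] carries no linear structure or topology; convex combinations are seen only through [F]. In
    coordinates the sandwich theorem is applied to the constant [- eps] on the image of [K], shifted
    by [u0], and to the norm, which is at least [eps] there because some test is. *)
Lemma finite_separation (K : U -> Prop) (u0 : U) (fs : list (U -> R)) (eps : R) :
  (forall u v t, 0 <= t <= 1 -> K u -> K v ->
     exists w, K w /\ forall f, F f -> f w = t * f u + (1 - t) * f v) ->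
  (exists u, K u) -> Forall F fs -> 0 < eps ->
  (forall u, K u -> exists f, In f fs /\ eps <= Rabs (f u - f u0)) ->
  exists f, F f /\ forall u, K u -> f u0 + eps <= f u.
Proof.
  intros HK [u1 Hu1] HF Heps Hfar.
  assert (forall w u v t, (forall f, F f -> f w = t * f u + (1 - t) * f v) ->
            evals fs w = t *v evals fs u +v (1 - t) *v evals fs v) as Hev.
  { intros w u v t Hw; clear Hfar.
    induction fs as [|f fs IH]; simpl.
    - ring.
    - inversion HF; subst; rewrite IH, Hw by auto; reflexivity. }
  destruct (sandwich (coord_space (length fs))
              (fun z r => exists u, K u /\ z = evals fs u -v evals fs u0 /\ r = - eps)
              (fun z s => norm z <= s)
              (evals fs u1 -v evals fs u0) (- eps)
              (norm (evals fs u1 -v evals fs u0) + 1) 1) as [l Hl].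
  - intros x y a b t Ht [u [Hu [-> ->]]] [v [Hv [-> ->]]].
    destruct (HK u v t Ht Hu Hv) as [w [Hw Hwf]].
    exists w; split; auto; split; [|ring].
    rewrite (Hev w u v t Hwf); vec.
  - intros x y a b t Ht Hx Hy; eapply Rle_trans; [apply norm_triangle|].
    rewrite !norm_scal_nonneg by lra.
    apply Rplus_le_compat; apply Rmult_le_compat_l; lra.
  - intros w r s [u [Hu [-> ->]]] Hs.
    destruct (Hfar u Hu) as [f [Hf Hd]].
    pose proof (evals_norm fs u u0 f Hf); lra.
  - exists u1; auto.
  - lra.
  - intros z Hz; eapply Rle_trans; [apply norm_triangle|]; lra.
  - destruct (evals_linear fs (dval l) HF) as [f [Hf Hlf]].
    { split; [apply dval_add | apply dval_scal]. }
    exists f; split; auto; intros u Hu.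
    assert (norm (zero : coord_space (length fs)) <= 0) as H0 by (rewrite norm_zero; lra).
    pose proof (Hl _ _ _ _ (ex_intro _ u (conj Hu (conj eq_refl eq_refl))) H0) as H.
    rewrite dval_zero, dval_add, dval_opp, !Hlf in H; lra.
Qed.
End FiniteSeparation.

Section Bidual.
Context {V : NormedSpace}.
Implicit Types (p : Bidual V) (f g : Dual V).

Lemma bval_lin p a b f g : bval p (a *v f +v b *v g) = a * bval p f + b * bval p g.
Proof. destruct p as [p [H1 H2]]; apply H1; intros x; reflexivity. Qed.
Lemma bval_add p f g : bval p (f +v g) = bval p f + bval p g.
Proof.
  replace (f +v g) with (1 *v f +v 1 *v g) by vec; rewrite bval_lin; ring.
Qed.
Lemma bval_scal p a f : bval p (a *v f) = a * bval p f.
Proof.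
  replace (a *v f) with (a *v f +v 0 *v f) by vec; rewrite bval_lin; ring.
Qed.
Lemma bval_opp p f : bval p (opp f) = - bval p f.
Proof. rewrite opp_scal, bval_scal; ring. Qed.
Lemma bval_zero p : bval p zero = 0.
Proof. rewrite <- (scal_zero_l zero), bval_scal; ring. Qed.

Lemma bval_bound p : exists N, 0 <= N /\ forall f, Rabs (bval p f) <= N * norm f.
Proof.
  destruct p as [p [H1 [M HM]]]; exists (Rabs M); split; [apply Rabs_pos|].
  intros f; eapply Rle_trans; [apply HM|].
  apply Rmult_le_compat_r; [apply dnormf_nonneg | apply Rle_abs].
Qed.

Lemma bidual_of_proof (l : Dual (dual_space V)) :
  (forall (f g h : Dual V) (a b : R), (forall x, dval h x = a * dval f x + b * dval g x) ->
     dval l h = a * dval l f + b * dval l g) /\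
  (exists M, forall f : Dual V, Rabs (dval l f) <= M * dnormf (dval f)).
Proof.
  split.
  - intros f g h a b H.
    replace h with (a *v f +v b *v g) by (apply dval_ext; intros x; rewrite H; reflexivity).
    now rewrite dval_add, !dval_scal.
  - exists (dnormf (dval l)); exact (fun f => dval_bound l f).
Qed.
Definition bidual_of (l : Dual (dual_space V)) : Bidual V := exist _ (dval l) (bidual_of_proof l).

Lemma embed_proof (x : V) :
  (forall (f g h : Dual V) (a b : R), (forall x, dval h x = a * dval f x + b * dval g x) ->
     dval h x = a * dval f x + b * dval g x) /\
  (exists M, forall f : Dual V, Rabs (dval f x) <= M * dnormf (dval f)).
Proof.
  split; [auto|].
  exists (norm x); intros f; rewrite Rmult_comm; apply dval_bound.
Qed.
Definition embed (x : V) : Bidual V := exist _ (fun f => dval f x) (embed_proof x).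
Lemma bval_embed x f : bval (embed x) f = dval f x.
Proof. reflexivity. Qed.

Lemma blin_proof p q (a b : R) :
  (forall (f g h : Dual V) (c d : R), (forall x, dval h x = c * dval f x + d * dval g x) ->
     a * bval p h + b * bval q h = c * (a * bval p f + b * bval q f) + d * (a * bval p g + b * bval q g)) /\
  (exists M, forall f : Dual V, Rabs (a * bval p f + b * bval q f) <= M * dnormf (dval f)).
Proof.
  split.
  - intros f g h c d H.
    replace h with (c *v f +v d *v g) by (apply dval_ext; intros x; rewrite H; reflexivity).
    rewrite !bval_lin; ring.
  - destruct (bval_bound p) as [N [_ HN]], (bval_bound q) as [N' [_ HN']].
    exists (Rabs a * N + Rabs b * N'); intros f; eapply Rle_trans; [apply Rabs_triang|].
    rewrite Rmult_plus_distr_r, !Rabs_mult, !Rmult_assoc.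
    apply Rplus_le_compat; apply Rmult_le_compat_l; auto using Rabs_pos.
Qed.
Definition blin p q (a b : R) : Bidual V := exist _ _ (blin_proof p q a b).
Lemma bval_blin p q a b f : bval (blin p q a b) f = a * bval p f + b * bval q f.
Proof. reflexivity. Qed.

(** Otherwise some functional [f] satisfies [p f + eps <= f x] on the whole ball of radius [N]; the
    infimum over the ball gives [p f + eps <= - N |f|], against the bound on [p]. *)
Lemma goldstine p (N : R) (fs : list (Dual V)) (eps : R) :
  0 <= N -> (forall f, Rabs (bval p f) <= N * norm f) -> 0 < eps ->
  exists x : V, norm x <= N /\ forall f, In f fs -> Rabs (dval f x - bval p f) < eps.
Proof.
  intros HN Hp Heps; apply NNPP; intros Hn.
  destruct (finite_separation (Bidual V) (fun phi => exists f, forall q, phi q = bval q f))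
    with (K := fun q => exists x, norm x <= N /\ q = embed x) (u0 := p)
         (fs := map (fun f q => bval q f) fs) (eps := eps) as [phi [[f Hf] Hsep]]; auto.
  - exists zero; intros q; now rewrite bval_zero.
  - intros a f g [f' Hf] [g' Hg]; exists (a *v f' +v 1 *v g'); intros q.
    rewrite Hf, Hg, bval_lin; ring.
  - intros u v t Ht [x [Hx ->]] [y [Hy ->]].
    exists (embed (t *v x +v (1 - t) *v y)); split.
    + exists (t *v x +v (1 - t) *v y); split; auto.
      eapply Rle_trans; [apply norm_triangle|].
      rewrite !norm_scal_nonneg by lra; nra.
    + intros f [f' Hf]; rewrite !Hf, !bval_embed;
      now rewrite dval_add, !dval_scal.
  - exists (embed zero), zero; rewrite norm_zero; auto.
  - apply Forall_forall; intros phi H; apply in_map_iff in H; destruct H as [f [<- _]].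
    now exists f.
  - intros u [x [Hx ->]]; apply NNPP; intros Hfar; apply Hn; exists x; split; auto.
    intros f Hf; apply Rnot_le_lt; intros Hle; apply Hfar.
    exists (fun q => bval q f); split; auto.
    apply in_map_iff; now exists f.
  (* This error stays below [eps] after multiplication by [N]. *)
  - destruct (dnormf_approx f (eps / (2 * (N + 1)))) as [x [Hx1 Hx2]].
    { apply Rdiv_lt_0_compat; lra. }
    assert (norm ((- N) *v x) <= N) as HNx.
    { rewrite norm_scal, Rabs_Ropp, Rabs_pos_eq by auto; nra. }
    pose proof (Hsep _ (ex_intro _ ((- N) *v x) (conj HNx eq_refl))) as H.
    rewrite !Hf, bval_embed, dval_scal in H.
    pose proof (Hp f) as H1; apply Rabs_le_inv in H1.
    change (norm f) with (dnormf (dval f)) in H1.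
    assert (N * (eps / (2 * (N + 1))) < eps).
    { apply Rle_lt_trans with (eps / 2); [|lra].
      apply (Rmult_le_reg_r (2 * (N + 1))); [lra|]; field_simplify; nra. }
    assert (N * (dnormf (dval f) - eps / (2 * (N + 1))) <= N * dval f x)
      by (apply Rmult_le_compat_l; lra).
    lra.
Qed.

Lemma bval_dual p : exists l : Dual (dual_space V), forall f, dval l f = bval p f.
Proof.
  assert (is_linear_fun (dual_space V) (bval p) /\ is_bounded_fun (dual_space V) (bval p)) as H.
  { split; [split|].
    - apply bval_add.
    - apply bval_scal.
    - destruct (bval_bound p) as [N [_ HN]]; now exists N. }
  now exists (exist (fun f : dual_space V -> R => is_linear_fun _ f /\ is_bounded_fun _ f) (bval p) H).
Qed.
End Bidual.

(** Source of the bidual points in the duality arguments: a multiplier on [V x V'] is a pair in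
    [V' x V'']. *)
Lemma dual_prod_split (V : NormedSpace) (l : Dual (prod_space V (dual_space V))) :
  exists (f : Dual V) (p : Bidual V), forall z, dval l z = dval f (fst z) + bval p (snd z).
Proof.
  pose (L := fun x g => dval l ((x, g) : prod_space V (dual_space V))).
  assert (is_linear_fun V (fun x => L x zero) /\ is_bounded_fun V (fun x => L x zero)) as Hf.
  { split; [split|]; unfold L.
    - intros x y; rewrite <- dval_add; f_equal; pair_vec.
    - intros a x; rewrite <- dval_scal; f_equal; pair_vec.
    - exists (dnormf (dval l)); intros x; eapply Rle_trans; [apply dval_bound|]; simpl.
      change (dnorm dzero) with (norm (zero : dual_space V)); rewrite norm_zero; lra. }
  assert (is_linear_fun (dual_space V) (fun g => L zero g) /\ is_bounded_fun (dual_space V) (fun g => L zero g)) as Hp.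
  { split; [split|]; unfold L.
    - intros x y; rewrite <- dval_add; f_equal; pair_vec.
    - intros a x; rewrite <- dval_scal; f_equal; pair_vec.
    - exists (dnormf (dval l)); intros x; eapply Rle_trans; [apply dval_bound|]; simpl.
      rewrite norm_zero; lra. }
  exists (exist (fun f : V -> R => is_linear_fun _ f /\ is_bounded_fun _ f) _ Hf).
  exists (bidual_of (exist (fun f : dual_space V -> R => is_linear_fun _ f /\ is_bounded_fun _ f) _ Hp)); intros [x g].
  change (L x g = L x zero + L zero g); unfold L; rewrite <- dval_add; f_equal; simpl; f_equal; symmetry.
  - apply add_zero.
  - exact (add_zero_l (V := dual_space V) g).
Qed.

(** * Fenchel duality on V x V' *)

Notation dual_pair V := (prod_space V (dual_space V)).

Definition coupling {V : NormedSpace} (z : dual_pair V) : R := dval (snd z) (fst z).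

(** The inequality [h^* >= c] with the conjugate replaced by its real upper bounds [r0]; where it is
    plus infinity nothing is asserted. *)
Definition conj_above {V : NormedSpace} (G : dual_pair V -> R -> Prop) : Prop :=
  forall (f : Dual V) (p : Bidual V) r0,
    (forall z r, G z r -> dval f (fst z) + bval p (snd z) - r <= r0) -> bval p f <= r0.

Definition convex_fun {V : NormedSpace} (a : V -> R) : Prop :=
  forall x y t, 0 <= t <= 1 -> a (t *v x +v (1 - t) *v y) <= t * a x + (1 - t) * a y.

(** For an empty [G] every real number, [-1] included, would bound the conjugate at the origin. *)
Lemma conj_above_inhabited {V : NormedSpace} (G : dual_pair V -> R -> Prop) :
  conj_above G -> exists z r, G z r.
Proof.
  intros H; apply NNPP; intros Hn.
  assert (bval (embed zero) (zero : dual_space V) <= -1).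
  { apply H; intros z r Hz; exfalso; apply Hn; eauto. }
  unfold bval in *; simpl in *; unfold dval in *; simpl in *; lra.
Qed.

(* [a] and [b] are the penalties in the two variables and [D] is a hard constraint; the
   last hypothesis evaluates the dual problem at [(f0 + u, p0 + v)]. *)
Lemma fenchel_duality (V : NormedSpace) (G : dual_pair V -> R -> Prop)
  (f0 : Dual V) (p0 : Bidual V) (a : V -> R) (D : V -> Prop) (b : dual_space V -> R)
  (w0 : dual_pair V) (r0 d A0 B0 eta : R) :
  convex_rel G -> conj_above G -> convex_fun a -> convex_fun b ->
  (forall x y t, 0 <= t <= 1 -> D x -> D y -> D (t *v x +v (1 - t) *v y)) ->
  G w0 r0 -> 0 < d ->
  (forall x, norm x <= d -> D (fst w0 +v x) /\ a (fst w0 +v x) <= A0) ->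
  (forall g, norm g <= d -> b (snd w0 +v g) <= B0) ->
  (forall (u : Dual V) (v : Bidual V), exists (x : V) (g : dual_space V), D x /\
     a x + b g + (dval u x - bval p0 u) + bval v (g -v f0) - bval v u < eta) ->
  exists z r, G z r /\ D (fst z) /\
    r - dval f0 (fst z) - bval p0 (snd z) + bval p0 f0 + a (fst z) + b (snd z) < eta.
Proof.
  intros HG Hconj Ha Hb HD HG0 Hd HaD Hb0 Hdual; apply NNPP; intros Hn.
  (* If the claim fails, [G + P] is nonnegative over [D]; [P] collects the affine shift, the
     penalties and [- eta]. *)
  pose (P := fun z : dual_pair V => - dval f0 (fst z) - bval p0 (snd z) + bval p0 f0 + a (fst z) + b (snd z) - eta).
  destruct (bval_bound p0) as [N [HN0 HN]].
  destruct (sandwich (dual_pair V) G (fun z s => D (fst z) /\ P z <= s) w0 r0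
    (norm f0 * (norm (fst w0) + d) + N * (norm (snd w0) + d) + bval p0 f0 + A0 + B0 - eta) d) as [l Hl]; auto.
  - intros x y s t c Hc [Hx Hxs] [Hy Hys]; split; [now apply HD|].
    pose proof (Ha (fst x) (fst y) c Hc); pose proof (Hb (snd x) (snd y) c Hc).
    apply Rle_trans with (c * P x + (1 - c) * P y).
    2: apply Rplus_le_compat; apply Rmult_le_compat_l; lra.
    unfold P in *; proj_ops.
    rewrite dval_add, !dval_scal, bval_lin; lra.
  - intros w r s Hw [HwD Hws]; apply Rnot_lt_le; intros Hlt; apply Hn.
    exists w, r; repeat split; auto; unfold P in Hws; lra.
  - intros z Hz; rewrite norm_prod in Hz.
    pose proof (norm_nonneg V (fst z)); pose proof (norm_nonneg (dual_space V) (snd z)).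
    destruct (HaD (fst z)) as [H1 H2]; [lra|].
    split; [exact H1|].
    pose proof (Hb0 (snd z) ltac:(lra)) as H3.
    pose proof (norm_triangle V (fst w0) (fst z)) as H4.
    pose proof (norm_triangle (dual_space V) (snd w0) (snd z)) as H5.
    pose proof (dval_norm_ge f0 (fst w0 +v fst z)) as H6.
    pose proof (HN (snd w0 +v snd z)) as H7; apply Rabs_le_inv in H7.
    assert (norm f0 * norm (fst w0 +v fst z) <= norm f0 * (norm (fst w0) + d)).
    { apply Rmult_le_compat_l; [apply norm_nonneg | lra]. }
    assert (N * norm (snd w0 +v snd z) <= N * (norm (snd w0) + d)).
    { apply Rmult_le_compat_l; auto; lra. }
    unfold P; proj_ops; lra.
  - destruct (dual_prod_split V l) as [mf [mp Hsplit]].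
    pose (f := opp mf : dual_space V); pose (p := blin mp mp (-1) 0).
    assert (forall z, dval l z = - dval f (fst z) - bval p (snd z)) as Hlz.
    { intros z; rewrite Hsplit; unfold f, p; rewrite dval_dopp, bval_blin; ring. }
    (* With [u = f - f0] and [v = p - p0] the dual hypothesis reads [P + f x + p g < p f] at
       [(x, g)], while [Hconj] gives the reverse. *)
    destruct (Hdual (f -v f0) (blin p p0 1 (-1))) as [x [g [Hx Hlt]]].
    assert (bval p f <= P (x, g) + dval f x + bval p g) as Hc.
    { apply Hconj; intros z r Hz.
      pose proof (Hl z r (x, g) (P (x, g)) Hz (conj Hx (Rle_refl _))) as H.
      rewrite !Hlz in H; cbn [fst snd] in H; lra. }
    assert (forall h, bval (blin p p0 1 (-1)) h = bval p h - bval p0 h) as Hbl.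
    { intros h; rewrite bval_blin; ring. }
    assert (dval (f -v f0) x = dval f x - dval f0 x) as Hdv by reflexivity.
    rewrite !Hbl, Hdv in Hlt.
    rewrite !bval_add, !bval_opp in Hlt.
    unfold P in Hc; cbn [fst snd] in Hc; lra.
Qed.

Lemma norm_sub_convex (V : NormedSpace) (c : V) : convex_fun (fun x => norm (x -v c)).
Proof.
  intros x y t Ht.
  replace (t *v x +v (1 - t) *v y -v c) with (t *v (x -v c) +v (1 - t) *v (y -v c)) by vec.
  eapply Rle_trans; [apply norm_triangle|]; rewrite !norm_scal_nonneg by lra; lra.
Qed.

Lemma norm_sq_convex (V : NormedSpace) (c : V) : convex_fun (fun x => / 2 * norm (x -v c) ^ 2).
Proof.
  intros x y t Ht; pose proof (norm_sub_convex V c x y t Ht) as H; cbv beta in *.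
  pose proof (norm_nonneg V (t *v x +v (1 - t) *v y -v c)).
  set (u := norm (t *v x +v (1 - t) *v y -v c)) in *; set (a := norm (x -v c)) in *; set (b := norm (y -v c)) in *.
  assert (u ^ 2 <= (t * a + (1 - t) * b) ^ 2) by (apply pow_incr; lra).
  assert (0 <= t * (1 - t) * (a - b) ^ 2).
  { apply Rmult_le_pos; [apply Rmult_le_pos; lra | apply pow2_ge_0]. }
  nra.
Qed.

(** The conjugate of half the squared norm is half the squared dual norm. The infimum is only
    approached, along [- |u|] times an almost norming vector. *)
Lemma half_square_conj (V : NormedSpace) (u : Dual V) (eta : R) :
  0 < eta -> exists x : V, / 2 * norm x ^ 2 + dval u x <= - (/ 2 * norm u ^ 2) + eta.
Proof.
  intros Heta.
  pose proof (norm_nonneg (dual_space V) u) as Hu.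
  destruct (dnormf_approx u (eta / (norm u + 1))) as [x [Hx1 Hx2]].
  { apply Rdiv_lt_0_compat; lra. }
  change (dnormf (dval u)) with (norm u) in Hx2.
  exists ((- norm u) *v x).
  rewrite dval_scal, norm_scal, Rabs_Ropp, Rabs_pos_eq by auto.
  set (n := norm u) in *.
  assert (n * (eta / (n + 1)) <= eta).
  { apply (Rmult_le_reg_r (n + 1)); [lra|]; field_simplify; nra. }
  assert (n * (n - eta / (n + 1)) <= n * dval u x) by (apply Rmult_le_compat_l; lra).
  assert ((n * norm x) ^ 2 <= n ^ 2).
  { apply pow_incr; pose proof (norm_nonneg V x); nra. }
  nra.
Qed.

Lemma coupling_bound {V : NormedSpace} (z : dual_pair V) :
  Rabs (coupling z) <= norm (fst z) * norm (snd z).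
Proof. unfold coupling; rewrite Rmult_comm; apply dval_bound. Qed.

(** At a multiplier [(u, v)] the dual value is close to [- |u|^2 / 2 - |v|^2 / 2 - v u], which is at
    most 0 because [- v u <= |u| |v|]. The coupling terms come from the linear shift by
    bilinearity. *)
Lemma quadratic_approximation (V : NormedSpace) (G : dual_pair V -> R -> Prop) (z0 : dual_pair V) (eta : R) :
  convex_rel G -> conj_above G -> 0 < eta ->
  exists z r, G z r /\ r - coupling z + coupling (z -v z0)
     + / 2 * norm (fst z -v fst z0) ^ 2 + / 2 * norm (snd z -v snd z0) ^ 2 < eta.
Proof.
  intros HG Hconj Heta.
  destruct (conj_above_inhabited G Hconj) as [w0 [r0 Hw0]].
  assert (forall (W : NormedSpace) (w c x : W), norm x <= 1 ->
    / 2 * norm (w +v x -v c) ^ 2 <= / 2 * (norm (w -v c) + 1) ^ 2) as Hball.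
  { intros W w c x Hx; apply Rmult_le_compat_l; [lra|].
    apply pow_incr; split; [apply norm_nonneg|].
    replace (w +v x -v c) with ((w -v c) +v x) by vec.
    eapply Rle_trans; [apply norm_triangle | lra]. }
  destruct (fenchel_duality V G (snd z0) (embed (fst z0)) (fun x => / 2 * norm (x -v fst z0) ^ 2)
    (fun _ => True) (fun g => / 2 * norm (g -v snd z0) ^ 2) w0 r0 1
    (/ 2 * (norm (fst w0 -v fst z0) + 1) ^ 2) (/ 2 * (norm (snd w0 -v snd z0) + 1) ^ 2) eta)
    as [z [r [Hz [_ Hlt]]]]; auto using norm_sq_convex; try lra.
  - intros u v.
    destruct (half_square_conj V u (eta / 4)) as [x Hx]; [lra|].
    destruct (bval_dual v) as [l Hl].
    destruct (half_square_conj (dual_space V) l (eta / 4)) as [g Hg]; [lra|].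
    exists (fst z0 +v x), (snd z0 +v g); split; auto.
    replace (fst z0 +v x -v fst z0) with x by vec.
    replace (snd z0 +v g -v snd z0) with g by vec.
    rewrite <- !Hl, bval_embed, dval_add.
    pose proof (dval_norm_ge l u) as H.
    pose proof (pow2_ge_0 (norm l - norm u)). nra.
  - exists z, r; split; auto.
    assert (coupling (z -v z0) = coupling z - dval (snd z0) (fst z) - dval (snd z) (fst z0) + dval (snd z0) (fst z0)) as ->.
    { unfold coupling; proj_ops.
      rewrite dval_dadd, dval_dopp, !dval_add, !dval_opp; ring. }
    rewrite !bval_embed in Hlt; lra.
Qed.

(** * The contact set of a strong representative *)

Lemma pow_half_small (C eps : R) : 0 < eps -> exists n, forall m, (n <= m)%nat -> C * (/ 2) ^ m < eps.
Proof.
  intros Heps.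
  destruct (pow_lt_1_zero (/ 2)) with (y := eps / (Rabs C + 1)) as [n Hn].
  - rewrite Rabs_pos_eq; lra.
  - apply Rdiv_lt_0_compat; auto; pose proof (Rabs_pos C); lra.
  - exists n; intros m Hm; specialize (Hn m Hm).
    rewrite Rabs_pos_eq in Hn by (apply pow_le; lra).
    pose proof (Rabs_pos C); pose proof (Rle_abs C).
    assert (0 < (/ 2) ^ m) by (apply pow_lt; lra).
    apply (Rmult_lt_compat_l (Rabs C + 1)) in Hn; [|lra].
    replace ((Rabs C + 1) * (eps / (Rabs C + 1))) with eps in Hn by (field; lra); nra.
Qed.

Lemma geometric_limit (V : NormedSpace) (u : nat -> V) (C : R) :
  (forall n, norm (u (S n) -v u n) <= C * (/ 2) ^ n) ->
  exists l, forall n, norm (l -v u n) <= 2 * C * (/ 2) ^ n.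
Proof.
  intros Hu.
  (* Keeping the subtracted geometric tail makes the induction on [k] close. *)
  assert (forall n k, norm (u (k + n)%nat -v u n) <= 2 * C * (/ 2) ^ n - 2 * C * (/ 2) ^ (k + n)) as Hk.
  { intros n k; induction k as [|k IH]; simpl.
    - rewrite add_opp, norm_zero; lra.
    - eapply Rle_trans; [apply (norm_sub_triangle _ (u (k + n)%nat))|].
      specialize (Hu (k + n)%nat); simpl; lra. }
  assert (0 <= C) as HC.
  { specialize (Hu O); pose proof (norm_nonneg _ (u 1%nat -v u O)); simpl in Hu; lra. }
  assert (forall n m, (n <= m)%nat -> norm (u m -v u n) <= 2 * C * (/ 2) ^ n) as Hnm.
  { intros n m Hnm; replace m with ((m - n) + n)%nat by lia.
    eapply Rle_trans; [apply Hk|].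
    assert (0 < (/ 2) ^ (m - n + n)) by (apply pow_lt; lra); nra. }
  destruct (complete V u) as [l Hl].
  - intros eps Heps; destruct (pow_half_small (2 * C) eps Heps) as [N HN].
    exists N; intros m n Hm Hn.
    destruct (Nat.le_ge_cases m n) as [H|H].
    + rewrite norm_sub_sym; eapply Rle_lt_trans; [now apply Hnm | now apply HN].
    + eapply Rle_lt_trans; [now apply Hnm | now apply HN].
  - exists l; intros n; apply Rnot_lt_le; intros Hlt.
    destruct (Hl (norm (l -v u n) - 2 * C * (/ 2) ^ n)) as [N HN]; [lra|].
    specialize (HN (max N n) ltac:(lia)).
    pose proof (Hnm n (max N n) ltac:(lia)).
    pose proof (norm_sub_triangle l (u (max N n)) (u n)) as H1.
    rewrite (norm_sub_sym l (u (max N n))) in H1; lra.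
Qed.

(** Approximating values need only satisfy [r' <= r + eps], so a closed relation is also upward
    closed, like an epigraph. *)
Definition closed_rel {V : NormedSpace} (G : V -> R -> Prop) : Prop :=
  forall z r, (forall eps, 0 < eps -> exists z' r', G z' r' /\ norm (z' -v z) < eps /\ r' <= r + eps) -> G z r.

Section Coupling.
Context {V : NormedSpace}.
Implicit Types z w : dual_pair V.

Lemma coupling_add z w :
  coupling (z +v w) = coupling z + dval (snd z) (fst w) + dval (snd w) (fst z) + coupling w.
Proof. unfold coupling; proj_ops; rewrite dval_dadd, !dval_add; ring. Qed.

Lemma coupling_opp z : coupling (opp z) = coupling z.
Proof. unfold coupling; proj_ops; rewrite dval_dopp, dval_opp; ring. Qed.

Lemma coupling_sub z w :
  coupling (z -v w) = coupling z - dval (snd w) (fst z) - dval (snd z) (fst w) + coupling w.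
Proof.
  rewrite coupling_add, coupling_opp; proj_ops; rewrite dval_dopp, dval_opp; ring.
Qed.

Lemma coupling_convex_combination z w t :
  coupling (t *v z +v (1 - t) *v w) = t * coupling z + (1 - t) * coupling w - t * (1 - t) * coupling (z -v w).
Proof.
  rewrite coupling_sub; unfold coupling; proj_ops.
  rewrite dval_dadd, !dval_dscal, !dval_add, !dval_scal; ring.
Qed.

Lemma coupling_near z w :
  coupling z <= coupling w + norm w * norm (z -v w) + norm (z -v w) ^ 2.
Proof.
  set (d := z -v w).
  replace z with (w +v d) at 1 by (unfold d; vec).
  rewrite coupling_add.
  pose proof (dval_norm_le (snd w) (fst d)); pose proof (dval_norm_le (snd d) (fst w)).
  pose proof (dval_norm_le (snd d) (fst d)); unfold coupling.
  rewrite !norm_prod.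
  pose proof (norm_nonneg _ (fst w)); pose proof (norm_nonneg _ (snd w)).
  pose proof (norm_nonneg _ (fst d)); pose proof (norm_nonneg _ (snd d)).
  nra.
Qed.
End Coupling.

Section StrongRepresentative.
Context {V : NormedSpace} (E : dual_pair V -> R -> Prop).
Hypothesis E_convex : convex_rel E.
Hypothesis E_closed : closed_rel E.
Hypothesis E_above : forall z r, E z r -> coupling z <= r.
Hypothesis E_conj : conj_above E.

Definition contact (z : dual_pair V) : Prop := E z (coupling z).

Lemma contact_closed z :
  (forall eps, 0 < eps -> exists w r, E w r /\ r <= coupling w + eps /\ norm (w -v z) < eps) -> contact z.
Proof.
  intros H; apply E_closed; intros eps Heps.
  pose proof (norm_nonneg _ z).
  set (e := Rmin 1 (eps / (norm z + 3))).
  assert (0 < e) as He by (apply Rmin_pos; [lra | apply Rdiv_lt_0_compat; lra]).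
  assert (e <= 1) by apply Rmin_l.
  assert ((norm z + 3) * e <= eps) as He2.
  { apply Rle_trans with ((norm z + 3) * (eps / (norm z + 3))).
    - apply Rmult_le_compat_l; [lra | apply Rmin_r].
    - right; field; lra. }
  destruct (H e He) as [w [r [Hw [Hr Hd]]]].
  exists w, r; split; auto.
  pose proof (coupling_near w z); pose proof (norm_nonneg _ (w -v z)).
  assert (0 <= norm z * e) by nra.
  assert (norm z * norm (w -v z) <= norm z * e) by (apply Rmult_le_compat_l; lra).
  assert (norm (w -v z) ^ 2 <= e) by nra.
  split; lra.
Qed.

Lemma approximation_step z0 r0 e : E z0 r0 -> 0 < e -> r0 <= coupling z0 + e ^ 2 ->
  exists z r, E z r /\ r <= coupling z + (e / 2) ^ 2 /\ norm (z -v z0) <= 4 * e.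
Proof.
  intros H0 He Hr0.
  destruct (quadratic_approximation V E z0 (e ^ 2 / 4)) as [z [r [Hz Hlt]]]; auto; [nra|].
  pose proof (E_above _ _ Hz).
  pose proof (coupling_bound (z -v z0)) as Hc; apply Rabs_le_inv in Hc.
  (* Convexity at the midpoint bounds [- c (z - z0)] by twice the sum of the two errors. With the
     quadratic estimate this gives [a^2 + b^2 <= 5 e^2], whence [a + b <= 4 e]. *)
  assert (/ 2 * coupling z + (1 - / 2) * coupling z0 - / 2 * (1 - / 2) * coupling (z -v z0) <= / 2 * r + (1 - / 2) * r0) as Hm.
  { rewrite <- coupling_convex_combination; apply E_above, E_convex; auto; lra. }
  exists z, r; split; auto; rewrite norm_prod.
  revert Hc Hlt; proj_ops; intros Hc Hlt.
  set (a := norm (fst z -v fst z0)) in *; set (b := norm (snd z -v snd z0)) in *.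
  assert (0 <= a) by apply norm_nonneg; assert (0 <= b) by apply norm_nonneg.
  pose proof (pow2_ge_0 (a - b)).
  assert (r <= coupling z + e ^ 2 / 4) by lra.
  split; [lra|].
  assert (a ^ 2 + b ^ 2 <= 5 * e ^ 2) by lra.
  apply Rsqr_incr_0_var; unfold Rsqr; [|lra].
  pose proof (pow2_ge_0 (a - b)); nra.
Qed.

(** Iterating the step with [e / 2^n] sends the error to 0, and the moves [4 e / 2^n] add up to at
    most [8 e]. *)
Lemma bronsted_rockafellar z0 r0 e : E z0 r0 -> 0 < e -> r0 <= coupling z0 + e ^ 2 ->
  exists z, contact z /\ norm (z -v z0) <= 8 * e.
Proof.
  intros H0 He Hr0.
  pose (ok := fun n (s : dual_pair V * R) => E (fst s) (snd s) /\ snd s <= coupling (fst s) + (e * (/ 2) ^ n) ^ 2).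
  destruct (choice (fun (ns : nat * (dual_pair V * R)) s' => ok (fst ns) (snd ns) ->
      ok (S (fst ns)) s' /\ norm (fst s' -v fst (snd ns)) <= 4 * e * (/ 2) ^ fst ns)) as [next Hnext].
  { intros [n [z r]]; cbn [fst snd].
    destruct (classic (ok n (z, r))) as [[H1 H2]|Hn]; [|exists (z, r); tauto].
    destruct (approximation_step z r (e * (/ 2) ^ n)) as [z' [r' [H3 [H4 H5]]]]; auto.
    { apply Rmult_lt_0_compat; auto; apply pow_lt; lra. }
    exists (z', r'); intros _; unfold ok; cbn [fst snd]; repeat split; auto; [|lra].
    replace (e * (/ 2) ^ S n) with (e * (/ 2) ^ n / 2) by (simpl; field); auto. }
  pose (s := fix s n := match n with O => (z0, r0) | S n => next (n, s n) end).
  assert (forall n, ok n (s n)) as Hok.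
  { induction n as [|n IH]; [split; simpl; auto; now rewrite Rmult_1_r|].
    apply (Hnext (n, s n) IH). }
  destruct (geometric_limit _ (fun n => fst (s n)) (4 * e)) as [l Hl].
  { intros n; apply (Hnext (n, s n) (Hok n)). }
  exists l; split; [|specialize (Hl O); cbn [s fst pow] in Hl; lra].
  apply contact_closed; intros eps Heps.
  destruct (pow_half_small (8 * e) eps Heps) as [N1 HN1].
  destruct (pow_half_small (e ^ 2) eps Heps) as [N2 HN2].
  set (n := max N1 N2).
  destruct (Hok n) as [H1 H2].
  exists (fst (s n)), (snd (s n)); repeat split; auto.
  - specialize (HN2 n ltac:(unfold n; lia)).
    assert (0 < (/ 2) ^ n <= 1) by (split; [apply pow_lt; lra | rewrite <- (pow1 n); apply pow_incr; lra]).
    nra.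
  - specialize (HN1 n ltac:(unfold n; lia)); specialize (Hl n).
    rewrite norm_sub_sym; lra.
Qed.

(** The quadratic estimate at [z0] gives an almost contact point [w]. A contact point near [w] is
    monotonically related to [z0], so [c (w - z0)] is almost nonnegative and the squared distances
    from [w] to [z0] must be small. *)
Lemma contact_maximal z0 : (forall z, contact z -> 0 <= coupling (z -v z0)) -> contact z0.
Proof.
  intros Hmon; apply contact_closed; intros eps Heps.
  (* If [a + b >= 50 e], half the sum of squares exceeds the error [8 e (a + b) + 65 e^2]. *)
  set (e := Rmin 1 (eps / 50)).
  assert (0 < e) as He by (apply Rmin_pos; lra).
  assert (e <= 1) by apply Rmin_l; assert (e <= eps / 50) by apply Rmin_r.
  destruct (quadratic_approximation V E z0 (e ^ 2)) as [w [r [Hw Hlt]]]; auto; [nra|].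
  pose proof (E_above _ _ Hw).
  pose proof (coupling_bound (w -v z0)) as Hc; apply Rabs_le_inv in Hc.
  revert Hc Hlt; proj_ops; intros Hc Hlt.
  pose proof (norm_prod (w -v z0)) as Hn; revert Hn; proj_ops; intros Hn.
  set (a := norm (fst w -v fst z0)) in *; set (b := norm (snd w -v snd z0)) in *.
  assert (0 <= a) by apply norm_nonneg; assert (0 <= b) by apply norm_nonneg.
  assert (r <= coupling w + e ^ 2) as Hr by (pose proof (pow2_ge_0 (a - b)); nra).
  destruct (bronsted_rockafellar w r e) as [z [Hz Hzw]]; auto.
  specialize (Hmon z Hz).
  pose proof (coupling_near (z -v z0) (w -v z0)) as Hnear.
  replace (z -v z0 -v (w -v z0)) with (z -v w) in Hnear by vec.
  rewrite Hn in *; set (n := norm (z -v w)) in *.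
  assert (0 <= n) by apply norm_nonneg.
  assert (n ^ 2 <= 64 * e ^ 2) by nra.
  assert ((a + b) * n <= (a + b) * (8 * e)) by (apply Rmult_le_compat_l; lra).
  exists w, r; repeat split; auto; [nra|].
  rewrite Hn; apply Rnot_le_lt; intros Hge.
  assert (50 * e <= a + b) by lra.
  pose proof (pow2_ge_0 (a - b)); nra.
Qed.

(** Homogeneity along the ray through [- f]. When [v] is not bounded by [b] the dual value is minus
    infinity, so only bounded multipliers remain to be examined. *)
Lemma unbounded_ray (v : Bidual V) (b C : R) (f : dual_space V) :
  b * norm f < bval v f -> exists g : dual_space V, b * norm g + bval v g < C.
Proof.
  intros Hf.
  set (t := (Rabs C + 1) / (bval v f - b * norm f)).
  assert (0 < t) as Ht by (apply Rdiv_lt_0_compat; pose proof (Rabs_pos C); lra).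
  exists ((- t) *v f).
  rewrite norm_scal, Rabs_Ropp, Rabs_pos_eq, bval_scal by lra.
  replace (b * (t * norm f) + - t * bval v f) with (- (t * (bval v f - b * norm f))) by ring.
  unfold t; replace ((Rabs C + 1) / (bval v f - b * norm f) * (bval v f - b * norm f)) with (Rabs C + 1)
    by (field; lra).
  pose proof (Rle_abs (- C)); rewrite Rabs_Ropp in *; lra.
Qed.

(* Penalizing the dual variable with a weight exceeding [norm p0] makes the
   bidual point [p0] harmless, so a ball constraint in [V] is enough. *)
Lemma contact_negative_infimum (f0 : Dual V) (p0 : Bidual V) (eta : R) : 0 < eta ->
  exists z, contact z /\ coupling z - dval f0 (fst z) - bval p0 (snd z) + bval p0 f0 < eta.
Proof.
  intros Heta.
  destruct (conj_above_inhabited E E_conj) as [w0 [r0 Hw0]].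
  destruct (bval_bound p0) as [N [HN0 HN]].
  pose proof (norm_nonneg _ (fst w0)) as Hw0n.
  (* The excess 1 over the bound [N] of [p0] pays for moving to a contact point; the ball also
     leaves unit room around [fst w0]. *)
  set (b := N + 1 + norm (fst w0)).
  assert (N + 1 <= b) as Hb by (unfold b; lra).
  (* Since [8 e < 1 <= b - N], the coefficient of [D] in the final estimate is nonpositive; the
     second bound covers the terms free of [D]. *)
  set (e := Rmin (/ 9) (eta / (20 + 10 * b + 10 * N))).
  assert (0 < e) as He by (apply Rmin_pos; [lra | apply Rdiv_lt_0_compat; lra]).
  assert (e <= / 9) as He1 by apply Rmin_l.
  assert ((20 + 10 * b + 10 * N) * e <= eta) as He2.
  { apply Rle_trans with ((20 + 10 * b + 10 * N) * (eta / (20 + 10 * b + 10 * N))).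
    - apply Rmult_le_compat_l; [lra | apply Rmin_r].
    - right; field; lra. }
  destruct (fenchel_duality V E f0 (embed zero) (fun _ => 0) (fun x => norm x <= b)
    (fun g => b * norm (g -v f0)) w0 r0 1 0 (b * (norm (snd w0 -v f0) + 1)) (e ^ 2))
    as [z [r [Hz [Hzb Hlt]]]]; auto; try lra.
  - intros x y t Ht; lra.
  - intros x y t Ht; pose proof (norm_sub_convex _ f0 x y t Ht) as H; cbv beta in H.
    apply (Rmult_le_compat_l b) in H; lra.
  - intros x y t Ht Hx Hy; eapply Rle_trans; [apply norm_triangle|].
    rewrite !norm_scal_nonneg by lra; nra.
  - intros x Hx; split; [|lra].
    eapply Rle_trans; [apply norm_triangle|]; unfold b; lra.
  - intros g Hg; apply Rmult_le_compat_l; [lra|].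
    replace (snd w0 +v g -v f0) with ((snd w0 -v f0) +v g) by vec.
    eapply Rle_trans; [apply norm_triangle|]; lra.
  - intros u v; setoid_rewrite bval_embed.
    destruct (classic (exists f : dual_space V, b * norm f < bval v f)) as [[f Hf]|Hv].
    + destruct (unbounded_ray v b (bval v u) f Hf) as [g Hg].
      exists zero, (f0 +v g); rewrite norm_zero, !dval_zero.
      replace (f0 +v g -v f0) with g by vec.
      split; [lra|]; assert (0 < e ^ 2) by nra; lra.
    (* For [v] bounded by [b], take [g = f0] and let [x] nearly minimize [u] on the ball of radius
       [b]: the value is about [- b |u| - v u <= 0]. *)
    + destruct (dnormf_approx u (e ^ 2 / (2 * b))) as [x [Hx1 Hx2]].
      { apply Rdiv_lt_0_compat; nra. }
      change (dnormf (dval u)) with (norm u) in Hx2.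
      exists ((- b) *v x), f0.
      rewrite add_opp, norm_zero, bval_zero, dval_scal, dval_zero, norm_scal, Rabs_Ropp, Rabs_pos_eq by lra.
      split; [nra|].
      assert (- bval v u <= b * norm u).
      { apply Rnot_lt_le; intros H; apply Hv; exists (opp u); rewrite norm_opp, bval_opp; lra. }
      apply (Rmult_lt_compat_l b) in Hx2; [|lra].
      replace (b * (norm u - e ^ 2 / (2 * b))) with (b * norm u - e ^ 2 / 2) in Hx2 by (field; lra).
      assert (0 < e ^ 2) by nra; lra.
  - cbv beta in Hlt; rewrite !bval_embed, !dval_zero in Hlt.
    pose proof (E_above _ _ Hz) as Hc.
    assert (coupling z - dval f0 (fst z) = dval (snd z -v f0) (fst z)) as Hcz.
    { unfold coupling; now rewrite dval_dadd, dval_dopp. }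
    pose proof (dval_norm_ge (snd z -v f0) (fst z)) as H1.
    set (D := norm (snd z -v f0)) in *.
    assert (0 <= D) as HD by apply norm_nonneg.
    assert (D * norm (fst z) <= D * b) by (apply Rmult_le_compat_l; auto).
    destruct (bronsted_rockafellar z r e) as [z' [Hz' Hd]]; auto; [lra|].
    exists z'; split; auto.
    rewrite norm_prod in Hd; revert Hd; proj_ops; intros Hd.
    (* Here [p0] meets only [snd z' - f0], whose size is paid for by the [- b D] in the bound on the
       third term. *)
    assert (coupling z' - dval f0 (fst z') - bval p0 (snd z') + bval p0 f0
      = dval (snd z' -v f0) (fst z' -v fst z) + dval (snd z' -v snd z) (fst z) + dval (snd z -v f0) (fst z)
        - bval p0 (snd z' -v f0)) as ->.
    { unfold coupling; rewrite !dval_dadd, !dval_dopp, !dval_add, !dval_opp, bval_add, bval_opp; ring. }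
    pose proof (dval_norm_le (snd z' -v f0) (fst z' -v fst z)) as H2.
    pose proof (dval_norm_le (snd z' -v snd z) (fst z)) as H3.
    pose proof (HN (snd z' -v f0)) as H4; apply Rabs_le_inv in H4.
    pose proof (norm_sub_triangle (snd z') (snd z) f0) as H5; fold D in H5.
    set (D' := norm (snd z' -v f0)) in *.
    pose proof (norm_nonneg _ (fst z' -v fst z)); pose proof (norm_nonneg _ (snd z' -v snd z)).
    pose proof (norm_nonneg _ (fst z)).
    assert (0 <= D') by apply norm_nonneg.
    set (dx := norm (fst z' -v fst z)) in *; set (dg := norm (snd z' -v snd z)) in *.
    assert (D' * dx <= (D + 8 * e) * (8 * e)) by (apply Rmult_le_compat; lra).
    assert (dg * norm (fst z) <= 8 * e * b) by (apply Rmult_le_compat; lra).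
    assert (N * D' <= N * (D + 8 * e)) by (apply Rmult_le_compat_l; lra).
    assert (dval (snd z -v f0) (fst z) < e ^ 2 - b * D) by lra.
    assert (D * (8 * e + N - b) <= 0) by nra.
    nra.
Qed.
End StrongRepresentative.

(** * Bounded nets in the contact set *)

Section Deviation.
Context {V : NormedSpace} (p : Bidual V).

(** An l1 distance from [p] as seen by [F]; [norm_sum F] is a Lipschitz constant for it. *)
Fixpoint deviation (F : list (Dual V)) (x : V) : R :=
  match F with nil => 0 | f :: F => Rabs (dval f x - bval p f) + deviation F x end.
Fixpoint norm_sum (F : list (Dual V)) : R :=
  match F with nil => 0 | f :: F => norm f + norm_sum F end.

Lemma deviation_nonneg F x : 0 <= deviation F x.
Proof. induction F as [|f F IH]; simpl; [lra|]; pose proof (Rabs_pos (dval f x - bval p f)); lra. Qed.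

Lemma norm_sum_nonneg F : 0 <= norm_sum F.
Proof.
  induction F as [|f F IH]; cbn [norm_sum]; [lra|]; pose proof (norm_nonneg (dual_space V) f); lra.
Qed.

Lemma deviation_in F x f : In f F -> Rabs (dval f x - bval p f) <= deviation F x.
Proof.
  induction F as [|g F IH]; simpl; [tauto|]; intros [->|H].
  - pose proof (deviation_nonneg F x); lra.
  - specialize (IH H); pose proof (Rabs_pos (dval g x - bval p g)); lra.
Qed.

Lemma norm_sum_in F f : In f F -> norm f <= norm_sum F.
Proof.
  induction F as [|g F IH]; cbn [In norm_sum]; [tauto|]; intros [->|H].
  - pose proof (norm_sum_nonneg F); lra.
  - specialize (IH H); pose proof (norm_nonneg (dual_space V) g); lra.
Qed.

Lemma deviation_le F x e c :
  (forall f, In f F -> Rabs (dval f x - bval p f) <= e + c * norm f) ->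
  deviation F x <= INR (length F) * e + c * norm_sum F.
Proof.
  induction F as [|f F IH]; intros H.
  - cbn; lra.
  - cbn [deviation norm_sum length]; rewrite S_INR.
    assert (deviation F x <= INR (length F) * e + c * norm_sum F) by (apply IH; intros; apply H; now right).
    pose proof (H f (or_introl eq_refl)); lra.
Qed.

Lemma deviation_add F x y : deviation F (x +v y) <= deviation F x + norm_sum F * norm y.
Proof.
  induction F as [|f F IH]; cbn [deviation norm_sum]; [lra|].
  assert (Rabs (dval f (x +v y) - bval p f) <= Rabs (dval f x - bval p f) + norm f * norm y); [|lra].
  rewrite dval_add.
  replace (dval f x + dval f y - bval p f) with ((dval f x - bval p f) + dval f y) by ring.
  eapply Rle_trans; [apply Rabs_triang|]; apply Rplus_le_compat_l, dval_bound.
Qed.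

Lemma deviation_convex F : convex_fun (deviation F).
Proof.
  intros x y t Ht; induction F as [|f F IH]; cbn [deviation]; [lra|].
  assert (Rabs (dval f (t *v x +v (1 - t) *v y) - bval p f)
          <= t * Rabs (dval f x - bval p f) + (1 - t) * Rabs (dval f y - bval p f)); [|lra].
  rewrite dval_add, !dval_scal.
  replace (t * dval f x + (1 - t) * dval f y - bval p f)
    with (t * (dval f x - bval p f) + (1 - t) * (dval f y - bval p f)) by ring.
  eapply Rle_trans; [apply Rabs_triang|].
  rewrite !Rabs_mult, (Rabs_pos_eq t), (Rabs_pos_eq (1 - t)) by lra; lra.
Qed.
End Deviation.

Section GossezClosure.
Context {V : NormedSpace} (E : dual_pair V -> R -> Prop).
Hypothesis E_convex : convex_rel E.
Hypothesis E_closed : closed_rel E.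
Hypothesis E_above : forall z r, E z r -> coupling z <= r.
Hypothesis E_conj : conj_above E.

(** Generated by binary combinations, so that convexity is a constructor and stable properties
    follow by induction. *)
Inductive contact_hull : dual_pair V -> R -> Prop :=
  | hull_contact z : contact E z -> contact_hull z (coupling z)
  | hull_convex x y a b t : 0 <= t <= 1 -> contact_hull x a -> contact_hull y b ->
      contact_hull (t *v x +v (1 - t) *v y) (t * a + (1 - t) * b).

Lemma contact_hull_sub z r : contact_hull z r -> E z r.
Proof. induction 1; [auto | now apply E_convex]. Qed.

Lemma contact_hull_conj : conj_above contact_hull.
Proof.
  intros f p r0 H; apply Rnot_lt_le; intros Hlt.
  destruct (contact_negative_infimum E E_convex E_closed E_above E_conj f p (bval p f - r0)) as [z [Hz Hz']]; [lra|].
  pose proof (H z (coupling z) (hull_contact z Hz)); lra.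
Qed.

Variables (f0 : Dual V) (p0 : Bidual V).
Hypothesis related : forall z, contact E z ->
  0 <= coupling z - dval f0 (fst z) - bval p0 (snd z) + bval p0 f0.

(** The expression is affine in [(z, r)] jointly, so its sign passes from the contact set to the
    hull. *)
Lemma contact_hull_related z r : contact_hull z r -> 0 <= r - dval f0 (fst z) - bval p0 (snd z) + bval p0 f0.
Proof.
  induction 1; [auto|].
  proj_ops; rewrite dval_add, !dval_scal, bval_lin.
  replace (t * a + (1 - t) * b - (t * dval f0 (fst x) + (1 - t) * dval f0 (fst y)) -
    (t * bval p0 (snd x) + (1 - t) * bval p0 (snd y)) + bval p0 f0)
    with (t * (a - dval f0 (fst x) - bval p0 (snd x) + bval p0 f0)
      + (1 - t) * (b - dval f0 (fst y) - bval p0 (snd y) + bval p0 f0)) by ring.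
  apply Rplus_le_le_0_compat; apply Rmult_le_pos; lra.
Qed.

(** The penalties are of first order in [rho], the bound of second order; as the shift is
    nonnegative on the hull, the scaled deviation and the dual distance both fall below [2 rho].
    Dividing by [1 + norm_sum F] keeps the deviation caused by a multiplier of size [rho] below
    [rho]. *)
Lemma hull_approximation (w0 : dual_pair V) (r0 N : R) (F : list (Dual V)) (rho : R) :
  contact_hull w0 r0 -> 0 <= N -> (forall f : Dual V, Rabs (bval p0 f) <= N * norm f) ->
  0 < rho <= 1 ->
  exists z r, contact_hull z r /\ norm (fst z) <= N + 1 + norm (fst w0) /\
    r - dval f0 (fst z) - bval p0 (snd z) + bval p0 f0
    + rho * (deviation p0 F (fst z) / (1 + norm_sum F)) + rho * norm (snd z -v f0) < 2 * rho ^ 2.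
Proof.
  intros Hw0 HN0 HN Hrho.
  pose proof (norm_sum_nonneg F) as HS; pose proof (norm_nonneg _ (fst w0)).
  set (S := 1 + norm_sum F).
  assert (0 < / S) as HSi by (apply Rinv_0_lt_compat; unfold S; lra).
  destruct (fenchel_duality V contact_hull f0 p0 (fun x => rho * (deviation p0 F x / S))
    (fun x => norm x <= N + 1 + norm (fst w0)) (fun g => rho * norm (g -v f0)) w0 r0 1
    (rho * ((deviation p0 F (fst w0) + norm_sum F) / S)) (rho * (norm (snd w0 -v f0) + 1)) (2 * rho ^ 2))
    as [z [r [Hz [Hzb Hlt]]]]; auto; try lra.
  - intros x y a b t Ht Hx Hy; now apply hull_convex.
  - exact contact_hull_conj.
  - intros x y t Ht; pose proof (deviation_convex p0 F x y t Ht) as H1.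
    apply (Rmult_le_compat_l (rho * / S)) in H1; [unfold Rdiv; lra|].
    apply Rmult_le_pos; lra.
  - intros x y t Ht; pose proof (norm_sub_convex _ f0 x y t Ht) as H1; cbv beta in H1.
    apply (Rmult_le_compat_l rho) in H1; lra.
  - intros x y t Ht Hx Hy; eapply Rle_trans; [apply norm_triangle|].
    rewrite !norm_scal_nonneg by lra; nra.
  - intros x Hx; split.
    + eapply Rle_trans; [apply norm_triangle|]; lra.
    + apply Rmult_le_compat_l; [lra|]; apply Rmult_le_compat_r; [lra|].
      eapply Rle_trans; [apply deviation_add|].
      apply Rplus_le_compat_l; nra.
  - intros g Hg; apply Rmult_le_compat_l; [lra|].
    replace (snd w0 +v g -v f0) with ((snd w0 -v f0) +v g) by vec.
    eapply Rle_trans; [apply norm_triangle|]; lra.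
  - intros u v.
    destruct (classic (exists f : dual_space V, rho * norm f < bval v f)) as [[f Hf]|Hv].
    + destruct (unbounded_ray v rho (bval v u + bval p0 u - rho * (deviation p0 F zero / S)) f Hf) as [g Hg].
      exists zero, (f0 +v g); rewrite norm_zero, !dval_zero.
      replace (f0 +v g -v f0) with g by vec.
      split; [lra|]; assert (0 < rho ^ 2) by nra; lra.
    + assert (forall f : Dual V, Rabs (bval v f) <= rho * norm f) as Hv'.
      { intros f; apply Rabs_le; split; apply Rnot_lt_le; intros Hlt; apply Hv.
        - exists (opp f); rewrite norm_opp, bval_opp; lra.
        - exists f; lra. }
      (* The errors at [u] and at the members of [F] add up to [rho ^ 2]. *)
      set (e := rho ^ 2 / (1 + INR (length F))).
      pose proof (pos_INR (length F)) as Hlen.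
      assert (0 < rho ^ 2) by nra.
      assert (0 < e) as He by (apply Rdiv_lt_0_compat; lra).
      assert (e + INR (length F) * e = rho ^ 2) as He' by (unfold e; field; lra).
      assert (0 <= INR (length F) * e) by (apply Rmult_le_pos; lra).
      (* The ideal choice of [x] is the bidual point [p0 + v], bounded by [N + rho]; a vector of the
         ball imitates it on [u] and [F]. *)
      destruct (goldstine (blin p0 v 1 1) (N + rho) (u :: F) e) as [x [Hx1 Hx2]]; auto; [lra| |].
      { intros f; rewrite bval_blin.
        replace (1 * bval p0 f + 1 * bval v f) with (bval p0 f + bval v f) by ring.
        eapply Rle_trans; [apply Rabs_triang|].
        specialize (HN f); specialize (Hv' f); lra. }
      exists x, f0; split; [lra|].
      rewrite add_opp, norm_zero, bval_zero.
      pose proof (Hx2 u (or_introl eq_refl)) as Hu; rewrite bval_blin in Hu; apply Rabs_def2 in Hu.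
      assert (deviation p0 F x <= INR (length F) * e + rho * norm_sum F) as Hdev.
      { apply deviation_le; intros f Hf.
        pose proof (Hx2 f (or_intror Hf)) as Hfx; rewrite bval_blin in Hfx.
        specialize (Hv' f).
        replace (dval f x - bval p0 f) with ((dval f x - (1 * bval p0 f + 1 * bval v f)) + bval v f) by ring.
        eapply Rle_trans; [apply Rabs_triang|]; lra. }
      assert (deviation p0 F x / S <= rho).
      { apply (Rmult_le_reg_r S); [unfold S; lra|].
        replace (deviation p0 F x / S * S) with (deviation p0 F x) by (field; unfold S; lra).
        unfold S; nra. }
      assert (rho * (deviation p0 F x / S) <= rho * rho) by (apply Rmult_le_compat_l; lra).
      lra.
  - exists z, r; auto.
Qed.

(** [B] is fixed by the ball constraint and [f0] before [F] and [eps] are chosen; this uniformity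
    makes the net bounded. *)
Lemma contact_approximation :
  exists B, forall (F : list (Dual V)) (eps : R), 0 < eps ->
    exists z, contact E z /\ norm (fst z) <= B /\ norm (snd z) <= B /\
      (forall f, In f F -> Rabs (dval f (fst z) - bval p0 f) < eps) /\ norm (snd z -v f0) < eps.
Proof.
  destruct (conj_above_inhabited contact_hull contact_hull_conj) as [w0 [r0 Hw0]].
  destruct (bval_bound p0) as [N [HN0 HN]].
  set (R0 := N + 1 + norm (fst w0)).
  pose proof (norm_nonneg _ (fst w0)); pose proof (norm_nonneg (dual_space V) f0).
  assert (1 <= R0) as HR0 by (unfold R0; lra).
  exists (R0 + 1 + norm f0); intros F eps' Heps'.
  set (eps := Rmin 1 eps').
  assert (0 < eps) as Heps by (apply Rmin_pos; lra).
  assert (eps <= 1) as Heps1 by apply Rmin_l.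
  assert (eps <= eps') as Heps2 by apply Rmin_r.
  pose proof (norm_sum_nonneg F) as HS.
  set (S := 1 + norm_sum F).
  (* A move of length [8 t] changes the value of a member of [F] by at most [8 S t = 2 eps / 5]. *)
  set (t := eps / (20 * S)).
  assert (0 < t) as Ht by (apply Rdiv_lt_0_compat; unfold S; lra).
  assert (20 * (S * t) = eps) as Ht' by (unfold t; field; unfold S; lra).
  assert (t <= S * t) as HtS by (unfold S; nra).
  (* [rho C] bounds the excess of [r] over the coupling: [2 rho^2 <= 2 rho] from the shifted value,
     and [2 rho (R0 + N)] from pairing [snd z - f0], of norm below [2 rho], with [fst z] and
     [p0]. *)
  set (C := 2 + 2 * R0 + 2 * N).
  set (rho := Rmin (Rmin 1 (t ^ 2 / C)) (eps / (8 * S))).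
  assert (0 < rho) as Hrho.
  { repeat apply Rmin_pos; try lra; apply Rdiv_lt_0_compat; try nra; unfold C, S; lra. }
  assert (rho <= 1) as Hrho1 by (eapply Rle_trans; [apply Rmin_l | apply Rmin_l]).
  assert (rho * C <= t ^ 2) as HrhoC.
  { apply Rle_trans with (t ^ 2 / C * C).
    - apply Rmult_le_compat_r; [unfold C; lra|]; eapply Rle_trans; [apply Rmin_l | apply Rmin_r].
    - right; field; unfold C; lra. }
  assert (8 * (S * rho) <= eps) as HrhoS.
  { apply Rle_trans with (8 * (S * (eps / (8 * S)))).
    - apply Rmult_le_compat_l; [lra|]; apply Rmult_le_compat_l; [unfold S; lra | apply Rmin_r].
    - right; field; unfold S; lra. }
  destruct (hull_approximation w0 r0 N F rho) as [z [r [Hz [HzR Hlt]]]]; auto.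
  pose proof (contact_hull_related z r Hz) as Hrel.
  pose proof (contact_hull_sub z r Hz) as HEz.
  fold S R0 in Hlt, HzR.
  set (D := norm (snd z -v f0)) in *.
  assert (0 <= D) as HD by apply norm_nonneg.
  set (q := deviation p0 F (fst z) / S) in *.
  assert (0 <= q) as Hq.
  { apply Rmult_le_pos; [apply deviation_nonneg | left; apply Rinv_0_lt_compat; unfold S; lra]. }
  assert (0 <= rho * q) by (apply Rmult_le_pos; lra).
  assert (0 <= rho * D) by (apply Rmult_le_pos; lra).
  assert (D < 2 * rho) as HD2 by (apply (Rmult_lt_reg_l rho); lra).
  assert (q < 2 * rho) as Hq2 by (apply (Rmult_lt_reg_l rho); lra).
  assert (deviation p0 F (fst z) = q * S) as Hdev by (unfold q; field; unfold S; lra).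
  assert (S * q <= S * (2 * rho)) as HqS by (apply Rmult_le_compat_l; unfold S in *; lra).
  destruct (bronsted_rockafellar E E_convex E_closed E_above E_conj z r t) as [z' [Hz' Hd]]; auto.
  { assert (coupling z - dval f0 (fst z) - bval p0 (snd z) + bval p0 f0
      = dval (snd z -v f0) (fst z) - bval p0 (snd z -v f0)) as Hc.
    { unfold coupling; rewrite dval_dadd, dval_dopp, bval_add, bval_opp; ring. }
    pose proof (dval_norm_ge (snd z -v f0) (fst z)) as Hg1.
    pose proof (HN (snd z -v f0)) as Hg2; apply Rabs_le_inv in Hg2.
    fold D in Hg1, Hg2.
    assert (D * norm (fst z) <= 2 * rho * R0) by (apply Rmult_le_compat; auto using norm_nonneg; lra).
    assert (N * D <= N * (2 * rho)) by (apply Rmult_le_compat_l; lra).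
    assert (rho ^ 2 <= rho) by nra.
    unfold C in HrhoC; lra. }
  rewrite norm_prod in Hd; revert Hd; proj_ops; intros Hd.
  pose proof (norm_nonneg _ (fst z' -v fst z)); pose proof (norm_nonneg _ (snd z' -v snd z)).
  assert (rho <= S * rho) by (unfold S; nra).
  exists z'; split; auto; split; [|split; [|split]].
  - pose proof (norm_le_sub (fst z') (fst z)); lra.
  - pose proof (norm_le_sub (snd z') (snd z)); pose proof (norm_le_sub (snd z) f0) as Hk; fold D in Hk; lra.
  - intros f Hf.
    pose proof (deviation_in p0 F (fst z) f Hf) as Hin.
    replace (dval f (fst z') - bval p0 f) with (dval f (fst z' -v fst z) + (dval f (fst z) - bval p0 f))
      by (rewrite dval_add, dval_opp; ring).
    eapply Rle_lt_trans; [apply Rabs_triang|].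
    pose proof (dval_bound f (fst z' -v fst z)) as Hbd.
    change (dnormf (dval f)) with (norm f) in Hbd.
    pose proof (norm_sum_in F f Hf).
    assert (norm f * norm (fst z' -v fst z) <= S * (8 * t)).
    { apply Rmult_le_compat; try lra; [apply (norm_nonneg (dual_space V)) | unfold S; lra]. }
    lra.
  - pose proof (norm_sub_triangle (snd z') (snd z) f0) as Hk; fold D in Hk; lra.
Qed.
End GossezClosure.

(** * Epigraphs and conjugates *)

Lemma Rbar_le_trans a b c : Rbar_le a b -> Rbar_le b c -> Rbar_le a c.
Proof. destruct a, b, c; simpl; try tauto; lra. Qed.

Lemma Rbar_le_refl a : Rbar_le a a.
Proof. destruct a; simpl; auto; lra. Qed.

Lemma Rbar_le_antisym a b : Rbar_le a b -> Rbar_le b a -> a = b.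
Proof. destruct a, b; simpl; try tauto; intros; f_equal; lra. Qed.

(** Real upper bounds determine the order; this is the bridge from extended values to epigraph
    relations. *)
Lemma Rbar_le_of_reals a b : (forall r, Rbar_le b (Fin r) -> Rbar_le a (Fin r)) -> Rbar_le a b.
Proof.
  intros H; destruct b as [b| |].
  - apply H; simpl; lra.
  - destruct a; simpl; auto.
  - destruct a as [a| |]; simpl; auto.
    + specialize (H (a - 1) I); simpl in H; lra.
    + exact (H 0 I).
Qed.

Lemma Rbar_glb_exists (S : Rbar -> Prop) : exists m, Rbar_is_glb S m.
Proof.
  destruct (classic (exists r, forall s, S s -> Rbar_le (Fin r) s)) as [[r Hr]|Hn].
  - destruct (classic (exists a, S (Fin a))) as [Ha|Hna].
    + destruct (inf_exists (fun a => S (Fin a)) r Ha) as [i [Hi1 Hi2]].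
      { intros e He; apply (Hr _ He). }
      exists (Fin i); split.
      * intros [s| |] Hs; simpl; auto; apply (Hr _ Hs).
      * intros [b| |] Hb; simpl; auto.
        -- apply Rnot_lt_le; intros Hlt.
           destruct (Hi2 b Hlt) as [e [He He']]; specialize (Hb _ He); simpl in Hb; lra.
        -- destruct Ha as [a Ha]; exact (Hb _ Ha).
    + exists PInf; split; [|intros [b| |] _; simpl; auto].
      intros [s| |] Hs; simpl; auto; [apply Hna; eauto | exact (Hr _ Hs)].
  - exists MInf; split; [simpl; auto|].
    intros [b| |] Hb; simpl; auto.
    + apply Hn; now exists b.
    + apply Hn; exists 0; intros s Hs; eapply Rbar_le_trans; [|apply (Hb _ Hs)]; simpl; auto.
Qed.

Lemma Rbar_lub_exists (S : Rbar -> Prop) : exists m, Rbar_is_lub S m.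
Proof.
  destruct (Rbar_glb_exists (fun b => forall s, S s -> Rbar_le s b)) as [m [Hm1 Hm2]].
  exists m; split; auto.
Qed.

Lemma Rbar_sup_le (S : Rbar -> Prop) b : Rbar_le (Rbar_sup S) b <-> forall s, S s -> Rbar_le s b.
Proof.
  assert (Rbar_is_lub S (Rbar_sup S)) as [H1 H2] by (unfold Rbar_sup; apply epsilon_spec, Rbar_lub_exists).
  split; auto; intros H s Hs; eapply Rbar_le_trans; eauto.
Qed.

Lemma Rbar_inf_le (S : Rbar -> Prop) r :
  Rbar_le (Rbar_inf S) (Fin r) <-> forall eps, 0 < eps -> exists u, S u /\ Rbar_le u (Fin (r + eps)).
Proof.
  assert (Rbar_is_glb S (Rbar_inf S)) as [H1 H2] by (unfold Rbar_inf; apply epsilon_spec, Rbar_glb_exists).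
  split.
  - intros H eps Heps; apply NNPP; intros Hn.
    assert (Rbar_le (Fin (r + eps)) (Rbar_inf S)) as H3.
    { apply H2; intros [s| |] Hs; simpl; auto.
      - apply Rnot_lt_le; intros Hlt; apply Hn; exists (Fin s); simpl; split; auto; lra.
      - apply Hn; exists MInf; simpl; auto. }
    pose proof (Rbar_le_trans _ _ _ H3 H) as H4; simpl in H4; lra.
  - intros H; destruct (Rbar_inf S) as [i| |]; simpl; auto.
    + apply Rnot_lt_le; intros Hlt.
      destruct (H ((i - r) / 2)) as [u [Hu Hur]]; [lra|].
      pose proof (Rbar_le_trans _ _ _ (H1 u Hu) Hur) as H3; simpl in H3; lra.
    + destruct (H 1) as [u [Hu Hur]]; [lra|].
      exact (Rbar_le_trans _ _ _ (H1 u Hu) Hur).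
Qed.

Section Epigraph.
Context {V : NormedSpace}.
Implicit Type h : Fun2 V.

Definition epi h (z : dual_pair V) (r : R) : Prop := Rbar_le (h (fst z) (snd z)) (Fin r).

Lemma epi_up h z r s : epi h z r -> r <= s -> epi h z s.
Proof. intros H Hrs; eapply Rbar_le_trans; [exact H | exact Hrs]. Qed.

Lemma convex2_iff h : convex2 h <-> convex_rel (epi h).
Proof.
  split.
  - intros H [y1 f1] [y2 f2] r s t Ht H1 H2; apply (H y1 y2 f1 f2); auto.
  - intros H y1 y2 f1 f2 f r s t H1 H2 Ht Hf.
    pose proof (H (y1, f1) (y2, f2) r s t Ht H1 H2) as H3.
    replace f with (t *v f1 +v (1 - t) *v f2); [exact H3|].
    apply dval_ext; intros x; rewrite Hf; reflexivity.
Qed.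

Lemma lsc_hull_epi h z r :
  epi (lsc_hull h) z r <-> forall eps, 0 < eps -> exists w, norm (w -v z) < eps /\ epi h w (r + eps).
Proof.
  unfold epi at 1, lsc_hull; rewrite Rbar_sup_le; split.
  - intros H eps Heps.
    specialize (H _ (ex_intro _ eps (conj Heps eq_refl))).
    rewrite Rbar_inf_le in H; destruct (H eps Heps) as [u [[y [f [Hd ->]]] Hu]].
    exists (y, f); split; [exact Hd | exact Hu].
  - intros H s [eps [Heps ->]]; apply Rbar_inf_le; intros eps' Heps'.
    destruct (H (Rmin eps eps')) as [w [Hd Hw]]; [now apply Rmin_pos|].
    pose proof (Rmin_l eps eps'); pose proof (Rmin_r eps eps').
    exists (h (fst w) (snd w)); split.
    + exists (fst w), (snd w); split; auto.
      apply Rlt_le_trans with (Rmin eps eps'); [exact Hd | auto].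
    + eapply epi_up; [exact Hw | lra].
Qed.

Lemma norm_lsc_iff h : norm_lsc h <-> closed_rel (epi h).
Proof.
  split.
  - intros H z r Hz; eapply Rbar_le_trans; [apply H|].
    apply lsc_hull_epi; intros eps Heps.
    destruct (Hz eps Heps) as [w [s [Hw [Hd Hs]]]]; exists w; split; auto; eapply epi_up; eauto.
  - intros H y f; apply Rbar_le_of_reals; intros r Hr.
    apply (H (y, f) r); intros eps Heps.
    destruct (proj1 (lsc_hull_epi h (y, f) r) Hr eps Heps) as [w [Hd Hw]].
    exists w, (r + eps); repeat split; auto; lra.
Qed.

Lemma lsc_hull_le h z r : epi h z r -> epi (lsc_hull h) z r.
Proof.
  intros H; apply lsc_hull_epi; intros eps Heps; exists z; split.
  - rewrite add_opp, norm_zero; auto.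
  - eapply epi_up; eauto; lra.
Qed.

Lemma lsc_hull_closed h : closed_rel (epi (lsc_hull h)).
Proof.
  intros z r H; apply lsc_hull_epi; intros eps Heps.
  destruct (H (eps / 2)) as [w [s [Hw [Hd Hs]]]]; [lra|].
  rewrite lsc_hull_epi in Hw; destruct (Hw (eps / 2)) as [w' [Hd' Hw']]; [lra|].
  exists w'; split.
  - pose proof (norm_sub_triangle w' w z); lra.
  - eapply epi_up; eauto; lra.
Qed.

Lemma lsc_hull_convex h : convex_rel (epi h) -> convex_rel (epi (lsc_hull h)).
Proof.
  intros H x y a b t Ht Hx Hy; apply lsc_hull_epi; intros eps Heps.
  rewrite lsc_hull_epi in Hx, Hy.
  destruct (Hx eps Heps) as [x' [Hdx Hx']], (Hy eps Heps) as [y' [Hdy Hy']].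
  exists (t *v x' +v (1 - t) *v y'); split.
  - replace (t *v x' +v (1 - t) *v y' -v (t *v x +v (1 - t) *v y))
      with (t *v (x' -v x) +v (1 - t) *v (y' -v y)) by vec.
    eapply Rle_lt_trans; [apply norm_triangle|]; rewrite !norm_scal_nonneg by lra.
    destruct (Rle_lt_dec t (1 / 2)); nra.
  - eapply epi_up; [apply H; eauto|]; lra.
Qed.

Lemma coupling_le_limit (z : dual_pair V) r :
  (forall eps, 0 < eps -> exists w, norm (w -v z) < eps /\ coupling w <= r + eps) -> coupling z <= r.
Proof.
  intros H; apply Rnot_lt_le; intros Hlt.
  pose proof (norm_nonneg _ z).
  set (e := Rmin 1 ((coupling z - r) / (norm z + 4))).
  assert (0 < e) as He by (apply Rmin_pos; [lra | apply Rdiv_lt_0_compat; lra]).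
  assert (e <= 1) by apply Rmin_l.
  assert ((norm z + 4) * e <= coupling z - r) as He2.
  { apply Rle_trans with ((norm z + 4) * ((coupling z - r) / (norm z + 4))).
    - apply Rmult_le_compat_l; [lra | apply Rmin_r].
    - right; field; lra. }
  destruct (H e He) as [w [Hd Hw]].
  pose proof (coupling_near z w) as Hn; rewrite norm_sub_sym in Hn.
  pose proof (norm_le_sub w z).
  pose proof (norm_nonneg _ (w -v z)); set (d := norm (w -v z)) in *.
  assert (norm w * d <= (norm z + 1) * e) by (apply Rmult_le_compat; auto using norm_nonneg; lra).
  assert (d ^ 2 <= e) by nra.
  lra.
Qed.

Lemma conj2_le h f p r :
  Rbar_le (conj2 h f p) (Fin r) <->
  forall z s, epi h z s -> dval f (fst z) + bval p (snd z) - s <= r.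
Proof.
  unfold conj2; rewrite Rbar_sup_le; split.
  - intros H [y g] s Hs; unfold epi in Hs; cbn [fst snd] in *.
    specialize (H _ (ex_intro _ y (ex_intro _ g eq_refl))).
    destruct (h y g); simpl in *; try tauto; lra.
  - intros H u [y [g ->]].
    specialize (H (y, g)); unfold epi in H; cbn [fst snd] in *.
    destruct (h y g) as [a| |]; simpl in *; auto.
    + apply (H a); lra.
    + specialize (H (dval f y + bval p g - r - 1) I); lra.
Qed.

Lemma conj_above_iff h :
  (forall f p, Rbar_le (Fin (bval p f)) (conj2 h f p)) <-> conj_above (epi h).
Proof.
  split.
  - intros H f p r Hr.
    pose proof (Rbar_le_trans _ _ _ (H f p) (proj2 (conj2_le h f p r) Hr)) as H1; exact H1.
  - intros H f p; apply Rbar_le_of_reals; intros r Hr; apply H; now apply conj2_le.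
Qed.

Lemma above_coupling_iff h :
  (forall y f, Rbar_le (Fin (dval f y)) (h y f)) <-> (forall z r, epi h z r -> coupling z <= r).
Proof.
  split.
  - intros H z r Hz; exact (Rbar_le_trans _ _ _ (H (fst z) (snd z)) Hz).
  - intros H y f; apply Rbar_le_of_reals; intros r Hr; exact (H (y, f) r Hr).
Qed.

(* Differentiate [E - coupling >= 0] at a zero along segments. *)
Lemma contact_conj (E : dual_pair V -> R -> Prop) z w s :
  convex_rel E -> (forall z r, E z r -> coupling z <= r) -> contact E z -> E w s ->
  dval (snd z) (fst w) + dval (snd w) (fst z) - s <= coupling z.
Proof.
  intros Hc Ha Hz Hw; apply Rnot_lt_le; intros Hlt.
  set (g := s - (dval (snd z) (fst w) + dval (snd w) (fst z)) + coupling z).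
  assert (forall t, 0 < t <= 1 -> 0 <= g + t * Rabs (coupling (w -v z))) as H.
  { intros t Ht.
    pose proof (Ha _ _ (Hc w z s (coupling z) t ltac:(lra) Hw Hz)) as H.
    rewrite coupling_convex_combination in H.
    assert (0 <= t * (g - t * coupling (w -v z))) as H1.
    { pose proof (coupling_sub w z) as E1; unfold g.
      replace (dval (snd z) (fst w) + dval (snd w) (fst z)) with (coupling w + coupling z - coupling (w -v z)) by lra.
      lra. }
    apply (Rmult_le_reg_l t); [lra|].
    pose proof (Rle_abs (- coupling (w -v z))) as H2; rewrite Rabs_Ropp in H2.
    apply (Rmult_le_compat_l (t * t)) in H2; [lra | nra]. }
  set (m := Rabs (coupling (w -v z))) in *.
  assert (0 <= m) by apply Rabs_pos.
  set (t := Rmin 1 (- g / (2 * (m + 1)))).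
  assert (g < 0) by (unfold g; lra).
  assert (0 < t) by (apply Rmin_pos; [lra | apply Rdiv_lt_0_compat; lra]).
  assert (t <= 1) by apply Rmin_l.
  assert (t * (m + 1) <= - g / 2).
  { apply Rle_trans with (- g / (2 * (m + 1)) * (m + 1)).
    - apply Rmult_le_compat_r; [lra | apply Rmin_r].
    - right; field; lra. }
  specialize (H t ltac:(lra)); lra.
Qed.
End Epigraph.

(** If [(z0, t0)] were missing, [G] would exceed [t0 + eps] near [z0], and elsewhere the affine
    minorant keeps it above a steep downward cone with apex at height [t0 + eps]. An affine
    functional between the two contradicts the conjugate bounds. *)
Lemma fenchel_moreau (Z : NormedSpace) (G : Z -> R -> Prop) (l0 : Dual Z) (m0 : R) (z0 : Z) (t0 : R) :
  convex_rel G -> closed_rel G -> (exists z r, G z r) ->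
  (forall z r, G z r -> dval l0 z - m0 <= r) ->
  (forall (l : Dual Z) rho, (forall z r, G z r -> dval l z - r <= rho) -> dval l z0 - rho <= t0) ->
  G z0 t0.
Proof.
  intros Hc Hcl [z1 [r1 Hz1]] Hmin H; apply Hcl; intros eps Heps; apply NNPP; intros Hn.
  assert (forall z r, G z r -> norm (z -v z0) < eps -> t0 + eps < r) as Hfar.
  { intros z r Hz Hd; apply Rnot_le_lt; intros Hle; apply Hn; now exists z, r. }
  (* Outside the [eps]-ball the extra slope [C] makes up for the heights of the minorant and of the
     apex. *)
  set (C := (Rabs (dval l0 z0 - m0) + Rabs (t0 + eps)) / eps).
  assert (C * eps = Rabs (dval l0 z0 - m0) + Rabs (t0 + eps)) as HC by (unfold C; field; lra).
  assert (0 <= C) as HC0.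
  { apply Rmult_le_pos; [|left; now apply Rinv_0_lt_compat].
    apply Rplus_le_le_0_compat; apply Rabs_pos. }
  pose proof (norm_nonneg (dual_space Z) l0) as Hl0.
  set (K := norm l0 + C).
  destruct (sandwich Z G (fun z s => K * norm (z -v z0) - t0 - eps <= s) z1 r1
    (K * (norm (z1 -v z0) + 1) - t0 - eps) 1) as [l Hl]; auto; try lra.
  - intros x y a b t Ht Hx Hy.
    pose proof (norm_sub_convex Z z0 x y t Ht) as Hxy; cbv beta in Hxy.
    apply (Rmult_le_compat_l K) in Hxy; [|unfold K; lra].
    apply (Rmult_le_compat_l t) in Hx; [|lra].
    apply (Rmult_le_compat_l (1 - t)) in Hy; [|lra].
    lra.
  - intros z r s Hz Hs.
    pose proof (norm_nonneg _ (z -v z0)) as Hd.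
    destruct (Rlt_le_dec (norm (z -v z0)) eps) as [Hlt|Hge].
    + specialize (Hfar z r Hz Hlt).
      assert (0 <= K * norm (z -v z0)) by (apply Rmult_le_pos; unfold K; lra); lra.
    + specialize (Hmin z r Hz).
      pose proof (dval_norm_ge l0 (z -v z0)) as H1; rewrite dval_add, dval_opp in H1.
      assert (C * eps <= C * norm (z -v z0)) by (apply Rmult_le_compat_l; auto).
      pose proof (Rle_abs (t0 + eps)); pose proof (Rle_abs (- (dval l0 z0 - m0))) as Hneg.
      rewrite Rabs_Ropp in Hneg; unfold K in Hs; lra.
  - intros z Hz.
    assert (norm (z1 +v z -v z0) <= norm (z1 -v z0) + 1) as Hd.
    { replace (z1 +v z -v z0) with ((z1 -v z0) +v z) by vec.
      eapply Rle_trans; [apply norm_triangle | lra]. }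
    apply (Rmult_le_compat_l K) in Hd; unfold K in *; lra.
  - specialize (H (opp l : dual_space Z) (dval (opp l : dual_space Z) z0 - t0 - eps)).
    rewrite !dval_dopp in H.
    assert (- dval l z0 - (- dval l z0 - t0 - eps) <= t0); [|lra].
    apply H; intros z r Hz; rewrite dval_dopp.
    specialize (Hl z r z0 (- t0 - eps) Hz); cbv beta in Hl.
    rewrite add_opp, norm_zero in Hl; specialize (Hl ltac:(lra)); lra.
Qed.

(** * Baire category and open mappings *)

(** If every [A n] failed to be dense in every ball of [L], nested balls, each avoiding one more
    [A n], would shrink to a point of [L] outside all of them. *)
Lemma baire (V : NormedSpace) (L : V -> Prop) (A : nat -> V -> Prop) (y0 : V) :
  norm_closed L -> L y0 -> (forall z, L z -> exists n, A n z) ->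
  exists n y rho, L y /\ 0 < rho /\
    forall z, L z -> norm (z -v y) < rho -> forall eps, 0 < eps -> exists w, A n w /\ norm (w -v z) < eps.
Proof.
  intros HLc HL0 HA; apply NNPP; intros Hn.
  destruct (choice (fun (s : nat * (V * R)) (s' : V * R) => L (fst (snd s)) /\ 0 < snd (snd s) ->
      L (fst s') /\ 0 < snd s' /\ snd s' <= snd (snd s) / 2 /\
      norm (fst s' -v fst (snd s)) + snd s' <= snd (snd s) /\
      forall w, A (fst s) w -> snd s' < norm (w -v fst s'))) as [next Hnext].
  { intros [n [y rho]]; cbn [fst snd].
    destruct (classic (L y /\ 0 < rho)) as [[Hy Hrho]|Hno]; [|exists (y, rho); tauto].
    assert (exists z, L z /\ norm (z -v y) < rho /\ exists eps, 0 < eps /\ forall w, A n w -> eps <= norm (w -v z))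
      as [z [Hz [Hd [eps [Heps Hfar]]]]].
    { apply NNPP; intros Hn2; apply Hn; exists n, y, rho; repeat split; auto.
      intros z Hz Hd eps Heps; apply NNPP; intros Hn3; apply Hn2; exists z; repeat split; auto.
      exists eps; split; auto; intros w Hw; apply Rnot_lt_le; intros Hlt; apply Hn3; eauto. }
    (* The first bound keeps the closed ball off [A n]; the second keeps it inside the previous ball
       and halves the radius. *)
    exists (z, Rmin (eps / 2) ((rho - norm (z -v y)) / 2)); intros _; cbn [fst snd].
    pose proof (Rmin_l (eps / 2) ((rho - norm (z -v y)) / 2)).
    pose proof (Rmin_r (eps / 2) ((rho - norm (z -v y)) / 2)).
    pose proof (norm_nonneg _ (z -v y)).
    repeat split; auto; try lra.
    - apply Rmin_pos; lra.
    - intros w Hw; specialize (Hfar w Hw); lra. }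
  pose (s := fix s n := match n with O => (y0, 1) | S n => next (n, s n) end).
  assert (forall n, L (fst (s n)) /\ 0 < snd (s n)) as Hs.
  { induction n as [|n IH]; [cbn; split; [auto | lra]|].
    destruct (Hnext (n, s n) IH) as [H1 [H2 _]]; now split. }
  assert (forall n, snd (s (S n)) <= snd (s n) / 2) as Hhalf.
  { intros n; apply (Hnext (n, s n) (Hs n)). }
  assert (forall n, norm (fst (s (S n)) -v fst (s n)) + snd (s (S n)) <= snd (s n)) as Hnest.
  { intros n; apply (Hnext (n, s n) (Hs n)). }
  assert (forall n w, A n w -> snd (s (S n)) < norm (w -v fst (s (S n)))) as Havoid.
  { intros n; apply (Hnext (n, s n) (Hs n)). }
  assert (forall n, snd (s n) <= (/ 2) ^ n) as Hr.
  { induction n as [|n IH]; [cbn; lra|]; specialize (Hhalf n).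
    change ((/ 2) ^ S n) with (/ 2 * (/ 2) ^ n); lra. }
  assert (forall n k, norm (fst (s (k + n)%nat) -v fst (s n)) + snd (s (k + n)%nat) <= snd (s n)) as Hnk.
  { intros n k; induction k as [|k IH].
    - cbn [Nat.add]; rewrite add_opp, norm_zero; lra.
    - pose proof (Hnest (k + n)%nat) as H1.
      pose proof (norm_sub_triangle (fst (s (S k + n)%nat)) (fst (s (k + n)%nat)) (fst (s n))) as H2.
      cbn [Nat.add] in *; lra. }
  destruct (geometric_limit V (fun n => fst (s n)) 1) as [l Hl].
  { intros n; specialize (Hnest n); specialize (Hr n); destruct (Hs (S n)); lra. }
  assert (forall n, norm (l -v fst (s n)) <= snd (s n)) as Hball.
  { intros n; apply Rnot_lt_le; intros Hlt.
    destruct (pow_half_small 2 (norm (l -v fst (s n)) - snd (s n))) as [N HN]; [lra|].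
    set (m := max N n); specialize (HN m ltac:(unfold m; lia)).
    pose proof (Hnk n (m - n)%nat) as H1.
    replace (m - n + n)%nat with m in H1 by (unfold m; lia).
    pose proof (norm_sub_triangle l (fst (s m)) (fst (s n))).
    specialize (Hl m); destruct (Hs m); lra. }
  assert (L l) as HLl.
  { apply HLc; intros eps Heps.
    destruct (pow_half_small 1 eps Heps) as [N HN]; specialize (HN N (Nat.le_refl N)).
    exists (fst (s N)); split; [apply Hs|].
    specialize (Hball N); specialize (Hr N); lra. }
  destruct (HA l HLl) as [n Hnl].
  specialize (Havoid n l Hnl); specialize (Hball (S n)); lra.
Qed.

Section OpenMapping.
Variables (V W : NormedSpace) (Psi : prod_space V W -> R -> Prop) (L : V -> Prop).
Hypothesis Psi_convex : convex_rel Psi.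
Hypothesis Psi_closed : closed_rel Psi.
Hypothesis L_closed : norm_closed L.
Hypothesis L_add : forall x y, L x -> L y -> L (x +v y).
Hypothesis L_scal : forall a x, L x -> L (a *v x).
Hypothesis Psi_dom : forall q s, Psi q s -> L (fst q).
Hypothesis Psi_core : forall z, L z -> exists d w s, 0 < d /\ Psi (d *v z, w) s.
Hypothesis L_zero : L zero.

Lemma Psi_up q s s' : Psi q s -> s <= s' -> Psi q s'.
Proof.
  intros H Hs; apply Psi_closed; intros eps Heps; exists q, s.
  rewrite add_opp, norm_zero; repeat split; auto; lra.
Qed.

(** One number bounds both the partner [w] and the value, so that Baire's theorem runs over a single
    index. *)
Definition bounded_fiber (n : R) (z : V) : Prop := exists w : W, norm w <= n /\ Psi (z, w) n.

Lemma bounded_fiber_up n m z : n <= m -> bounded_fiber n z -> bounded_fiber m z.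
Proof. intros Hnm [w [Hw Hz]]; exists w; split; [lra | eapply Psi_up; eauto]. Qed.

Lemma bounded_fiber_convex n x y t :
  0 <= t <= 1 -> bounded_fiber n x -> bounded_fiber n y -> bounded_fiber n (t *v x +v (1 - t) *v y).
Proof.
  intros Ht [w [Hw Hx]] [w' [Hw' Hy]]; exists (t *v w +v (1 - t) *v w'); split.
  - eapply Rle_trans; [apply norm_triangle|]; rewrite !norm_scal_nonneg by lra; nra.
  - pose proof (Psi_convex _ _ _ _ t Ht Hx Hy) as H.
    replace (t * n + (1 - t) * n) with n in H by ring; exact H.
Qed.

(** Both [d z] and [zero] have fibers, and for large [n] the vector [z / (n + 1)] is a convex
    combination of them. *)
Lemma bounded_fiber_exhaust z : L z -> exists n, bounded_fiber (INR (S n)) (/ INR (S n) *v z).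
Proof.
  intros Hz.
  destruct (Psi_core z Hz) as [d [w [s [Hd Hs]]]].
  destruct (Psi_core zero L_zero) as [d' [w' [s' [Hd' Hs']]]].
  rewrite scal_zero_r in Hs'.
  destruct (INR_unbounded (/ d + norm w + norm w' + Rabs s + Rabs s')) as [n Hn].
  assert (0 < / d) by now apply Rinv_0_lt_compat.
  pose proof (norm_nonneg _ w); pose proof (norm_nonneg _ w').
  pose proof (Rabs_pos s); pose proof (Rabs_pos s'); pose proof (Rle_abs s); pose proof (Rle_abs s').
  exists n; rewrite S_INR; set (N := INR n) in *.
  assert (bounded_fiber (N + 1) (d *v z)) as Hz1 by (exists w; split; [lra | eapply Psi_up; eauto; lra]).
  assert (bounded_fiber (N + 1) zero) as Hz2 by (exists w'; split; [lra | eapply Psi_up; eauto; lra]).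
  assert (/ (N + 1) * / d <= 1) as Hle.
  { apply (Rmult_le_reg_l (N + 1)); [lra|].
    rewrite <- Rmult_assoc, Rinv_r by lra; lra. }
  assert (0 <= / (N + 1) * / d) as Hge.
  { apply Rmult_le_pos; left; [apply Rinv_0_lt_compat; lra | auto]. }
  replace (/ (N + 1) *v z) with ((/ (N + 1) * / d) *v (d *v z) +v (1 - / (N + 1) * / d) *v zero)
    by (vec_coefs; field; lra).
  now apply bounded_fiber_convex.
Qed.

(** Baire's theorem gives density near some [y]; averaging with a fiber over a multiple of [- y]
    recentres the ball at the origin. *)
Lemma bounded_fiber_dense : exists N eps, 0 < eps /\
  forall z, L z -> norm z <= eps -> forall eta, 0 < eta -> exists c, bounded_fiber N c /\ norm (c -v z) < eta.
Proof.
  destruct (baire V L (fun n z => bounded_fiber (INR (S n)) (/ INR (S n) *v z)) zero) as [n [y [rho [Hy [Hrho Hd]]]]];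
    auto using bounded_fiber_exhaust.
  destruct (bounded_fiber_exhaust ((-1) *v y)) as [m Hm]; auto.
  pose proof (pos_INR n); pose proof (pos_INR m).
  rewrite S_INR in Hm; setoid_rewrite S_INR in Hd.
  set (p := INR n + 1) in *; set (q := INR m + 1) in *.
  assert (1 <= p) as Hp by (unfold p; lra); assert (1 <= q) as Hq by (unfold q; lra).
  assert (0 < / p) by (apply Rinv_0_lt_compat; lra).
  set (N := Rmax p q); pose proof (Rmax_l p q); pose proof (Rmax_r p q).
  assert (0 < p / (p + q) * / p) as Hpos.
  { apply Rmult_lt_0_compat; [apply Rdiv_lt_0_compat; lra | auto]. }
  exists N, (p / (p + q) * / p * (rho / 2)); split; [apply Rmult_lt_0_compat; lra|].
  intros z Hz Hzn eta Heta.
  assert (/ (p + q) = p / (p + q) * / p) as Epq by (field; lra).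
  rewrite <- Epq in *.
  (* If [w] is near this point, then [(w - y) / (p + q)], a convex combination of [w / p] and
     [- y / q], is near [z]. *)
  destruct (Hd (y +v (p + q) *v z)) with (eps := eta) as [w [Hw Hwd]]; auto.
  { replace (y +v (p + q) *v z -v y) with ((p + q) *v z) by vec.
    rewrite norm_scal_nonneg by lra.
    apply Rle_lt_trans with ((p + q) * (/ (p + q) * (rho / 2))).
    - apply Rmult_le_compat_l; lra.
    - rewrite <- Rmult_assoc, Rinv_r by lra; lra. }
  assert (0 <= p / (p + q) <= 1) as Hl.
  { split; [left; apply Rdiv_lt_0_compat; lra|].
    apply (Rmult_le_reg_r (p + q)); [lra|].
    replace (p / (p + q) * (p + q)) with p by (field; lra); lra. }
  exists (p / (p + q) *v (/ p *v w) +v (1 - p / (p + q)) *v (/ q *v ((-1) *v y))); split.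
  - apply bounded_fiber_convex; auto; [apply bounded_fiber_up with p | apply bounded_fiber_up with q]; auto.
  - replace (p / (p + q) *v (/ p *v w) +v (1 - p / (p + q)) *v (/ q *v ((-1) *v y)) -v z)
      with (/ (p + q) *v (w -v (y +v (p + q) *v z))) by (vec_coefs; field; lra).
    rewrite norm_scal_nonneg by lra.
    assert (/ (p + q) <= 1).
    { rewrite <- Rinv_1; apply Rinv_le_contravar; lra. }
    pose proof (norm_nonneg _ (w -v (y +v (p + q) *v z))); nra.
Qed.

(* Successive approximation: every small [z] is twice an infinite convex combination
   [sum 2^-(k+1) c_k] of points with fibers in a fixed ball; closedness passes to the limit. *)
Lemma open_mapping : exists K eps, 0 < eps /\
  forall z, L z -> norm z <= eps -> exists w, Psi (z, w) K.
Proof.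
  destruct bounded_fiber_dense as [N [eps [Heps Hdense]]].
  exists N, (eps / 2); split; [lra|].
  intros z0 Hz0 Hz0n.
  destruct (choice (fun (e : V) (q : prod_space V W) => L e /\ norm e <= eps ->
     norm (snd q) <= N /\ Psi q N /\ norm (e -v fst q) <= eps / 2)) as [sel Hsel].
  { intros e; destruct (classic (L e /\ norm e <= eps)) as [[H1 H2]|Hn]; [|exists zero; tauto].
    destruct (Hdense e H1 H2 (eps / 2)) as [c [[w [Hw Hc]] Hd]]; [lra|].
    exists (c, w); intros _; cbn [fst snd]; rewrite norm_sub_sym; repeat split; auto; lra. }
  (* The state holds the rescaled error, [e_0 = 2 z0] and [e_(k+1) = 2 (e_k - c_k)], and the partial
     sum. Errors stay within [eps] because [c_k] is chosen within [eps / 2] of [e_k]. *)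
  pose (st := fix st k := match k with
    | O => (2 *v z0, zero : prod_space V W)
    | S k => (2 *v (fst (st k) -v fst (sel (fst (st k)))), snd (st k) +v (/ 2) ^ S k *v sel (fst (st k)))
    end).
  assert (forall k, L (fst (st k)) /\ norm (fst (st k)) <= eps) as He.
  { induction k as [|k IH].
    - cbn [st fst]; split; auto; rewrite norm_scal_nonneg; lra.
    - destruct (Hsel _ IH) as [H1 [H2 H3]].
      cbn [st fst]; split.
      + apply L_scal, L_add; [apply IH|]; rewrite opp_scal; apply L_scal; eapply Psi_dom; eauto.
      + rewrite norm_scal_nonneg; lra. }
  assert (forall k, z0 = fst (snd (st k)) +v (/ 2) ^ S k *v fst (st k)) as Hsum.
  { induction k as [|k IH].
    - cbn [st fst snd pow]; change (fst (zero : prod_space V W)) with (zero : V); vec_coefs; field.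
    - rewrite IH at 1; cbn [st fst snd]; proj_ops; cbn [pow].
      set (x := fst (st k)); set (y := fst (snd (st k))); set (c := fst (sel x)); vec_coefs; field. }
  (* The weights used so far add up to [1 - 2^-k]; giving the rest to any admissible [q] yields a
     genuine convex combination. *)
  assert (forall k q, Psi q N -> Psi (snd (st k) +v (/ 2) ^ k *v q) N) as Hcomb.
  { induction k as [|k IH]; intros q Hq.
    - cbn [st snd pow]; replace (zero +v 1 *v q) with q by vec; auto.
    - destruct (Hsel _ (He k)) as [H1 [H2 H3]].
      pose proof (Psi_convex _ _ _ _ (/ 2) ltac:(lra) H2 Hq) as H.
      replace (/ 2 * N + (1 - / 2) * N) with N in H by field.
      apply IH in H.
      cbn [st snd pow].
      match goal with H : Psi ?a _ |- Psi ?b _ => replace b with a; [exact H|] end.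
      vec_coefs; field. }
  assert (0 <= N) as HN.
  { destruct (Hsel _ (He O)) as [H1 _]; eapply Rle_trans; [apply norm_nonneg | exact H1]. }
  assert (forall k, norm (sel (fst (st k))) <= 2 * eps + N) as Hseln.
  { intros k; destruct (Hsel _ (He k)) as [H1 [H2 H3]]; destruct (He k) as [_ H4].
    rewrite norm_prod.
    pose proof (norm_le_sub (fst (sel (fst (st k)))) (fst (st k))) as H5.
    rewrite norm_sub_sym in H5; lra. }
  destruct (geometric_limit _ (fun k => snd (st k)) (2 * eps + N)) as [l Hl].
  { intros k; cbn [st snd].
    replace (snd (st k) +v (/ 2) ^ S k *v sel (fst (st k)) -v snd (st k)) with ((/ 2) ^ S k *v sel (fst (st k))) by vec.
    assert (0 < (/ 2) ^ k) by (apply pow_lt; lra).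
    rewrite norm_scal_nonneg by (left; apply pow_lt; lra); cbn [pow].
    pose proof (Hseln k); pose proof (norm_nonneg _ (sel (fst (st k)))); nra. }
  exists (snd l); apply Psi_closed; intros eta Heta.
  destruct (pow_half_small (3 * (2 * eps + N) + eps) eta Heta) as [k Hk]; specialize (Hk k (Nat.le_refl k)).
  exists (snd (st k) +v (/ 2) ^ k *v sel (fst (st k))), N.
  assert (0 < (/ 2) ^ k) as Hpk by (apply pow_lt; lra).
  repeat split; [apply Hcomb, (Hsel _ (He k)) | | lra].
  eapply Rle_lt_trans; [|exact Hk].
  replace (snd (st k) +v (/ 2) ^ k *v sel (fst (st k)) -v ((z0, snd l) : prod_space V W))
    with ((snd (st k) -v (z0, snd l)) +v (/ 2) ^ k *v sel (fst (st k))) by vec.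
  eapply Rle_trans; [apply norm_triangle|].
  rewrite norm_scal_nonneg, norm_prod by lra; proj_ops.
  pose proof (Hl k) as H1; rewrite norm_sub_sym, norm_prod in H1; revert H1; proj_ops; intros H1.
  pose proof (norm_nonneg _ (fst (snd (st k)) -v fst l)).
  assert (norm (fst (snd (st k)) -v z0) <= (/ 2) ^ k * eps).
  { rewrite (Hsum k) at 1.
    replace (fst (snd (st k)) -v (fst (snd (st k)) +v (/ 2) ^ S k *v fst (st k)))
      with (opp ((/ 2) ^ S k *v fst (st k))) by vec.
    rewrite norm_opp, norm_scal_nonneg by (left; apply pow_lt; lra).
    destruct (He k) as [_ H2]; cbn [pow]; pose proof (norm_nonneg _ (fst (st k))); nra. }
  pose proof (Hseln k); nra.
Qed.
End OpenMapping.

(** * Exactness of the conjugate of a composition *)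

Section Composition.
Context {X Y : NormedSpace} (A : LinCont X Y).

Lemma lmap_opp x : A (opp x) = opp (A x).
Proof. rewrite !opp_scal; apply lmap_scal. Qed.
Lemma lmap_zero : A zero = zero.
Proof. rewrite <- (scal_zero_l zero), lmap_scal, scal_zero_l; reflexivity. Qed.

Lemma lmap_bound : exists K, 0 <= K /\ forall x, norm (A x) <= K * norm x.
Proof.
  destruct (lmap_bnd X Y A) as [K HK]; exists (Rabs K); split; [apply Rabs_pos|].
  intros x; eapply Rle_trans; [apply HK|].
  apply Rmult_le_compat_r; [apply norm_nonneg | apply Rle_abs].
Qed.

Lemma dval_adj v x : dval (adj A v) x = dval v (A x).
Proof. reflexivity. Qed.
Lemma adj_add (v w : Dual Y) : adj A (v +v w) = adj A v +v adj A w.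
Proof. now apply dval_ext. Qed.
Lemma adj_scal a (v : Dual Y) : adj A (a *v v) = a *v adj A v.
Proof. now apply dval_ext. Qed.
Lemma adj_opp (v : Dual Y) : adj A (opp v) = opp (adj A v).
Proof. now apply dval_ext. Qed.

Lemma adj_norm K (v : Dual Y) : 0 <= K -> (forall x, norm (A x) <= K * norm x) -> norm (adj A v) <= K * norm v.
Proof.
  intros HK H; apply dnormf_le.
  - apply Rmult_le_pos; auto; apply (norm_nonneg (dual_space Y)).
  - intros x; rewrite dval_adj; eapply Rle_trans; [apply dval_norm_le|].
    rewrite (Rmult_comm K), Rmult_assoc; apply Rmult_le_compat_l; auto; apply (norm_nonneg (dual_space Y)).
Qed.

Lemma biadj_proof (p : Bidual X) :
  (forall (f g h : Dual Y) (a b : R), (forall x, dval h x = a * dval f x + b * dval g x) ->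
     bval p (adj A h) = a * bval p (adj A f) + b * bval p (adj A g)) /\
  (exists M, forall f : Dual Y, Rabs (bval p (adj A f)) <= M * dnormf (dval f)).
Proof.
  split.
  - intros f g h a b H; rewrite <- bval_lin; f_equal; apply dval_ext; intros x; apply H.
  - destruct (bval_bound p) as [N [HN0 HN]], lmap_bound as [K [HK0 HK]].
    exists (N * K); intros f; eapply Rle_trans; [apply HN|].
    rewrite Rmult_assoc; apply Rmult_le_compat_l; auto; now apply adj_norm.
Qed.
Definition biadj (p : Bidual X) : Bidual Y := exist _ _ (biadj_proof p).
Lemma bval_biadj p v : bval (biadj p) v = bval p (adj A v).
Proof. reflexivity. Qed.

Lemma hA_epi (h : Fun2 Y) z r :
  epi (hA A h) z r <-> forall eps, 0 < eps -> exists v, adj A v = snd z /\ epi h (A (fst z), v) (r + eps).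
Proof.
  unfold epi at 1, hA; rewrite Rbar_inf_le; split.
  - intros H eps Heps; destruct (H eps Heps) as [u [[v [Hv ->]] Hu]]; now exists v.
  - intros H eps Heps; destruct (H eps Heps) as [v [Hv Hu]].
    exists (h (A (fst z)) v); split; auto; now exists v.
Qed.

Lemma hA_le (h : Fun2 Y) x v r : epi h (A x, v) r -> epi (hA A h) (x, adj A v) r.
Proof.
  intros H; apply hA_epi; intros eps Heps; exists v; split; auto; eapply epi_up; eauto; lra.
Qed.

Lemma hA_convex (h : Fun2 Y) : convex_rel (epi h) -> convex_rel (epi (hA A h)).
Proof.
  intros H z w a b t Ht Hz Hw; apply hA_epi; intros eps Heps; rewrite hA_epi in Hz, Hw.
  destruct (Hz eps Heps) as [v [Hv Hzv]], (Hw eps Heps) as [v' [Hv' Hwv]].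
  exists (t *v v +v (1 - t) *v v'); split.
  - now rewrite adj_add, !adj_scal, Hv, Hv'.
  - proj_ops; rewrite lmap_add, !lmap_scal.
    eapply epi_up; [exact (H _ _ _ _ t Ht Hzv Hwv) | lra].
Qed.

Lemma hA_above (h : Fun2 Y) :
  (forall z r, epi h z r -> coupling z <= r) -> forall z r, epi (hA A h) z r -> coupling z <= r.
Proof.
  intros H z r Hz; apply le_epsilon; intros eps Heps; rewrite hA_epi in Hz.
  destruct (Hz eps Heps) as [v [Hv Hzv]].
  unfold coupling; rewrite <- Hv; exact (H _ _ Hzv).
Qed.
End Composition.

(* The conjugate of the composition is the infimal composition of [conj2 h] with
   [adj A], and the infimum is attained; stated through upper bounds. *)
Definition exact_conjugate {X Y : NormedSpace} (A : LinCont X Y) (h : Fun2 Y) : Prop :=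
  forall (f : Dual X) (p : Bidual X) r,
    (forall x v s, epi h (A x, v) s -> dval f x + bval p (adj A v) - s <= r) ->
    exists v, adj A v = f /\ Rbar_le (conj2 h v (biadj A p)) (Fin r).

Section Affine.
Context {V : NormedSpace} (D : V -> Prop).
Hypothesis D_zero : D zero.

(** The missing coefficient is placed on [zero], which lies in [D]; thus [aff D] is the linear
    span. *)
Lemma aff_of_comb l : Forall (fun q => D (snd q)) l -> aff D (lc_sum l).
Proof.
  intros Hl; exists ((1 - coef_sum l, zero) :: l); split; [now constructor|].
  cbn; split; [ring|]; now rewrite scal_zero_r, add_zero_l.
Qed.

Lemma aff_sub x : D x -> aff D x.
Proof.
  intros Hx; replace x with (lc_sum ((1, x) :: nil)) by (cbn [lc_sum]; vec).
  apply aff_of_comb; now constructor.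
Qed.

Lemma aff_scal a x : aff D x -> aff D (a *v x).
Proof.
  intros [l [Hl [_ ->]]].
  assert (exists l', Forall (fun q => D (snd q)) l' /\ a *v lc_sum l = lc_sum l') as [l' [Hl' ->]].
  2: now apply aff_of_comb.
  induction Hl as [|[b y] l Hy Hl [l' [Hl' E]]].
  - exists nil; split; auto; apply scal_zero_r.
  - exists ((a * b, y) :: l'); split; [now constructor|]; cbn [lc_sum].
    now rewrite scal_distr_l, scal_assoc, E.
Qed.

Lemma aff_add x y : aff D x -> aff D y -> aff D (x +v y).
Proof.
  intros [l [Hl [_ ->]]] [l' [Hl' [_ ->]]].
  replace (lc_sum l +v lc_sum l') with (lc_sum (l ++ l')).
  - apply aff_of_comb, Forall_app; auto.
  - clear Hl; induction l as [|[b z] l IH]; cbn [lc_sum app].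
    + now rewrite add_zero_l.
    + now rewrite IH, add_assoc.
Qed.

Lemma aff_diffset x : aff D x -> aff (diffset D D) x.
Proof.
  intros [l [Hl [H1 H2]]]; exists l; split; auto.
  eapply Forall_impl; [|exact Hl]; intros q Hq; exists (snd q), zero; repeat split; auto; vec.
Qed.
End Affine.

Section Qualification.
Context {X Y : NormedSpace} (A : LinCont X Y) (h : Fun2 Y).
Hypothesis h_convex : convex_rel (epi h).
Hypothesis h_closed : closed_rel (epi h).
Hypothesis h_meets : exists x v r, epi h (A x, v) r.

Lemma pr_dom_iff y : pr_dom h y <-> exists v r, epi h (y, v) r.
Proof.
  unfold epi; split.
  - intros [v Hv]; exists v; cbn [fst snd]; destruct (h y v) as [r| |]; [exists r | tauto | exists 0]; simpl; auto; lra.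
  - intros [v [r Hv]]; exists v; cbn [fst snd] in Hv; intros E; rewrite E in Hv; exact Hv.
Qed.

(* Attouch-Brezis: the value function of the perturbed problem is bounded above near 0
   in the closed space [aff D], hence minorized by [- r - K |z|]; separate it from this cone. *)
Lemma exact_of_interior : ic (diffset (pr_dom h) (imA A)) zero -> exact_conjugate A h.
Proof.
  intros [Hclosed Hicr] f p r HP.
  set (D := diffset (pr_dom h) (imA A)) in *.
  assert (forall y v s x, epi h (y, v) s -> D (y -v A x)) as HDin.
  { intros y v s x H; exists y, (A x); repeat split; [apply pr_dom_iff; eauto | now exists x]. }
  destruct h_meets as [x1 [v1 [r1 H1]]].
  assert (D zero) as HD0 by (rewrite <- (add_opp Y (A x1)); eapply HDin; eauto).
  destruct (bval_bound p) as [N [HN0 HN]], (lmap_bound A) as [KA [HK0 HK]].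
  (* The perturbed objective [h (A x + z, v) - f x - p (adj A v)] at [(z, (x, v))]. At [z = 0] it is
     at least [- r] by [HP]. *)
  set (Psi := fun (q : prod_space Y (prod_space X (dual_space Y))) s =>
    epi h (A (fst (snd q)) +v fst q, snd (snd q)) (s + dval f (fst (snd q)) + bval p (adj A (snd (snd q))))).
  assert (convex_rel Psi) as HPc.
  { intros q q' s s' t Ht Hq Hq'; unfold Psi in *.
    pose proof (h_convex _ _ _ _ t Ht Hq Hq') as H; revert H; proj_ops.
    rewrite adj_add, !adj_scal, bval_lin, dval_add, !dval_scal, lmap_add, !lmap_scal.
    unfold epi; proj_ops; intros H.
    match goal with H : Rbar_le (h ?a ?b) _ |- Rbar_le (h ?c _) _ => replace c with a by vec end.
    eapply Rbar_le_trans; [exact H|]; simpl; lra. }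
  assert (closed_rel Psi) as HPcl.
  { intros q s Hq; apply h_closed; intros eps Heps.
    pose proof (norm_nonneg (dual_space X) f) as Hf0.
    set (C := 2 + KA + norm f + N * KA).
    assert (0 <= N * KA) by (apply Rmult_le_pos; auto).
    assert (2 <= C) as HC by (unfold C; lra).
    destruct (Hq (eps / C)) as [q' [s' [Hq' [Hd Hs]]]]; [apply Rdiv_lt_0_compat; lra|].
    set (e := eps / C) in *.
    assert (C * e = eps) as HCe by (unfold e; field; lra).
    do 2 eexists; split; [exact Hq'|].
    rewrite norm_prod in Hd; revert Hd; proj_ops; intros Hd.
    pose proof (norm_prod (snd q' -v snd q)) as E; revert E; proj_ops; intros E; rewrite E in Hd; clear E.
    set (dz := norm (fst q' -v fst q)) in *.
    set (dx := norm (fst (snd q') -v fst (snd q))) in *.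
    set (dv := norm (snd (snd q') -v snd (snd q))) in *.
    assert (0 <= dz) by apply norm_nonneg; assert (0 <= dx) by apply norm_nonneg.
    assert (0 <= dv) by apply norm_nonneg.
    assert (KA * dx <= KA * e) by (apply Rmult_le_compat_l; lra).
    split.
    - rewrite norm_prod; proj_ops; fold dv.
      replace (A (fst (snd q')) +v fst q' -v (A (fst (snd q)) +v fst q))
        with (A (fst (snd q') -v fst (snd q)) +v (fst q' -v fst q)) by (rewrite lmap_add, lmap_opp; vec).
      pose proof (norm_triangle _ (A (fst (snd q') -v fst (snd q))) (fst q' -v fst q)) as Hx2; fold dz in Hx2.
      pose proof (HK (fst (snd q') -v fst (snd q))) as Hx3; fold dx in Hx3.
      assert (0 <= (norm f + N * KA) * e) by (apply Rmult_le_pos; [lra | left; apply Rdiv_lt_0_compat; lra]).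
      unfold C in HCe; lra.
    - pose proof (dval_norm_le f (fst (snd q') -v fst (snd q))) as Hx2; rewrite dval_add, dval_opp in Hx2; fold dx in Hx2.
      pose proof (HN (adj A (snd (snd q') -v snd (snd q)))) as Hx3; apply Rabs_le_inv in Hx3.
      pose proof (adj_norm A KA (snd (snd q') -v snd (snd q)) HK0 HK) as Hx4; fold dv in Hx4.
      apply (Rmult_le_compat_l N) in Hx4; auto.
      rewrite adj_add, adj_opp, bval_add, bval_opp in Hx3.
      rewrite adj_add, adj_opp in Hx4.
      assert (norm f * dx <= norm f * e) by (apply Rmult_le_compat_l; lra).
      assert (N * KA * dv <= N * KA * e) by (apply Rmult_le_compat_l; lra).
      assert (0 <= KA * e) by (apply Rmult_le_pos; lra).
      unfold C in HCe; lra. }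
  destruct (open_mapping Y (prod_space X (dual_space Y)) Psi (aff D)) as [K [eps [Heps HKe]]]; auto.
  - intros; now apply aff_add.
  - intros; now apply aff_scal.
  - intros q s Hq; apply aff_sub; auto.
    replace (fst q) with (A (fst (snd q)) +v fst q -v A (fst (snd q))) by vec.
    eapply HDin; exact Hq.
  - intros z Hz; apply aff_diffset in Hz; auto.
    destruct (Hicr z Hz) as [d [Hd Hd']].
    destruct (Hd' d) as [y [b [Hy [[x ->] E]]]]; [lra|].
    apply pr_dom_iff in Hy; destruct Hy as [v [s Hv]].
    exists d, (x, v), (s - dval f x - bval p (adj A v)); split; auto.
    unfold Psi; cbn [fst snd].
    replace (A x +v d *v z) with y.
    + replace (s - dval f x - bval p (adj A v) + dval f x + bval p (adj A v)) with s by ring; auto.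
    + rewrite <- (add_zero_l (d *v z)), E; vec.
  - apply aff_sub; auto.
  - assert (forall w s, Psi (zero, w) s -> - r <= s) as Hmin.
    { intros [x v] s H; unfold Psi in H; cbn [fst snd] in H; rewrite add_zero in H.
      specialize (HP _ _ _ H); lra. }
    set (K' := (K + r) / eps).
    assert (K' * eps = K + r) as HK' by (unfold K'; field; lra).
    assert (0 <= K') as HK'0.
    { destruct (HKe zero) as [w Hw]; [now apply aff_sub, HD0 | rewrite norm_zero; lra|].
      apply Hmin in Hw; apply Rmult_le_pos; [lra | left; now apply Rinv_0_lt_compat]. }
    assert (forall z w s, Psi (z, w) s -> - r - K' * norm z <= s) as Hlow.
    { intros z w s H; pose proof (norm_nonneg _ z) as Hz.
      set (n := norm z) in *; destruct Hz as [Hz|Hz].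
      2: { rewrite <- Hz; unfold n in Hz; symmetry in Hz; apply norm_eq0 in Hz; subst z.
           apply Hmin in H; lra. }
      (* [z] and its opposite multiple of norm [eps] average to [zero], where values are at least
         [- r]; the bound [K] at the opposite point then bounds [s] below. *)
      destruct (HKe ((- (eps / n)) *v z)) as [w' Hw'].
      { apply aff_scal; auto; apply aff_sub; auto.
        replace z with (A (fst w) +v z -v A (fst w)) by vec; eapply HDin; exact H. }
      { rewrite norm_scal, Rabs_Ropp, Rabs_pos_eq by (left; now apply Rdiv_lt_0_compat).
        fold n; right; field; lra. }
      assert (0 <= eps / (eps + n) <= 1) as Ht.
      { split; [left; apply Rdiv_lt_0_compat; lra|].
        apply (Rmult_le_reg_r (eps + n)); [lra|].
        replace (eps / (eps + n) * (eps + n)) with eps by (field; lra); lra. }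
      pose proof (HPc _ _ _ _ _ Ht H Hw') as H2.
      set (q := eps / (eps + n) *v (z, w) +v (1 - eps / (eps + n)) *v (- (eps / n) *v z, w')) in *.
      assert (q = (zero, snd q)) as E.
      { apply pair_eq; auto; unfold q; proj_ops; vec_coefs; field; lra. }
      rewrite E in H2; apply Hmin in H2.
      apply (Rmult_le_compat_r (eps + n)) in H2; [|lra].
      replace ((eps / (eps + n) * s + (1 - eps / (eps + n)) * K) * (eps + n)) with (eps * s + n * K) in H2
        by (field; lra).
      apply (Rmult_le_reg_l eps); auto.
      replace (eps * (- r - K' * n)) with (- r * eps - (K' * eps) * n) by ring.
      rewrite HK'; lra. }
    destruct (sandwich Y (fun z s => exists w, Psi (z, w) s) (fun z s => K' * norm z + r <= s)
      (A x1 -v A x1) (r1 - dval f x1 - bval p (adj A v1)) (K' * 1 + r) 1) as [l Hl]; auto; try lra.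
    + intros z z' s s' t Ht [w Hw] [w' Hw'].
      exists (t *v w +v (1 - t) *v w'); exact (HPc _ _ _ _ t Ht Hw Hw').
    + intros z z' s s' t Ht Hz Hz'.
      pose proof (norm_triangle _ (t *v z) ((1 - t) *v z')) as H.
      rewrite !norm_scal_nonneg in H by lra.
      apply (Rmult_le_compat_l K') in H; auto.
      apply (Rmult_le_compat_l t) in Hz; [|lra].
      apply (Rmult_le_compat_l (1 - t)) in Hz'; [|lra]; lra.
    + intros z s s' [w Hw] Hs; apply Hlow in Hw; lra.
    + exists (x1, v1); unfold Psi; cbn [fst snd].
      replace (A x1 +v (A x1 -v A x1)) with (A x1) by vec.
      replace (r1 - dval f x1 - bval p (adj A v1) + dval f x1 + bval p (adj A v1)) with r1 by ring; auto.
    + intros z Hz; replace (A x1 -v A x1 +v z) with z by vec.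
      apply Rplus_le_compat_r, Rmult_le_compat_l; auto.
    + assert (forall y g s x, epi h (y, g) s ->
         - dval l y + bval p (adj A g) - s <= r - dval f x - dval l (A x)) as Hsep.
      { intros y g s x H.
        assert (Psi (y -v A x, (x, g)) (s - dval f x - bval p (adj A g))) as HPsi.
        { unfold Psi; cbn [fst snd].
          replace (A x +v (y -v A x)) with y by vec.
          replace (s - dval f x - bval p (adj A g) + dval f x + bval p (adj A g)) with s by ring; auto. }
        pose proof (Hl (y -v A x) _ zero r (ex_intro (fun w => Psi (y -v A x, w) _) (x, g) HPsi)) as H2; cbv beta in H2.
        rewrite norm_zero, dval_zero, dval_add, dval_opp in H2; specialize (H2 ltac:(lra)); lra. }
      (* [Hsep] bounds this linear functional of [x] above, so it vanishes and [f] is the adjoint of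
         [opp l]. *)
      assert (forall x, dval f x + dval l (A x) <= 0) as Hneg.
      { intros x; apply Rnot_lt_le; intros Hlt.
        set (u := dval f x + dval l (A x)) in *.
        set (b := r - (- dval l (A x1) + bval p (adj A v1) - r1)).
        pose proof (Hsep (A x1) v1 r1 ((Rabs b + 1) / u *v x) H1) as H2.
        rewrite lmap_scal, !dval_scal in H2.
        assert ((Rabs b + 1) / u * dval f x + (Rabs b + 1) / u * dval l (A x) = Rabs b + 1).
        { rewrite <- Rmult_plus_distr_l; fold u; field; lra. }
        pose proof (Rle_abs b); unfold b in *; lra. }
      exists (opp l : dual_space Y); split.
      * apply dval_ext; intros x; rewrite dval_adj, dval_dopp.
        pose proof (Hneg x); pose proof (Hneg (opp x)) as H2.
        rewrite lmap_opp, !dval_opp in H2; lra.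
      * apply conj2_le; intros [y g] s Hs; cbn [fst snd].
        rewrite dval_dopp, bval_biadj.
        pose proof (Hsep y g s zero Hs) as H2; rewrite lmap_zero, !dval_zero in H2; lra.
Qed.

Hypothesis h_above : forall z r, epi h z r -> coupling z <= r.
Hypothesis h_contact : exists z, contact (epi h) z.

(** [E] is the epigraph of the infimal composition, so exactness says that [(f, biadj A p, r)]
    belongs to it; by closedness it suffices to refute a separation by finitely many tests. The sign
    of the coefficient [s] on the value decides the argument. *)
Lemma exact_of_closedness :
  closed_regarding3
    (fun a b r => exists v : Dual Y, adj A v = a /\ Rbar_le (conj2 h v b) (Fin r))
    (fun _ b _ => imA2 A b) -> exact_conjugate A h.
Proof.
  intros Hclosed f p r HP.
  set (E := fun a b r => exists v : Dual Y, adj A v = a /\ Rbar_le (conj2 h v b) (Fin r)) in *.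
  assert (E f (biadj A p) r); [|auto].
  apply (Hclosed f (biadj A p) r); split; [|now exists p].
  intros xs fs eps Heps; apply NNPP; intros Hn.
  (* A contact point supplies the affine minorant for Fenchel-Moreau and a member of [E]. *)
  destruct h_contact as [zc Hzc].
  destruct h_meets as [x1 [v1 [r1 H1]]].
  pose proof (fun w s => contact_conj (epi h) zc w s h_convex h_above Hzc) as Hminor.
  assert (E (adj A (snd zc)) (embed (fst zc)) (coupling zc)) as HEc.
  { exists (snd zc); split; auto; apply conj2_le; exact Hminor. }
  assert (forall z0 t0, (forall v q rho, E (adj A v) q rho -> dval v (fst z0) + bval q (snd z0) - rho <= t0) ->
    epi h z0 t0) as Hfm.
  { intros z0 t0 H.
    assert (exists l : Dual (dual_pair Y), forall z, dval l z = dval (snd zc) (fst z) + dval (snd z) (fst zc)) as [l0 Hl0].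
    { assert (is_linear_fun (dual_pair Y) (fun z => dval (snd zc) (fst z) + dval (snd z) (fst zc)) /\
              is_bounded_fun (dual_pair Y) (fun z => dval (snd zc) (fst z) + dval (snd z) (fst zc))) as Hl.
      { split; [split|].
        - intros z w; proj_ops; rewrite dval_add, dval_dadd; ring.
        - intros a z; proj_ops; rewrite dval_scal, dval_dscal; ring.
        - exists (norm (snd zc) + norm (fst zc)); intros z; eapply Rle_trans; [apply Rabs_triang|].
          pose proof (dval_bound (snd zc) (fst z)); pose proof (dval_bound (snd z) (fst zc)).
          rewrite norm_prod.
          pose proof (norm_nonneg _ (fst z)); pose proof (norm_nonneg _ (snd z)).
          pose proof (norm_nonneg _ (fst zc)); pose proof (norm_nonneg _ (snd zc)).
          change (dnormf (dval (snd zc))) with (norm (snd zc)) in *.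
          change (dnormf (dval (snd z))) with (norm (snd z)) in *; nra. }
      now exists (exist (fun g : dual_pair Y -> R => is_linear_fun _ g /\ is_bounded_fun _ g) _ Hl). }
    apply (fenchel_moreau (dual_pair Y) (epi h) l0 (coupling zc)); auto.
    - now exists (A x1, v1), r1.
    - intros z s Hz; rewrite Hl0; specialize (Hminor z s Hz); lra.
    - intros l rho Hl; destruct (dual_prod_split Y l) as [v [q Hvq]].
      rewrite Hvq; apply H; exists v; split; auto.
      apply conj2_le; intros z s Hz; specialize (Hl z s Hz); rewrite Hvq in Hl; lra. }
  destruct (finite_separation (Dual X * Bidual Y * R)
    (fun phi => exists (x : X) (g : dual_space Y) s,
       forall u, phi u = dval (fst (fst u)) x + bval (snd (fst u)) g + s * snd u))
    with (K := fun u => E (fst (fst u)) (snd (fst u)) (snd u)) (u0 := (f, biadj A p, r))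
      (fs := (fun u => snd u) :: map (fun x u => dval (fst (fst u)) x) xs ++ map (fun g u => bval (snd (fst u)) g) fs)
      (eps := eps) as [phi [[x [g [s Hphi]]] Hsep]]; auto.
  - exists zero, zero, 0; intros u; rewrite dval_zero, bval_zero; ring.
  - intros a f1 f2 [x [g [s H]]] [x' [g' [s' H']]].
    exists (a *v x +v 1 *v x'), (a *v g +v 1 *v g'), (a * s + s'); intros u.
    rewrite H, H', dval_add, !dval_scal, bval_lin; ring.
  - intros [[a b] ra] [[a' b'] rb] t Ht [v [Hv Hva]] [v' [Hv' Hvb]]; cbn [fst snd] in *.
    exists (t *v a +v (1 - t) *v a' : dual_space X, blin b b' t (1 - t), t * ra + (1 - t) * rb); split.
    + exists (t *v v +v (1 - t) *v v'); cbn [fst snd]; split.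
      * now rewrite adj_add, !adj_scal, Hv, Hv'.
      * rewrite conj2_le in *; intros z s Hz.
        pose proof (Rmult_le_compat_l t _ _ (proj1 Ht) (Hva z s Hz)).
        pose proof (Rmult_le_compat_l (1 - t) _ _ ltac:(lra) (Hvb z s Hz)).
        rewrite dval_dadd, !dval_dscal, bval_blin; lra.
    + intros phi [x [g [s H]]]; rewrite !H; cbn [fst snd].
      rewrite dval_dadd, !dval_dscal, bval_blin; ring.
  - now exists (adj A (snd zc), embed (fst zc), coupling zc).
  - constructor; [|apply Forall_app; split; apply Forall_forall; intros phi H; apply in_map_iff in H].
    + exists zero, zero, 1; intros u; rewrite dval_zero, bval_zero; ring.
    + destruct H as [x [<- _]]; exists x, zero, 0; intros u; rewrite bval_zero; ring.
    + destruct H as [g [<- _]]; exists zero, g, 0; intros u; rewrite dval_zero; ring.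
  - intros [[a b] s] Hu; cbn [fst snd] in Hu.
    apply NNPP; intros Hfar; apply Hn; exists a, b, s; repeat split; auto.
    + intros x Hx; apply Rnot_le_lt; intros Hle; apply Hfar.
      exists (fun u => dval (fst (fst u)) x); split; auto; right; apply in_or_app; left; now apply (in_map (fun x u => dval (fst (fst u)) x)).
    + intros g Hg; apply Rnot_le_lt; intros Hle; apply Hfar.
      exists (fun u => bval (snd (fst u)) g); split; auto; right; apply in_or_app; right; now apply (in_map (fun g u => bval (snd (fst u)) g)).
    + apply Rnot_le_lt; intros Hle; apply Hfar; exists (fun u => snd u); split; auto; now left.
  - assert (forall v q rho, E (adj A v) q rho ->
      dval f x + bval p (adj A g) + s * r + eps <= dval v (A x) + bval q g + s * rho) as Hs.
    { intros v q rho H; pose proof (Hsep (adj A v, q, rho) H) as H2.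
      rewrite !Hphi in H2; cbn [fst snd] in H2; rewrite bval_biadj, dval_adj in H2; exact H2. }
    set (kappa := dval f x + bval p (adj A g) + eps).
    destruct (Rtotal_order s 0) as [Hs0|[->|Hs0]].
    (* [E] is upward closed in the value, so raising the value of one member violates the
       separation. *)
    + set (c := dval (snd zc) (A x) + bval (embed (fst zc)) g + s * coupling zc - (dval f x + bval p (adj A g) + s * r + eps)).
      set (n := (Rabs c + 1) / - s).
      assert (s * n = - (Rabs c + 1)) as Hsn by (unfold n; field; lra).
      assert (0 <= n) as Hn0.
      { left; apply Rdiv_lt_0_compat; [pose proof (Rabs_pos c)|]; lra. }
      assert (E (adj A (snd zc)) (embed (fst zc)) (coupling zc + n)) as HE2.
      { destruct HEc as [v [Hv Hc]]; exists v; split; auto.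
        eapply Rbar_le_trans; [exact Hc|]; simpl; lra. }
      apply Hs in HE2; pose proof (Rle_abs c); unfold c in *; lra.
    (* Vertical separation: subtracting [t (x, g)] from [(x1, v1)] lowers the bound on [h] by
       [t kappa], and the objective in [HP] gains [t eps]. *)
    + set (c := dval f x1 + bval p (adj A v1) - r1).
      set (t := (Rabs (r - c) + 1) / eps).
      assert (t * eps = Rabs (r - c) + 1) as Hte by (unfold t; field; lra).
      assert (0 < t) as Ht by (apply Rdiv_lt_0_compat; [pose proof (Rabs_pos (r - c))|]; lra).
      assert (epi h (A (x1 -v t *v x), v1 -v t *v g) (r1 - t * kappa)) as Hepi.
      { apply Hfm; intros v q rho H; cbn [fst snd].
        pose proof (Hs _ _ _ H) as H2; destruct H as [v' [Hv' Hq]].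
        rewrite conj2_le in Hq; pose proof (Hq _ _ H1) as H3; cbn [fst snd] in H3.
        (* [E] records [v] only through its adjoint image, which determines it on the range of
           [A]. *)
        assert (dval v' (A x1) = dval v (A x1)) as E1.
        { now rewrite <- !(dval_adj A), Hv'. }
        rewrite lmap_add, lmap_opp, lmap_scal, dval_add, dval_opp, dval_scal, bval_add, bval_opp, bval_scal.
        assert (t * kappa <= t * (dval v (A x) + bval q g)) by (apply Rmult_le_compat_l; unfold kappa; lra).
        lra. }
      apply HP in Hepi.
      rewrite adj_add, adj_opp, adj_scal, dval_add, dval_opp, dval_scal, bval_add, bval_opp, bval_scal in Hepi.
      pose proof (Rle_abs (r - c)); unfold kappa, c in *; lra.
    (* Division by [- s] turns the separation into a bound over all conjugate values; Fenchel-Moreau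
       then gives a point of the epigraph that beats [r] by [eps / s]. *)
    + assert (epi h (A ((- / s) *v x), (- / s) *v g) (dval f ((- / s) *v x) + bval p (adj A ((- / s) *v g)) - r - eps / s)) as Hepi.
      { apply Hfm; intros v q rho H; cbn [fst snd].
        pose proof (Hs _ _ _ H) as H2.
        rewrite lmap_scal, adj_scal, !dval_scal, !bval_scal.
        apply (Rmult_le_reg_l s); auto.
        replace (s * (- / s * dval v (A x) + - / s * bval q g - rho)) with (- (dval v (A x) + bval q g + s * rho))
          by (field; lra).
        replace (s * (- / s * dval f x + - / s * bval p (adj A g) - r - eps / s))
          with (- (dval f x + bval p (adj A g) + s * r + eps)) by (field; lra).
        lra. }
      apply HP in Hepi.
      assert (0 < eps / s) by now apply Rdiv_lt_0_compat.
      lra.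
Qed.
End Qualification.

(** * The composition A* T A *)

(** Adjoining the single related point to [T] gives a monotone extension. *)
Lemma max_monotone_related {V : NormedSpace} (T : Oper V) x v :
  max_monotone T ->
  (forall y g, T y g -> 0 <= dval v x - dval v y - dval g x + dval g y) -> T x v.
Proof.
  intros [Hmon Hmax] H.
  apply (Hmax (fun y g => T y g \/ (y = x /\ g = v))); auto.
  intros y g z k [Hy|[-> ->]] [Hz|[-> ->]]; auto.
  - pose proof (H y g Hy); lra.
  - lra.
Qed.

Lemma max_monotone_inhabited {V : NormedSpace} (T : Oper V) : max_monotone T -> exists y g, T y g.
Proof.
  intros HT; apply NNPP; intros Hn.
  apply Hn; exists zero, (zero : dual_space V); apply max_monotone_related; auto.
  intros y g Hy; exfalso; apply Hn; eauto.
Qed.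

Lemma exact_of_qualification {X Y : NormedSpace} (A : LinCont X Y) (T : Oper Y) (h : Fun2 Y) :
  max_monotone T -> representative T h ->
  (exists y, pr_dom h y /\ imA A y) ->
  ( ic (diffset (pr_dom h) (imA A)) zero
    \/ closed_regarding3
         (fun a b r => exists v : Dual Y, adj A v = a /\ Rbar_le (conj2 h v b) (Fin r))
         (fun _ b _ => imA2 A b) ) ->
  exact_conjugate A h.
Proof.
  intros HT [Hconv [Hlsc [Habove Hgraph]]] [y [Hy [x ->]]] Hq.
  rewrite convex2_iff in Hconv; rewrite norm_lsc_iff in Hlsc; rewrite above_coupling_iff in Habove.
  apply pr_dom_iff in Hy; destruct Hy as [v [r Hv]].
  assert (exists x v r, epi h (A x, v) r) as Hmeets by eauto.
  destruct Hq as [Hq|Hq]; [now apply exact_of_interior|].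
  apply exact_of_closedness; auto.
  destruct (max_monotone_inhabited T HT) as [z [g Hz]].
  exists (z, g); unfold contact, epi; cbn [fst snd]; rewrite (Hgraph z g Hz); apply Rbar_le_refl.
Qed.

Section Composition.
Context {X Y : NormedSpace} (A : LinCont X Y) (T : Oper Y) (h : Fun2 Y).
Hypothesis T_max : max_monotone T.
Hypothesis h_strong : strong_representative T h.
Hypothesis h_exact : exact_conjugate A h.

Let hull := lsc_hull (hA A h).

Lemma composition_convex : convex_rel (epi hull).
Proof.
  destruct h_strong as [[H _] _]; apply lsc_hull_convex, hA_convex; now apply convex2_iff.
Qed.

Lemma composition_closed : closed_rel (epi hull).
Proof. apply lsc_hull_closed. Qed.

Lemma composition_above z r : epi hull z r -> coupling z <= r.
Proof.
  destruct h_strong as [[_ [_ [H _]]] _]; rewrite above_coupling_iff in H.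
  intros Hz; apply coupling_le_limit; intros eps Heps.
  destruct (proj1 (lsc_hull_epi _ _ _) Hz eps Heps) as [w [Hd Hw]].
  exists w; split; auto; exact (hA_above A h H _ _ Hw).
Qed.

Lemma composition_conj : conj_above (epi hull).
Proof.
  intros f p r H.
  destruct (h_exact f p r) as [v [<- Hv]].
  { intros x v s Hs; apply (H (x, adj A v) s), lsc_hull_le, hA_le, Hs. }
  rewrite <- bval_biadj; destruct h_strong as [_ Hc].
  exact (Rbar_le_trans _ _ _ (Hc v (biadj A p)) Hv).
Qed.

(** At a contact point the conjugate is at most the coupling. Exactness produces [v] with adjoint
    image [f] and conjugate at most [v (A x)]; evaluating this on the graph of [T], where [h] is the
    coupling, shows that [(A x, v)] is monotonically related to [T]. *)
Lemma composition_graph x f : compTA A T x f <-> contact (epi hull) (x, f).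
Proof.
  destruct h_strong as [[_ [_ [_ Hgraph]]] _]; split.
  - intros [v [HT <-]]; apply lsc_hull_le, hA_le.
    unfold epi; cbn [fst snd]; rewrite (Hgraph _ _ HT); apply Rbar_le_refl.
  - intros Hc.
    destruct (h_exact f (embed x) (coupling ((x, f) : dual_pair X))) as [v [Hv Hle]].
    { intros x' v s Hs.
      pose proof (contact_conj (epi hull) (x, f) (x', adj A v) s composition_convex composition_above Hc) as H.
      apply H, lsc_hull_le, hA_le, Hs. }
    exists v; split; auto; apply max_monotone_related; auto.
    intros y g Hy; rewrite conj2_le in Hle.
    assert (epi h (y, g) (dval g y)) as Hyg.
    { unfold epi; cbn [fst snd]; rewrite (Hgraph _ _ Hy); apply Rbar_le_refl. }
    apply Hle in Hyg; unfold coupling in Hyg; cbn [fst snd] in Hyg.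
    rewrite bval_biadj, bval_embed, dval_adj, <- Hv, dval_adj in Hyg; lra.
Qed.

Lemma composition_strong : strong_representative (compTA A T) hull.
Proof.
  split; [split; [|split; [|split]]|].
  - apply convex2_iff, composition_convex.
  - apply norm_lsc_iff, composition_closed.
  - apply above_coupling_iff, composition_above.
  - intros x f Hx; apply Rbar_le_antisym.
    + now apply composition_graph in Hx.
    + apply above_coupling_iff; exact composition_above.
  - apply conj_above_iff, composition_conj.
Qed.

Lemma composition_max_monotone : max_monotone (compTA A T).
Proof.
  destruct T_max as [Hmon _]; split.
  - intros x f z g [v [Hv <-]] [w [Hw <-]]; rewrite !dval_adj; auto.
  - intros S HS Hsub x f Hx; apply composition_graph.
    apply contact_maximal;
      auto using composition_convex, composition_closed, composition_conj; [exact composition_above|].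
    intros [z g] Hz; apply composition_graph, Hsub in Hz.
    rewrite coupling_sub; unfold coupling; cbn [fst snd].
    pose proof (HS _ _ _ _ Hx Hz); lra.
Qed.

Lemma composition_gossez_D : gossez_D (compTA A T).
Proof.
  split; [exact composition_max_monotone|]; intros p f Hpf.
  destruct (contact_approximation (epi hull) composition_convex composition_closed
    composition_above composition_conj f p) as [B HB].
  { intros [z g] Hz; apply composition_graph in Hz; unfold coupling; cbn [fst snd].
    pose proof (Hpf z g Hz); lra. }
  (* An index pairs finitely many tests with a precision [2^-n], and a contact point is chosen for
     each. *)
  destruct (choice (fun (i : list (Dual X) * nat) (z : dual_pair X) =>
    contact (epi hull) z /\ norm (fst z) <= B /\ norm (snd z) <= B /\
    (forall g, In g (fst i) -> Rabs (dval g (fst z) - bval p g) < (/ 2) ^ snd i) /\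
    norm (snd z -v f) < (/ 2) ^ snd i)) as [net Hnet].
  { intros [F n]; apply HB, pow_lt; lra. }
  assert (forall (n : nat) (i : list (Dual X) * nat), (n <= snd i)%nat -> forall eps, 1 * (/ 2) ^ n < eps -> (/ 2) ^ snd i < eps) as Hpow.
  { intros n i Hi eps Heps; eapply Rle_lt_trans; [|exact Heps].
    replace (snd i) with (n + (snd i - n))%nat by lia; rewrite pow_add, (Rmult_comm 1).
    apply Rmult_le_compat_l; [apply pow_le; lra|].
    rewrite <- (pow1 (snd i - n)); apply pow_incr; lra. }
  exists (list (Dual X) * nat)%type, (fun i j => incl (fst i) (fst j) /\ (snd i <= snd j)%nat), net.
  split; [|split; [|split; [|split]]].
  - split; [exact (inhabits (nil, O))|]; split; [|split].
    + intros i; split; [apply incl_refl | apply Nat.le_refl].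
    + intros i j k [H1 H2] [H3 H4]; split; [eapply incl_tran; eauto | lia].
    + intros [F m] [F' n]; exists (F ++ F', max m n); cbn [fst snd].
      repeat split; try lia; [apply incl_appl | apply incl_appr]; apply incl_refl.
  - intros i; apply composition_graph; rewrite <- surjective_pairing; apply Hnet.
  - exists B; intros i; destruct (Hnet i) as [_ [H1 [H2 _]]]; now split.
  - intros g eps Heps; destruct (pow_half_small 1 eps Heps) as [n Hn]; specialize (Hn n (Nat.le_refl n)).
    exists (g :: nil, n); intros i [Hi1 Hi2]; cbn [fst snd] in *.
    apply Rlt_trans with ((/ 2) ^ snd i); [apply Hnet, Hi1; now left | eauto].
  - intros eps Heps; destruct (pow_half_small 1 eps Heps) as [n Hn]; specialize (Hn n (Nat.le_refl n)).
    exists (nil, n); intros i [_ Hi]; cbn [fst snd] in *.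
    apply Rlt_trans with ((/ 2) ^ snd i); [apply (Hnet i) | eauto].
Qed.
End Composition.

Theorem theorem4p6 (X Y : NormedSpace) (A : LinCont X Y) (T : Oper Y) (hT : Fun2 Y) :
  nonzero_space X -> nonzero_space Y ->
  gossez_D T ->
  strong_representative T hT ->
  (exists y, pr_dom hT y /\ imA A y) ->
  ( ic (diffset (pr_dom hT) (imA A)) zero
    \/ closed_regarding3
         (fun a b r => exists v : Dual Y, adj A v = a /\ Rbar_le (conj2 hT v b) (Fin r))
         (fun _ b _ => imA2 A b) ) ->
  strong_representative (compTA A T) (lsc_hull (hA A hT)) /\ gossez_D (compTA A T).
Proof.
  intros _ _ [HT _] Hstrong Hmeets Hq.
  assert (exact_conjugate A hT) as Hexact
    by (eapply exact_of_qualification; eauto; apply Hstrong).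
  split; [now apply composition_strong | now apply composition_gossez_D with hT].
Qed.
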